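(* Let $\pi : (M, g_0) \rightarrow (N, g_N)$ be a Riemannian submersion with totally umbilical fibers. If there exists a non-trivial variation $\{ g_t, t \in (-\epsilon, \epsilon) \} \subset \mathrm{Riem}(M, \mathcal{V}, g_0)$ such that $\pi : (M, g_t) \rightarrow (N, g_N)$ is a Riemannian submersion with totally umbilical fibers for all $t \in (-\epsilon, \epsilon)$, then there exists a non-trivial vertical vector field $\xi$ on $M$ whose restriction to $(\mathcal{F}_{x} , g_0 \vert_{\mathcal{F}_{x}})$ is a conformal Killing field for all $x \in N$. On the other hand, if on $(M, g_0)$ there exists a non-trivial bounded vertical vector field $\xi$ whose restriction to every fiber of $\pi$ (with the metric induced by $g_0$) is conformal Killing, then there exists a non-trivial variation $\{ g_t, t \in (-\epsilon, \epsilon) \} \subset \mathrm{Riem}(M, \mathcal{V}, g_0)$ such that $\pi : (M, g_t) \rightarrow (N, g_N)$ is a Riemannian submersion with totally umbilical fibers for all $t \in (-\epsilon, \epsilon)$.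
   Context: Manifolds are smooth, connected and oriented; all functions and tensor fields are smooth. A Riemannian submersion $\pi:(M,g)\to(N,g_N)$ is a smooth map with $\operatorname{rank}\pi_*=\dim N$ and $g(X,Y)=g_N(\pi_*X,\pi_*Y)$ for all $X,Y$ that are $g$-orthogonal to $\ker\pi_*$. $\mathcal{V}=\ker\pi_*$ is the vertical distribution, $n=\dim\mathcal{V}$; vertical vector fields are those with values in $\mathcal{V}$; $\mathcal{F}_x=\pi^{-1}(\{x\})$ is the fiber over $x\in N$. $\mathrm{Riem}(M,\mathcal{V},g_0)$ is the set of Riemannian metrics $g$ on $M$ with $g(X,Y)=g_0(X,Y)$ for all vertical $X,Y$. A variation of $g_0$ is a one-parameter family $\{g_t, t\in(-\epsilon,\epsilon)\}\subset \mathrm{Riem}(M,\mathcal{V},g_0)$ depending smoothly on $t$, whose member at $t=0$ is $g_0$; it is non-trivial if $g_t\neq g_0$ for some $t$. A vector field is non-trivial if it is not everywhere zero, and bounded on $(M,g)$ if $g(X,X)$ is a bounded function. The second fundamental form of the fibers is $h_t(X,Y)=P_{\mathcal{H}}^t\nabla^t_XY$ for vertical $X,Y$, where $\nabla^t$ is the Levi-Civita connection of $g_t$ and $P_{\mathcal{H}}^t$ is the $g_t$-orthogonal projection onto the $g_t$-orthogonal complement $\mathcal{H}(t)$ of $\mathcal{V}$; the mean curvature of the fibers is $H_t=\sum_{a=1}^n h_t(E_a,E_a)$ for a local $g_t$-orthonormal frame $\{E_1,\ldots,E_n\}$ of $\mathcal{V}$. The fibers of $\pi:(M,g_t)\to(N,g_N)$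 are totally umbilical if $h_t(X,Y)=\frac1n g_t(X,Y)H_t$ for all vertical $X,Y$.
   Formalization: The formal theorem assumes dim N ≥ 1; for N a point (e.g. the round 2-sphere mapped to a point, with a rotation field) every vector is vertical, so Riem(M,V,g_0) = {g_0} has no non-trivial variation and the second half fails. *)

(* Defs.v *)
From HB Require Import structures.
From mathcomp Require Import all_boot all_order all_algebra.
From mathcomp Require Import all_classical all_reals all_analysis.

Set Implicit Arguments.
Unset Strict Implicit.
Unset Printing Implicit Defensive.

Import Order.TTheory GRing.Theory Num.Theory.
Import numFieldNormedType.Exports.

Local Open Scope classical_set_scope.
Local Open Scope ring_scope.

(* C^k and C^oo maps on an open subset U of a finite-dimensional space V. *)
Fixpoint Ck (R : realType) (V W : normedModType R) (k : nat) (U : set V)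
    (f : V -> W) : Prop :=
  match k with
  | 0 => forall x, U x -> {for x, continuous f}
  | k'.+1 => (forall x, U x -> differentiable f x) /\
             forall v : V, Ck k' U (fun x => 'd f x v)
  end.

Definition Csmooth (R : realType) (V W : normedModType R) (U : set V)
    (f : V -> W) : Prop := forall k, Ck k U f.

(* The values of cmap outside cdom, and of cinv outside cmap @` cdom, are
   irrelevant. *)
Record chart (R : realType) (m : nat) (M : topologicalType) := Chart {
  cdom : set M;
  cmap : M -> 'rV[R]_m;
  cinv : 'rV[R]_m -> M }.

Definition is_chart (R : realType) (m : nat) (M : topologicalType)
    (c : chart R m M) : Prop :=
  [/\ open (cdom c),
      open (cmap c @` cdom c),
      forall q, cdom c q -> cinv c (cmap c q) = q,
      forall q, cdom c q -> {for q, continuous (cmap c)} &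
      forall y, (cmap c @` cdom c) y -> {for y, continuous (cinv c)}].

Definition transition (R : realType) (m : nat) (M : topologicalType)
    (c c' : chart R m M) : 'rV[R]_m -> 'rV[R]_m := cmap c' \o cinv c.

(* Smooth connected oriented m-manifolds. The atlas is oriented: all transition
   maps have positive Jacobian determinant. As an atlas may be indexed with
   repetitions, we index it by the points of M, the chart of index q being
   a chart around q; it serves to write down the tangent vectors at q. *)
Record manifold (R : realType) (m : nat) := Manifold {
  mcarrier :> topologicalType;
  chart_at : mcarrier -> chart R m mcarrier;
  manifold_hausdorff : hausdorff_space mcarrier;
  manifold_second_countable : @second_countable mcarrier;
  manifold_connected : connected [set: mcarrier];
  chart_atP : forall q, is_chart (chart_at q);
  chart_at_mem : forall q, cdom (chart_at q) q;
  manifold_smooth : forall a b,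
    Csmooth (cmap (chart_at a) @` (cdom (chart_at a) `&` cdom (chart_at b)))
            (transition (chart_at a) (chart_at b));
  manifold_oriented : forall a b y,
    (cmap (chart_at a) @` (cdom (chart_at a) `&` cdom (chart_at b))) y ->
    0 < \det (jacobian (transition (chart_at a) (chart_at b)) y) }.

(* The tangent space of M at q is 'rV[R]_m, a tangent vector being given by its
   components in the chart chart_at q. So a (not necessarily smooth) vector
   field is a function M -> 'rV[R]_m, but its smoothness cannot be read off
   from that function directly, since the reference chart varies with q:
   see [vf_smooth_on]. *)
Notation vfield M R m := (mcarrier M -> 'rV[R]_m) (only parsing).

Section Calculus.
Context {R : realType} {m : nat} {M : manifold R m}.

Definition smooth_on (W : normedModType R) (U : set M) (f : M -> W) : Prop :=
  forall a : M,
    Csmooth (cmap (chart_at a) @` (cdom (chart_at a) `&` U))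
            (f \o cinv (chart_at a)).

(* derivative of f at q in the direction of the tangent vector v *)
Definition ddir (W : normedModType R) (f : M -> W) (q : M) (v : 'rV[R]_m) : W :=
  'd (f \o cinv (chart_at q)) (cmap (chart_at q) q) v.

(* components of the vector field X in the chart c *)
Definition comps (c : chart R m M) (X : vfield M R m) : M -> 'rV[R]_m :=
  fun q => ddir (cmap c) q (X q).

Definition vf_smooth_on (U : set M) (X : vfield M R m) : Prop :=
  forall a : M, smooth_on (U `&` cdom (chart_at a)) (comps (chart_at a) X).

Definition lie_bracket (X Y : vfield M R m) : vfield M R m := fun q =>
  ddir (comps (chart_at q) Y) q (X q) - ddir (comps (chart_at q) X) q (Y q).

(* A field of bilinear forms, given at q by its Gram matrix in chart_at q. *)
Definition ip (g : M -> 'M[R]_m) (q : M) (u v : 'rV[R]_m) : R :=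
  (u *m g q *m v^T) 0 0.

Definition ipf (g : M -> 'M[R]_m) (X Y : vfield M R m) : M -> R :=
  fun q => ip g q (X q) (Y q).

Definition riemannian (g : M -> 'M[R]_m) : Prop :=
  [/\ forall q, (g q)^T = g q,
      forall q u, u != 0 -> 0 < ip g q u u &
      forall (U : set M) (X Y : vfield M R m), open U ->
        vf_smooth_on U X -> vf_smooth_on U Y -> smooth_on U (ipf g X Y)].

(* Joint smoothness in (t, q) for |t| < eps. *)
Definition smooth_family (eps : R) (g : R -> M -> 'M[R]_m) : Prop :=
  forall (U : set M) (X Y : vfield M R m), open U ->
    vf_smooth_on U X -> vf_smooth_on U Y ->
    forall a : M,
      Csmooth ([set s | - eps < s < eps] `*`
                (cmap (chart_at a) @` (cdom (chart_at a) `&` U)))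
        (fun z : R * 'rV[R]_m => ipf (g z.1) X Y (cinv (chart_at a) z.2)).

(* The Levi-Civita connection. The axioms are required over every open set U,
   so that nabla X Y makes sense for fields defined on U only; they determine
   nabla X Y on U for all X, Y smooth on U. *)
Definition is_levi_civita (g : M -> 'M[R]_m)
    (nabla : vfield M R m -> vfield M R m -> vfield M R m) : Prop :=
  forall U : set M, open U ->
  forall X Y Z : vfield M R m,
    vf_smooth_on U X -> vf_smooth_on U Y -> vf_smooth_on U Z ->
  forall f : M -> R, smooth_on U f ->
  vf_smooth_on U (nabla X Y) /\
  forall q, U q ->
  [/\ nabla (X \+ Y) Z q = nabla X Z q + nabla Y Z q /\
      nabla (fun r => f r *: X r) Y q = f q *: nabla X Y q,
      nabla X (Y \+ Z) q = nabla X Y q + nabla X Z q,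
      nabla X (fun r => f r *: Y r) q =
        ddir f q (X q) *: Y q + f q *: nabla X Y q,
      nabla X Y q - nabla Y X q = lie_bracket X Y q &
      ddir (ipf g Y Z) q (X q) =
        ip g q (nabla X Y q) (Z q) + ip g q (Y q) (nabla X Z q)].

End Calculus.

Section Submersions.
Context {R : realType} {m p : nat} {M : manifold R m} {N : manifold R p}.

Definition smooth_map (f : M -> N) : Prop :=
  continuous f /\
  forall b : N,
    smooth_on (f @^-1` cdom (chart_at b)) (cmap (chart_at b) \o f).

(* The matrix of the differential of f at q, acting on row vectors. *)
Definition dmap (f : M -> N) (q : M) : 'M[R]_(m, p) :=
  lin1_mx (ddir (cmap (chart_at (f q)) \o f) q).

Definition vertical (f : M -> N) (q : M) (v : 'rV[R]_m) : Prop :=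
  v *m dmap f q = 0.

Definition vertical_on (f : M -> N) (U : set M) (X : vfield M R m) : Prop :=
  vf_smooth_on U X /\ forall q, U q -> vertical f q (X q).

Definition horizontal (f : M -> N) (g : M -> 'M[R]_m) (q : M) (u : 'rV[R]_m)
    : Prop := forall v, vertical f q v -> ip g q u v = 0.

Definition riemannian_submersion (f : M -> N) (g : M -> 'M[R]_m)
    (gN : N -> 'M[R]_p) : Prop :=
  [/\ smooth_map f,
      forall q, \rank (dmap f q) = p &
      forall q u v, horizontal f g q u -> horizontal f g q v ->
        ip g q u v = ip gN (f q) (u *m dmap f q) (v *m dmap f q)].

(* Matrices whose row spaces are ker (dmap f q) and its g-orthogonal
   complement, and the projection onto the latter along the former. *)
Definition Vmx (f : M -> N) (q : M) : 'M[R]_m := kermx (dmap f q).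

Definition Hmx (f : M -> N) (g : M -> 'M[R]_m) (q : M) : 'M[R]_m :=
  kermx (g q *m (Vmx f q)^T).

Definition hproj (f : M -> N) (g : M -> 'M[R]_m) (q : M) (u : 'rV[R]_m)
    : 'rV[R]_m := u *m proj_mx (Hmx f g q) (Vmx f q).

Definition second_form (f : M -> N) (g : M -> 'M[R]_m)
    (nabla : vfield M R m -> vfield M R m -> vfield M R m)
    (X Y : vfield M R m) : vfield M R m :=
  fun q => hproj f g q (nabla X Y q).

Definition orthonormal_vframe (f : M -> N) (g : M -> 'M[R]_m) (U : set M)
    (n : nat) (E : 'I_n -> vfield M R m) : Prop :=
  [/\ forall a, vertical_on f U (E a),
      forall q a b, U q -> ip g q (E a q) (E b q) = (a == b)%:R &
      forall q v, U q -> vertical f q v ->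
        exists k : 'I_n -> R, v = \sum_a k a *: E a q].

Definition mean_curvature (f : M -> N) (g : M -> 'M[R]_m)
    (nabla : vfield M R m -> vfield M R m -> vfield M R m)
    (n : nat) (E : 'I_n -> vfield M R m) : vfield M R m :=
  fun q => \sum_a second_form f g nabla (E a) (E a) q.

(* In [orthonormal_vframe f g U E] with U nonempty, n is necessarily
   the dimension of the vertical distribution. *)
Definition umbilical_fibers (f : M -> N) (g : M -> 'M[R]_m) : Prop :=
  exists nabla : vfield M R m -> vfield M R m -> vfield M R m,
  is_levi_civita g nabla /\
  forall (U : set M) (n : nat) (E : 'I_n -> vfield M R m), open U ->
    orthonormal_vframe f g U E ->
  forall X Y : vfield M R m, vertical_on f U X -> vertical_on f U Y ->
  forall q, U q ->
    second_form f g nabla X Y q =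
      (n%:R^-1 * ip g q (X q) (Y q)) *: mean_curvature f g nabla E q.

(* Riem(M, V, g0) with V = ker f_* *)
Definition Riem (f : M -> N) (g0 : M -> 'M[R]_m) : set (M -> 'M[R]_m) :=
  [set g | riemannian g /\
     forall q u v, vertical f q u -> vertical f q v ->
       ip g q u v = ip g0 q u v].

(* The values g t for |t| >= eps are irrelevant. *)
Definition variation (f : M -> N) (g0 : M -> 'M[R]_m) (eps : R)
    (g : R -> M -> 'M[R]_m) : Prop :=
  [/\ 0 < eps,
      forall t, - eps < t < eps -> Riem f g0 (g t),
      smooth_family eps g &
      g 0 = g0].

Definition nontrivial_variation (f : M -> N) (g0 : M -> 'M[R]_m) (eps : R)
    (g : R -> M -> 'M[R]_m) : Prop :=
  variation f g0 eps g /\ exists2 t, - eps < t < eps & g t <> g0.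

(* The fiber S = f^-1(x) is an embedded submanifold with T_q S = ker (dmap f q).
   Its smooth functions and vector fields are those which are locally
   restrictions of smooth functions and vector fields of M. *)
Definition fiber_smooth_fun (f : M -> N) (x : N) (lam : M -> R) : Prop :=
  forall q, f q = x -> exists (U : set M) (phi : M -> R),
    [/\ open U, U q, smooth_on U phi &
        forall r, U r -> f r = x -> phi r = lam r].

Definition tangent_to_fiber (f : M -> N) (x : N) (U : set M)
    (X : vfield M R m) : Prop :=
  vf_smooth_on U X /\ forall q, U q -> f q = x -> vertical f q (X q).

Definition lie_metric (g : M -> 'M[R]_m) (Z X Y : vfield M R m) : M -> R :=
  fun q => ddir (ipf g X Y) q (Z q) - ip g q (lie_bracket Z X q) (Y q)
           - ip g q (X q) (lie_bracket Z Y q).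

(* xi|S satisfies L_xi (g|S) = lam * (g|S). For fields tangent to S at the
   points of S, the values of lie_metric on S depend only on the restrictions
   of the fields to S and on g|S. *)
Definition fiber_conformal_killing (f : M -> N) (g : M -> 'M[R]_m)
    (xi : vfield M R m) (x : N) : Prop :=
  exists2 lam : M -> R, fiber_smooth_fun f x lam &
  forall (U : set M) (X Y : vfield M R m), open U ->
    tangent_to_fiber f x U X -> tangent_to_fiber f x U Y ->
  forall q, U q -> f q = x ->
    lie_metric g xi X Y q = lam q * ip g q (X q) (Y q).

End Submersions.

Definition nontrivial_vf {R : realType} {m : nat} {M : manifold R m}
    (X : vfield M R m) : Prop := exists q, X q != 0.

Definition bounded_vf {R : realType} {m : nat} {M : manifold R m}
    (g : M -> 'M[R]_m) (X : vfield M R m) : Prop :=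
  exists C : R, forall q, ip g q (X q) (X q) <= C.

(* Main.v *)
(* The fibers are umbilical for g if and only if, for every g-horizontal field Z,
   the vertical part of the Lie derivative of g along Z is a multiple of g. For a
   basic field Z (the horizontal lift of a field on N) this vertical part depends
   only on Z and on the metric of the fibers: brackets of Z with vertical fields
   are vertical.

   If g_t and g_0 agree on the fibers and are different, then some field on N, cut
   off by a bump function, has different lifts for g_t and g_0. The difference of
   the two lifts is vertical, and conformal Killing on the fibers.

   Conversely, let xi be vertical and conformal Killing on the fibers, phi a
   function on N, F the composition of phi with the submersion, and put
   A_t u = u - t dF(u) xi and g_t(u, v) = g_0(A_t u, A_t v). As dF(xi) = 0, A_t is
   invertible and g_t is a metric; its lift of a field w is the g_0-lift of w plus
   t dphi(w) xi, where dphi(w) is constant along the fibers. So g_t has umbilical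
   fibers. It differs from g_0 for t <> 0 if dphi does not vanish at the image of
   a point where xi does not. *)
Require Import Defs.
From HB Require Import structures.
From mathcomp Require Import all_boot all_order all_algebra.
From mathcomp Require Import all_classical all_reals all_analysis.
From mathcomp Require Import ring lra.
Set Implicit Arguments.
Unset Strict Implicit.
Unset Printing Implicit Defensive.
Import Order.TTheory GRing.Theory Num.Theory.
Import numFieldNormedType.Exports.
Local Open Scope classical_set_scope.
Local Open Scope ring_scope.

(** * Smooth maps on normed spaces *)

Section Differentials.
Context {R : realType}.

(** The link between umbilicity and Lie derivatives is that, for horizontal Z and vertical X, Y,
    torsion-freeness and the verticality of [X, Y] turn (L_Z g)(X, Y) into -2 g(nabla_X Y, Z). Two
    metrics are then compared through their Lie derivatives, never through their connections.

    Two obstacles shape the rest. First, [umbilical_fibers] asks for a Levi-Civita connection, and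
    only one for g0 is given: one for the sheared metric has to be built from it. Secondly,
    [fiber_conformal_killing] tests fields that are tangent to a single fiber at its points only,
    whereas umbilicity concerns fields vertical on an open set. Passing from these to those requires
    that a smooth function vanishing on a fiber have zero derivative in vertical directions. The
    implicit function theorem would give this; a minimisation argument replaces it, producing points
    of the level set close to a prescribed line.

    The conformal factor is first found point by point; its smoothness is recovered at the end. *)

Lemma diff_near_eq (V W : normedModType R) (f g : V -> W) x :
  (\forall y \near x, f y = g y) -> differentiable f x ->
  differentiable g x /\ forall v, 'd g x v = 'd f x v.
Proof.
move=> fg df.
have fgx : f x = g x by exact: nbhs_singleton fg.
have eqo : g \o shift x = cst (g x) + 'd f x +o_ 0 id.
  apply/eqaddoP => e e0.
  have /diff_locally/eqaddoP/(_ e e0) := df.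
  have : \forall y \near (0 : V), f (y + x) = g (y + x).
    by move: fg; rewrite [X in X -> _](near_shift 0) subr0.
  by apply: filterS2 => y /= fy; rewrite !fctE /= fy fgx.
have dg := diff_unique (diff_continuous df) eqo.
split; last by move=> v; exact: (congr1 (@^~ v) dg).
by apply/diff_locallyP; rewrite dg; split; [exact: diff_continuous|].
Qed.

(** The composite has to agree with [h] only near [x], because compositions of chart maps and their
    inverses agree with the intended map only where the charts overlap. *)
Lemma diff_chain (U V W : normedModType R) (t : U -> V) (g : V -> W) (h : U -> W) x z w :
  t x = z -> differentiable t x -> differentiable g z ->
  (\forall y \near x, g (t y) = h y) -> 'd h x w = 'd g z ('d t x w).
Proof.
move=> <- dt dg e.
have [_ h1] := @diff_near_eq _ _ (g \o t) h x e (differentiable_comp dt dg).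
exact: etrans (h1 w) (congr1 (@^~ w) (diff_comp dt dg)).
Qed.

Lemma diff_comp_at (U V W : normedModType R) (t : U -> V) (g : V -> W) x w :
  differentiable t x -> differentiable g (t x) ->
  'd (g \o t) x w = 'd g (t x) ('d t x w).
Proof. by move=> dt dg; exact: (congr1 (@^~ w) (diff_comp dt dg)). Qed.

Lemma diffD_at (V W : normedModType R) (f g : V -> W) x v :
  differentiable f x -> differentiable g x ->
  'd (fun y => f y + g y) x v = 'd f x v + 'd g x v.
Proof. by move=> df dg; exact: (congr1 (@^~ v) (diffD df dg)). Qed.

Lemma diffM_at (V : normedModType R) (f g : V -> R) x v :
  differentiable f x -> differentiable g x ->
  'd (fun y => f y * g y) x v = f x * 'd g x v + g x * 'd f x v.
Proof. by move=> df dg; exact: (congr1 (@^~ v) (diffM df dg)). Qed.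

End Differentials.

Section SmoothMaps.
Context {R : realType}.
Implicit Types V W : normedModType R.

Lemma Ck_subset V W k (A B : set V) (f : V -> W) :
  A `<=` B -> Ck k B f -> Ck k A f.
Proof.
elim: k f => [|k IH] f AB /=; first by move=> h x /AB; exact: h.
by move=> [h1 h2]; split=> [x /AB|v]; [exact: h1|exact: IH].
Qed.

Lemma Ck_eq V W k (U : set V) (f g : V -> W) : open U ->
  (forall x, U x -> f x = g x) -> Ck k U f -> Ck k U g.
Proof.
move=> oU; elim: k f g => [|k IH] f g fg /=.
  move=> cf x Ux; rewrite /prop_for /continuous_at -(fg _ Ux).
  apply: cvg_trans (cf x Ux); apply: near_eq_cvg.
  by near=> y; apply: fg; near: y; exact: open_nbhs_nbhs.
have nfg x : U x -> \forall y \near x, f y = g y.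
  by move=> Ux; near=> y; apply: fg; near: y; exact: open_nbhs_nbhs.
move=> [h1 h2]; split=> [x Ux|v].
  by have [] := diff_near_eq (nfg x Ux) (h1 x Ux).
apply: IH (h2 v) => x Ux.
by have [_ e] := diff_near_eq (nfg x Ux) (h1 x Ux); exact: esym (e v).
Unshelve. all: by end_near. Qed.

(** [B] may be any set containing the point: continuity and differentiability in [Ck] are those of
    the ambient space, merely tested at the points of the set. *)
Lemma Ck_local V W k (U : set V) (f : V -> W) :
  (forall x, U x -> exists2 B : set V, B x & Ck k B f) -> Ck k U f.
Proof.
elim: k f => [|k IH] f h /=.
  by move=> x /h [B Bx]; exact.
split=> [x /h [B Bx []]|v]; first by move=> + _; exact.
by apply: IH => x /h [B Bx [_ /(_ v) ?]]; exists B.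
Qed.

Lemma Ck_S V W k (U : set V) (f : V -> W) : Ck k.+1 U f -> Ck k U f.
Proof.
elim: k f => [|k IH] f [h1 h2]; first by move=> x /h1; exact: differentiable_continuous.
by split=> // v; apply: IH.
Qed.

Lemma Csmooth_diff V W (U : set V) (f : V -> W) x :
  Csmooth U f -> U x -> differentiable f x.
Proof. by move=> /(_ 1) [+ _]; exact. Qed.

Lemma Csmooth_deriv V W (U : set V) (f : V -> W) v :
  Csmooth U f -> Csmooth U (fun x => 'd f x v).
Proof. by move=> h k; have [_] := h k.+1; exact. Qed.

Lemma Ck_cst V W k (U : set V) (a : W) : Ck k U (fun=> a).
Proof.
elim: k a => [|k IH] a /=; first by move=> x _; exact: cvg_cst.
split=> [x _|v]; first exact: differentiable_cst.
have -> : (fun x => 'd (fun=> a) x v) = fun=> 0.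
  by apply/funext => x; rewrite -/(cst a) diff_cst.
exact: IH.
Qed.

Lemma Ck_linear V W k (U : set V) (f : {linear V -> W}) :
  continuous f -> Ck k U f.
Proof.
case: k => [|k] cf /=; first by move=> x _; exact: cf.
split=> [x _|v]; first exact: linear_differentiable.
have -> : (fun x => 'd f x v) = fun=> f v.
  by apply/funext => x; rewrite diff_lin.
exact: Ck_cst.
Qed.

Lemma Ck_D V W k (U : set V) (f g : V -> W) : open U ->
  Ck k U f -> Ck k U g -> Ck k U (fun x => f x + g x).
Proof.
move=> oU; elim: k f g => [|k IH] f g /=.
  by move=> cf cg x Ux; apply: cvgD; [exact: cf|exact: cg].
move=> [f1 f2] [g1 g2]; split=> [x Ux|v].
  by apply: differentiableD; [exact: f1|exact: g1].
apply: Ck_eq (IH _ _ (f2 v) (g2 v)) => // x Ux.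
exact: esym (diffD_at v (f1 x Ux) (g1 x Ux)).
Qed.

Lemma Ck_M V k (U : set V) (f g : V -> R) : open U ->
  Ck k U f -> Ck k U g -> Ck k U (fun x => f x * g x).
Proof.
move=> oU; elim: k f g => [|k IH] f g.
  by move=> cf cg x Ux; apply: cvgM; [exact: cf|exact: cg].
move=> cf cg; move: (cf) (cg) => [f1 f2] [g1 g2]; split=> [x Ux|v].
  by apply: differentiableM; [exact: f1|exact: g1].
apply: (@Ck_eq _ _ _ _ (fun x => f x * 'd g x v + g x * 'd f x v)) => //.
  by move=> x Ux; exact: esym (diffM_at v (f1 x Ux) (g1 x Ux)).
by apply: Ck_D => //; apply: IH; first [exact: g2|exact: f2|exact: Ck_S cf|exact: Ck_S cg].
Qed.

Lemma Ck_sum V W k (U : set V) (I : Type) (r : seq I) (P : pred I)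
    (f : I -> V -> W) : open U ->
  (forall i, P i -> Ck k U (f i)) -> Ck k U (fun x => \sum_(i <- r | P i) f i x).
Proof.
move=> oU h; elim: r => [|i r IH].
  rewrite (_ : (fun x => _) = fun=> 0); first exact: Ck_cst.
  by apply/funext => x; rewrite big_nil.
have [Pi|nPi] := boolP (P i).
  rewrite (_ : (fun x => _) = fun x => f i x + \sum_(i <- r | P i) f i x).
    by apply: Ck_D => //; exact: h.
  by apply/funext => x; rewrite big_cons Pi.
rewrite (_ : (fun x => _) = fun x => \sum_(i <- r | P i) f i x) //.
by apply/funext => x; rewrite big_cons (negbTE nPi).
Qed.

Lemma diff_rV V n (f : V -> 'rV[R]_n) x :
  (forall j, differentiable (fun y => f y 0 j) x) ->
  differentiable f x /\
  forall v j, 'd f x v 0 j = 'd (fun y => f y 0 j) x v.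
Proof.
move=> df.
have fE : f = \sum_j (fun y => f y 0 j *: delta_mx 0 j : 'rV[R]_n).
  apply/funext => y; rewrite fct_sumE. exact: (row_sum_delta (f y)).
have dZ j : differentiable (fun y => f y 0 j *: delta_mx 0 j : 'rV[R]_n) x.
  exact: differentiableZl.
have dfx : differentiable f x by rewrite fE; exact: differentiable_sum.
split=> // v j.
pose c : 'rV[R]_n -> R := fun N => N 0 j.
have lc : linear c by move=> a u w; rewrite /c !mxE.
pose cM := GRing.isLinear.Build _ _ _ _ _ lc.
pose cL : {linear _ -> _} := HB.pack c cM.
have -> : 'd (fun y => f y 0 j) x = 'd c (f x) \o 'd f x :> (V -> R).
  exact: diff_comp dfx (differentiable_coord (f x) 0 j).
have ccL : continuous cL by exact: coord_continuous.
have -> : 'd c (f x) = cL :> (_ -> _) := diff_lin (f x) ccL.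
by [].
Qed.

Lemma diff_coord V n (f : V -> 'rV[R]_n) x : differentiable f x ->
  forall j, differentiable (fun y => f y 0 j) x.
Proof. by move=> df j; exact: differentiable_comp df (differentiable_coord (f x) 0 j). Qed.

Lemma Ck_rV V n k (U : set V) (f : V -> 'rV[R]_n) : open U ->
  (forall j, Ck k U (fun y => f y 0 j)) -> Ck k U f.
Proof.
move=> oU; elim: k f => [|k IH] f h.
  move=> x Ux; apply/cvg_ballP => e e0.
  have : forall j, \forall y \near x, ball (f x 0 j) e (f y 0 j).
    by move=> j; have /cvg_ballP := h j x Ux; apply.
  move=> /filter_forall; apply: filterS => y hy; split=> // i j; rewrite (ord1 i); exact: hy.
have d x : U x -> forall j, differentiable (fun y => f y 0 j) x.
  by move=> Ux j; have [/(_ x Ux)] := h j.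
split=> [x Ux|v]; first by have [] := diff_rV (d x Ux).
apply: IH => j; have [_ /(_ v)] := h j; apply: Ck_eq => // x Ux.
by have [_ ->] := diff_rV (d x Ux).
Qed.

Lemma Ck_coord V n k (U : set V) (f : V -> 'rV[R]_n) j : open U ->
  Ck k U f -> Ck k U (fun y => f y 0 j).
Proof.
move=> oU; elim: k f => [|k IH] f h.
  by move=> x Ux; exact: (@continuous_comp _ _ _ f (fun M : 'rV[R]_n => M 0 j) x (h x Ux) (@coord_continuous _ 1 n 0 j (f x))).
have [h1 h2] := h; have d x : U x -> forall j, differentiable (fun y => f y 0 j) x.
  by move=> Ux; apply: diff_coord; exact: h1.
split=> [x Ux|v]; first exact: d.
apply: Ck_eq (IH _ (h2 v)) => // x Ux.
by have [_ ->] := diff_rV (d x Ux).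
Qed.

Lemma diff_row_sum n (f : 'rV[R]_n -> R) x v :
  'd f x v = \sum_j v 0 j * 'd f x (delta_mx 0 j).
Proof.
rewrite {1}(row_sum_delta v) linear_sum; apply: eq_bigr => j _.
by rewrite linearZ.
Qed.

(** [Ck] controls ['d g y w] for a fixed direction [w] only. Expanding ['d g (f x) ('d f x v)] in
    the standard basis makes the directions constant, at the price of a sum of products; hence the
    row vectors as intermediate space. *)
Lemma Ck_comp V n k (U : set V) (B : set 'rV[R]_n) (f : V -> 'rV[R]_n)
    (g : 'rV[R]_n -> R) : open U ->
  (forall x, U x -> B (f x)) -> Ck k U f -> Ck k B g -> Ck k U (g \o f).
Proof.
move=> oU fB; elim: k g => [|k IH] g.
  by move=> cf cg x Ux; apply: continuous_comp (cf x Ux) (cg _ (fB _ Ux)).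
move=> cf cg; move: (cf) (cg) => [f1 f2] [g1 g2]; split=> [x Ux|v].
  by exact: (differentiable_comp (f1 x Ux) (g1 _ (fB _ Ux))).
apply: (@Ck_eq _ _ _ _
    (fun x => \sum_j 'd f x v 0 j * 'd g (f x) (delta_mx 0 j))) => //.
  move=> x Ux; apply: etrans (esym (diff_row_sum g (f x) ('d f x v))) (esym _).
  exact: diff_comp_at (f1 x Ux) (g1 _ (fB _ Ux)).
apply: Ck_sum => // j _; apply: Ck_M => //.
  exact: (@Ck_coord _ _ _ _ (fun x => 'd f x v) j oU (f2 v)).
by apply: (IH (fun y => 'd g y (delta_mx 0 j))); [exact: Ck_S cf|exact: g2].
Qed.

Lemma Ck_comp1 V k (U : set V) (B : set R) (f : V -> R) (g : R -> R) : open U ->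
  (forall x, U x -> B (f x)) -> Ck k U f -> Ck k B g -> Ck k U (g \o f).
Proof.
move=> oU fB; elim: k g => [|k IH] g.
  by move=> cf cg x Ux; apply: continuous_comp (cf x Ux) (cg _ (fB _ Ux)).
move=> cf cg; move: (cf) (cg) => [f1 f2] [g1 g2]; split=> [x Ux|v].
  by exact: (differentiable_comp (f1 x Ux) (g1 _ (fB _ Ux))).
apply: (@Ck_eq _ _ _ _ (fun x => 'd f x v * 'd g (f x) 1)) => //.
  move=> x Ux.
  have E : 'd g (f x) ('d f x v) = 'd f x v * 'd g (f x) 1.
    by rewrite -{1}(mulr1 ('d f x v)); exact: linearZ.
  apply: etrans (esym E) (esym _).
  exact: diff_comp_at (f1 x Ux) (g1 _ (fB _ Ux)).
apply: Ck_M => //; first exact: f2.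
exact: IH _ (Ck_S cf) (g2 1).
Qed.

(** Here the direction [L v] is constant already and no basis is involved, so that the lemma applies
    to the projection of a pair [(t, y)] to [y], used for families of metrics. *)
Lemma Ck_comp_linear V V' W k (B : set V') (L : {linear V -> V'}) (g : V' -> W) :
  continuous L -> open B -> Ck k B g -> Ck k (L @^-1` B) (g \o L).
Proof.
move=> cL oB; have oU : open (L @^-1` B) by move/continuousP : (cL) => /(_ B oB).
 elim: k g => [|k IH] g.
  by move=> cg x Ux; apply: continuous_comp (cL x) (cg _ Ux).
move=> [g1 g2]; split=> [x Ux|v].
  exact: (differentiable_comp (linear_differentiable x cL) (g1 _ Ux)).
apply: (@Ck_eq _ _ _ _ ((fun y => 'd g y (L v)) \o L)) => //; last exact: IH (g2 (L v)).
move=> x Ux; apply: esym.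
apply: etrans (diff_comp_at v (linear_differentiable x cL) (g1 _ Ux)) _.
by congr ('d g _ _); exact: (congr1 (@^~ v) (diff_lin x cL)).
Qed.

Lemma Ck_inv k : Ck k [set x : R | x != 0] (GRing.inv : R -> R).
Proof.
have oU : open [set x : R | x != 0].
  have -> : [set x : R | x != 0] = ~` [set 0].
    by apply/seteqP; split=> x /= /eqP.
  by rewrite openC; exact: closed_eq.
elim: k => [|k IH]; first by move=> x /= x0; exact/differentiable_continuous/differentiable_Rinv.
split=> [x /= x0|v]; first exact: differentiable_Rinv.
change (Ck k [set x : R | x != 0] (fun x : R => 'd (GRing.inv : R -> R) x v)).
apply: (@Ck_eq R R k _ (fun x : R => (x^-1 * x^-1) * (- v))) => //.
  by move=> x /= x0; rewrite diff_Rinv //= scaleNr -exprVn expr2 mulrN.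
by apply: Ck_M => //; [exact: Ck_M|exact: Ck_cst].
Qed.

End SmoothMaps.

(** * Smooth functions of one real variable *)

Section RealSmooth.
Context {R : realType}.

Lemma is_derive1_diff (f : R -> R) (x df : R) : is_derive x (1 : R) f df ->
  differentiable f x /\ forall v, 'd f x v = v * df.
Proof.
move=> [d e]; have df' : differentiable f x by apply/derivable1_diffP.
by split=> // v; rewrite diff1E // derive1E e.
Qed.

Lemma Ck_of_derive k (B : set R) (f df : R -> R) : open B ->
  (forall x, B x -> is_derive x (1:R) f (df x)) -> Ck k B df -> Ck k.+1 B f.
Proof.
move=> oB h c; split=> [x Bx|v]; first by have [] := is_derive1_diff (h x Bx).
change (Ck k B (fun x : R => 'd f x v)).
apply: (@Ck_eq _ R R k _ (fun x : R => v * df x)) => //.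
  by move=> x Bx; have [_ ->] := is_derive1_diff (h x Bx).
by apply: Ck_M => //; exact: Ck_cst.
Qed.

Lemma Ck_expR k (B : set R) : Ck k B (@expR R).
Proof.
apply: (@Ck_subset _ _ _ _ _ setT) => //.
elim: k => [|k IH]; first by move=> x _; exact: continuous_expR.
by apply: (Ck_of_derive openT (df := @expR R)) => // x _; exact: is_derive_expR.
Qed.

Lemma Ck_ln k : Ck k [set x : R | 0 < x] (@ln R).
Proof.
case: k => [|k]; first by move=> x /= x0; exact: continuous_ln.
have h : Ck k [set x : R | 0 < x] (GRing.inv : R -> R).
  by apply: Ck_subset (Ck_inv k) => x /= x0; rewrite gt_eqF.
exact: (Ck_of_derive (@open_gt _ (0 : R)) (fun x x0 => is_derive1_ln x0) h).
Qed.

(** The function 1 / sqrt x for x > 0, which normalises fields in the Gram-Schmidt process; the form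
    with [expR] and [ln] yields its smoothness by composition. *)
Definition isqrt (x : R) := expR (- (ln x) / 2).

Lemma isqrtP x : 0 < x -> isqrt x * isqrt x * x = 1.
Proof.
move=> x0; rewrite /isqrt -expRD -mulrDl -{3}(lnK x0) -expRD.
have -> : (- ln x - ln x) / 2 + ln x = 0 by field.
exact: expR0.
Qed.

Lemma Ck_isqrt k : Ck k [set x : R | 0 < x] isqrt.
Proof.
have o := @open_gt _ (0 : R).
apply: (@Ck_comp1 _ _ _ _ setT (fun x => - ln x / 2) (@expR R)) => //; last exact: Ck_expR.
apply: (@Ck_eq _ _ _ _ _ (fun x => ln x * - (2^-1))) => //.
  by move=> x _; rewrite mulrN mulNr.
by apply: Ck_M => //; [exact: Ck_ln|exact: Ck_cst].
Qed.

(* The functions [flat k] vanish to infinite order at 0 and their span is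
   stable under differentiation. *)
Definition flat (k : nat) (s : R) : R :=
  if 0 < s then s ^- k * expR (- s^-1) else 0.

(** Put y = s^-1 / (k + 2). Raising y <= 1 + y <= exp y to the power k + 2 bounds exp (s^-1) from
    below by y ^ (k + 2). The spare factor s ^ 2 is what makes difference quotients at 0 tend to
    0. *)
Lemma flat_le k : exists2 C, 0 < C & forall s, 0 < s -> `|flat k s| <= C * s ^+ 2.
Proof.
exists (k.+2%:R ^+ k.+2); first by rewrite exprn_gt0.
move=> s s0; rewrite /flat s0 ger0_norm; last by rewrite mulr_ge0 ?expR_ge0// invr_ge0 exprn_ge0 // ltW.
have e : s^-1 ^+ k.+2 / k.+2%:R ^+ k.+2 <= expR (s^-1).
  pose y := s^-1 / k.+2%:R.
  have y0 : 0 <= y by rewrite divr_ge0 // invr_ge0 ltW.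
  have -> : s^-1 = k.+2%:R * y by rewrite mulrC divfK.
  rewrite expRM_natl exprMn mulrAC divff ?expf_neq0// mul1r.
  apply: lerXn2r; rewrite ?nnegrE ?expR_ge0 //.
  by apply: le_trans (expR_ge1Dx _); rewrite lerDr.
rewrite expRN ler_pdivrMr ?expR_gt0 //.
have -> : s ^- k = k.+2%:R ^+ k.+2 * s ^+ 2 * (s^-1 ^+ k.+2 / k.+2%:R ^+ k.+2).
  rewrite exprVn; have s2 : s ^+ k.+2 = s ^+ k * s ^+ 2 by rewrite -exprD addn2.
  rewrite s2; set K := k.+2%:R ^+ k.+2; field.
  by rewrite expf_neq0 ?gt_eqF //= exprn_gt0.
by rewrite ler_pM2l // mulr_gt0 ?exprn_gt0.
Qed.

(** For s > 0 the recursion [flat k.+1 s = s^-1 * flat k s] gives the formula by induction on [k];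
    for s < 0 the function is locally zero; at 0 the quadratic bound [flat_le] applies. *)
Lemma is_derive_flat k (s : R) :
  is_derive s (1 : R) (flat k) (flat k.+2 s - k%:R * flat k.+1 s).
Proof.
have dinv (x : R) : 0 < x -> is_derive x (1 : R) (fun s : R => s^-1) (- x ^- 2).
  move=> x0; apply: is_derive_eq (is_deriveV _ _) _; first by rewrite gt_eqF.
  by rewrite [LHS]mulr1.
have [s0|s0|<-] := ltgtP 0 s.
- elim: k => [|k IH].
    apply: (@near_eq_is_derive R R R (expR \o (fun s : R => - s^-1))).
      near=> x; have x0 : 0 < x by near: x; exact: lt_nbhsr.
      by rewrite /flat x0 expr0 invr1 mul1r.
    have d1 : is_derive s (1 : R) (fun s : R => - s^-1) (s ^- 2).
      apply: is_derive_eq (is_deriveN (dinv _ s0)) _.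
      by rewrite opprK.
    apply: is_derive_eq (is_derive1_comp (is_derive_expR _) d1) _.
    by rewrite /flat s0 mul0r subr0 mulrC.
  apply: (@near_eq_is_derive R R R (fun x => x^-1 * flat k x)).
    near=> x; have x0 : 0 < x by near: x; exact: lt_nbhsr.
    by rewrite /flat x0 exprS invfM mulrA.
  apply: is_derive_eq (is_deriveM (dinv _ s0) IH) _.
  rewrite /flat s0 -natr1 /GRing.scale /=.
  by rewrite -!exprVn !(exprS (s^-1)); ring.
- apply: (@near_eq_is_derive R R R (cst 0)).
    near=> x; have x0 : x < 0 by near: x; exact: lt_nbhsl.
    by rewrite /flat ltNge ltW.
  apply: is_derive_eq (is_derive_cst _ _ _) _.
  by rewrite /flat !ltNge (ltW s0) mulr0 subr0.
- have e : flat k.+2 0 - k%:R * flat k.+1 0 = 0 by rewrite /flat ltxx mulr0 subr0.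
  rewrite e.
  suff h : (fun h => h^-1 *: (flat k (h *: (1 : R) + 0) - flat k 0)) @ 0^' --> (0 : R).
    by apply: DeriveDef; [exact: cvgP h|exact: cvg_lim h].
  have [C C0 hC] := flat_le k.
  apply/cvgrPdist_le => eps eps0.
  near=> h.
  have h0 : h != 0 by near: h; exact: nbhs_dnbhs_neq.
  rewrite sub0r normrN {2}/flat ltxx subr0 addr0 [h *: 1]mulr1 normrZ normfV.
  have [hp|hn] := ltP 0 h; last by rewrite /flat ltNge hn normr0 mulr0 ltW.
  rewrite mulrC ler_pdivrMr ?normr_gt0 //.
  apply: le_trans (hC _ hp) _.
  rewrite (gtr0_norm hp) expr2 mulrA ler_pM2r // -ler_pdivlMl //.
  apply: le_trans (ler_norm _) _; near: h.
  apply: dnbhs0_le; rewrite mulrC divr_gt0 //.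
Unshelve. all: by end_near. Qed.

Lemma Ck_flat k n (B : set R) : Ck n B (flat k).
Proof.
apply: (@Ck_subset _ _ _ _ _ setT) => //.
elim: n k => [|n IH] k.
  move=> x _; apply/differentiable_continuous.
  by have [] := is_derive1_diff (is_derive_flat k x).
apply: (Ck_of_derive openT (df := fun s => flat k.+2 s - k%:R * flat k.+1 s)).
  by move=> x _; exact: is_derive_flat.
apply: (@Ck_eq _ _ _ _ _ (fun s => flat k.+2 s + (- k%:R) * flat k.+1 s)).
- exact: openT.
- by move=> x _; rewrite mulNr.
apply: Ck_D; [exact: openT|exact: IH|].
by apply: Ck_M; [exact: openT|exact: Ck_cst|exact: IH].
Qed.

End RealSmooth.

(** * Symmetry of second derivatives and level sets of submersions *)

Section Schwarz.
Context {R : realType} {V : normedModType R}.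
Implicit Types (f : V -> R) (x u v : V).

Lemma nbhs_radius x (P : V -> Prop) : (\forall y \near x, P y) ->
  exists2 r : R, 0 < r & forall h, `|h| < r -> P (x + h).
Proof.
move=> /nbhs_ballP[r /= r0 hr]; exists r => // h hh.
by apply: hr; rewrite -ball_normE /= opprD addNKr normrN.
Qed.

Lemma diff_eps (W : normedModType R) (f : V -> W) x : differentiable f x ->
  forall e : R, 0 < e -> exists2 r : R, 0 < r &
    forall h, `|h| < r -> `|f (x + h) - f x - 'd f x h| <= e * `|h|.
Proof.
move=> /diff_locally df e e0.
have /eqaddoP/(_ e e0) := df.
rewrite /= => /nbhs_radius [r r0 hr]; exists r => // h hh.
have := hr h hh; rewrite add0r /= !fctE /= [h + x]addrC.
by rewrite opprD addrA.
Qed.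

Lemma is_derive_line f x u t : differentiable f (x + t *: u) ->
  is_derive t (1 : R) (fun s : R => f (x + s *: u)) ('d f (x + t *: u) u).
Proof.
move=> df; pose l := fun s : R => x + s *: u.
have [dl dlE] : is_diff t l ( *:%R ^~ u).
  have := @is_diffD R R V (cst x) ( *:%R ^~ u) 0 ( *:%R ^~ u) t _ _.
  by rewrite add0r; apply.
have dfl := differentiable_comp dl df.
apply: DeriveDef; first exact: diff_derivable dfl.
by rewrite deriveE // (diff_comp dl df) /= dlE scale1r.
Qed.

(** The mean value theorem for t in [0, s], applied to f(x + s v + t u) - f(x + t u), turns the
    second difference into s times an increment of g = 'd f(.) u. Both values of g are then expanded
    to first order at [x], and the terms in t cancel. *)
Lemma second_difference f x u v (e : R) :
  (\forall y \near x, differentiable f y) ->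
  differentiable (fun y => 'd f y u) x -> 0 < e ->
  exists2 r : R, 0 < r & forall s, 0 < s -> s < r ->
    `|f (x + s *: u + s *: v) - f (x + s *: u) - f (x + s *: v) + f x
      - s ^+ 2 * 'd (fun y => 'd f y u) x v| <= e * s ^+ 2.
Proof.
move=> /nbhs_radius[r1 r10 df] dg e0; set g := fun y => 'd f y u.
(* The displacements t u + s v and t u have norms adding up to at most s (2 |u| + |v|); the summand
   1 keeps [c] positive. With tolerance [e / c] for g the total error is e * s ^ 2. *)
pose c := 2 * `|u| + `|v| + 1.
have c0 : 0 < c by rewrite ltr_wpDl // addr_ge0 // mulr_ge0.
have [r2 r20 hg] := diff_eps dg (divr_gt0 e0 c0).
exists (Num.min r1 r2 / c); first by rewrite divr_gt0 // lt_min r10.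
move=> s s0; rewrite ltr_pdivlMr // lt_min => /andP[sr1 sr2].
have bnd t : 0 <= t -> t <= s -> [/\ `|t *: u + s *: v| < s * c, `|t *: u| < s * c &
      `|t *: u + s *: v| + `|t *: u| <= s * c].
  move=> t0 ts.
  have h1 : `|t *: u| <= s * `|u| by rewrite normrZ ger0_norm // ler_wpM2r.
  have h2 : `|s *: v| = s * `|v| by rewrite normrZ gtr0_norm.
  have h3 := ler_normD (t *: u) (s *: v).
  have h4 : 0 <= s * `|u| by rewrite mulr_ge0 // ltW.
  have h5 : 0 <= s * `|v| by rewrite mulr_ge0 // ltW.
  by rewrite /c; split; nra.
pose phi := fun t : R => f (x + s *: v + t *: u) - f (x + t *: u).
have dphi t : 0 <= t -> t <= s ->
    is_derive t (1 : R) phi (g (x + s *: v + t *: u) - g (x + t *: u)).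
  move=> t0 ts; have [b1 b2 b3] := bnd t t0 ts.
  apply: is_deriveB; apply: is_derive_line.
    by rewrite -addrA; apply: df; rewrite addrC; apply: lt_trans b1 _.
  by apply: df; apply: lt_trans b2 _.
have [] := @MVT R phi (fun t => g (x + s *: v + t *: u) - g (x + t *: u)) 0 s s0.
- by move=> t; rewrite in_itv /= => /andP[/ltW t0 /ltW ts]; exact: dphi.
- apply: derivable_within_continuous => t; rewrite in_itv /= => /andP[t0 ts].
  by have [] := dphi t t0 ts.
move=> t; rewrite in_itv /= => /andP[/ltW t0 /ltW ts].
rewrite /phi subr0 !scale0r !addr0.
have -> : x + s *: v + s *: u = x + s *: u + s *: v by rewrite addrAC.
move=> E.
have -> : f (x + s *: u + s *: v) - f (x + s *: u) - f (x + s *: v) + f x =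
   (g (x + s *: v + t *: u) - g (x + t *: u)) * s.
  by rewrite -E; ring.
have [b1 b2 b3] := bnd t t0 ts.
have h1 := hg _ (lt_trans b1 sr2); have h2 := hg _ (lt_trans b2 sr2).
have hE : x + (t *: u + s *: v) = x + s *: v + t *: u by rewrite addrCA addrC.
move: h1 h2; rewrite hE linearD [X in _ - (_ + X)]linearZ /=.
set G1 := g (_ + _ + _); set G2 := g (_ + _); set G0 := g x.
set L1 := 'd _ _ (t *: u); set L2 := 'd _ _ v => h1 h2.
have -> : (G1 - G2) * s - s ^+ 2 * L2 = ((G1 - G0 - (L1 + s * L2)) - (G2 - G0 - L1)) * s.
  by ring.
rewrite normrM (gtr0_norm s0) expr2 mulrA ler_pM2r //.
apply: le_trans (ler_normB _ _) _; apply: le_trans (lerD h1 h2) _.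
rewrite -mulrDr -(divfK (lt0r_neq0 c0) e) -[leRHS]mulrA [c * s]mulrC mulfK ?lt0r_neq0 //.
by rewrite ler_pM2l // divr_gt0.
Qed.

(** The second difference is symmetric in [u] and [v], and divided by s ^ 2 it approximates both
    sides. *)
Lemma second_diff_sym f x u v :
  (\forall y \near x, differentiable f y) ->
  differentiable (fun y => 'd f y u) x -> differentiable (fun y => 'd f y v) x ->
  'd (fun y => 'd f y u) x v = 'd (fun y => 'd f y v) x u.
Proof.
move=> df du dv; set A := LHS; set B := RHS.
suff h : forall e : R, 0 < e -> `|A - B| <= e.
  by apply/eqP; rewrite -subr_eq0 -normr_le0; apply/ler_addgt0Pl => e /h; rewrite addr0.
move=> e e0; have e20 : 0 < e / 2 by rewrite divr_gt0.
have [r r0 h1] := second_difference v df du e20.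
have [r' r'0 h2] := second_difference u df dv e20.
pose s := Num.min r r' / 2.
have m0 : 0 < Num.min r r' by rewrite lt_min r0.
have s0 : 0 < s by rewrite divr_gt0.
have [sr sr'] : s < r /\ s < r'.
  have : s < Num.min r r' by rewrite /s ltr_pdivrMr // mulr_natr mulr2n ltrDl.
  by rewrite lt_min => /andP.
have := h1 s s0 sr; have := h2 s s0 sr'.
have -> : x + s *: v + s *: u = x + s *: u + s *: v by rewrite addrAC.
rewrite -/A -/B; set D := f (x + _ + _); set F1 := f _; set F2 := f _; set F0 := f x.
move=> k2 k1.
have E : s ^+ 2 * (A - B) = (D - F1 - F2 + F0 - s ^+ 2 * B) - (D - F2 - F1 + F0 - s ^+ 2 * A).
  by ring.
have s20 : 0 < s ^+ 2 by rewrite exprn_gt0.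
rewrite -(ler_pM2l s20) -{1}(gtr0_norm s20) -normrM E.
apply: le_trans (ler_normB _ _) _; apply: le_trans (lerD k2 k1) _.
by rewrite -mulrDl -splitr mulrC.
Qed.

End Schwarz.

(** * Derivatives of functions vanishing on a level set *)

Section LevelSet.
Context {R : realType}.

Lemma norm_coord n (w : 'rV[R]_n) j : `|w 0 j| <= `|w|.
Proof.
rewrite [leRHS]/Num.Def.normr /= mx_normrE.
by apply/bigmax_geP; right => /=; exists (0, j).
Qed.

Lemma norm_rV_le n (w : 'rV[R]_n) c : 0 <= c -> (forall j, `|w 0 j| <= c) -> `|w| <= c.
Proof.
move=> c0 h; rewrite [leLHS]/Num.Def.normr /= mx_normrE.
by apply/bigmax_leP; split => // -[i j] _ /=; rewrite (ord1 i).
Qed.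

(** The norm of ['rV[R]_n] is the sup norm, which is not differentiable enough to be minimised by a
    gradient argument. This Euclidean square is smooth, and comparable to the square of the norm
    with factors 1 and [n]. *)
Definition sqnorm n (w : 'rV[R]_n) : R := \sum_j w 0 j ^+ 2.

Lemma sqnorm_ge n (w : 'rV[R]_n) : `|w| ^+ 2 <= sqnorm w.
Proof.
have s0 : 0 <= sqnorm w by apply: sumr_ge0 => j _; exact: sqr_ge0.
rewrite -[leRHS]sqr_sqrtr // ler_sqr ?nnegrE ?sqrtr_ge0 //.
apply: norm_rV_le; first exact: sqrtr_ge0.
move=> j; rewrite -sqrtr_sqr ler_sqrt //.
rewrite /sqnorm (bigD1 j) //= lerDl.
by apply: sumr_ge0 => i _; exact: sqr_ge0.
Qed.

Lemma sqnorm_le n (w : 'rV[R]_n) : sqnorm w <= n%:R * `|w| ^+ 2.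
Proof.
apply: (@le_trans _ _ (\sum_(j < n) `|w| ^+ 2)).
  by apply: ler_sum => j _; rewrite -real_normK ?num_real // ler_sqr ?nnegrE // norm_coord.
by rewrite sumr_const card_ord -[leLHS]mulr_natl.
Qed.

Context {V : normedModType R} {p : nat} (b : 'I_p -> V).

Definition lincomb (w : 'rV[R]_p) : V := \sum_j w 0 j *: b j.

Lemma lincomb_is_linear : linear lincomb.
Proof.
move=> a u w; rewrite /lincomb scaler_sumr -big_split /=.
by apply: eq_bigr => j _; rewrite !mxE scalerDl scalerA.
Qed.

HB.instance Definition _ := GRing.isLinear.Build R 'rV[R]_p V _ lincomb lincomb_is_linear.

Lemma norm_lincomb : exists2 K, 0 < K & forall w, `|lincomb w| <= K * `|w|.
Proof.
exists (1 + \sum_j `|b j|); first by rewrite ltr_pwDl // sumr_ge0.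
move=> w; apply: le_trans (ler_norm_sum _ _ _) _.
apply: (@le_trans _ _ (\sum_j `|b j| * `|w|)).
  by apply: ler_sum => j _; rewrite normrZ mulrC ler_wpM2l // norm_coord.
by rewrite -mulr_suml mulrDl mul1r lerDr.
Qed.

Lemma continuous_lincomb : continuous lincomb.
Proof.
have -> : lincomb = \sum_j (fun w : 'rV[R]_p => w 0 j *: b j).
  by apply/funext => w; rewrite fct_sumE.
move=> w; apply: differentiable_continuous; apply: differentiable_sum => j.
exact/differentiableZl/differentiable_coord.
Qed.

(* Minimise the squared distance from [Phi (x + s *: v + lincomb w)] to [Phi x]
   over the ball |w| <= e * s: the minimum is interior, so the gradient vanishes
   there, and since the differential is close to the identity along [lincomb],
   the value at the minimum is 0. *)
Lemma level_set_point (Phi : V -> 'rV[R]_p) x v (e : R) :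
  (\forall y \near x, differentiable Phi y) ->
  (forall j, {for x, continuous (fun y => 'd Phi y (b j))}) ->
  (forall j, 'd Phi x (b j) = delta_mx 0 j) ->
  'd Phi x v = 0 -> 0 < e ->
  exists2 r : R, 0 < r & forall s, 0 < s -> s < r ->
    exists2 w, `|w| <= e * s & Phi (x + s *: v + lincomb w) = Phi x.
Proof.
move=> dPhi cPhi Phib Phiv e0.
have [K K0 hK] := norm_lincomb.
have Phil w : 'd Phi x (lincomb w) = w.
  rewrite /lincomb linear_sum [RHS]row_sum_delta; apply: eq_bigr => j _.
  by rewrite linearZ Phib.
(* Chosen such that p ^ 2 * kap = 1 - kap: the final estimate then reads |eta|^2 <= (1 - kap)
   |eta|^2. *)
pose kap : R := (p%:R ^+ 2 + 1)^-1.
have kap0 : 0 < kap by rewrite invr_gt0 ltr_wpDl // sqr_ge0.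
have near_kap : \forall y \near x, forall j, `|'d Phi y (b j) - delta_mx 0 j| < kap.
  have : forall j, \forall y \near x, `|'d Phi y (b j) - delta_mx 0 j| < kap.
    move=> j; have /cvgrPdist_lt/(_ _ kap0) := cPhi j.
    by apply: filterS => y /=; rewrite Phib distrC.
  exact: filter_forall.
have [r1 r10 h1] : exists2 r1 : R, 0 < r1 & forall h, `|h| < r1 ->
    differentiable Phi (x + h) /\ forall j, `|'d Phi (x + h) (b j) - delta_mx 0 j| < kap.
  apply: (@nbhs_radius R V x (fun y => differentiable Phi y /\
    forall j, `|'d Phi y (b j) - delta_mx 0 j| < kap)).
  by near=> y; split; near: y.
pose c := `|v| + K * e.
have c0 : 0 < c by rewrite ltr_wpDl // mulr_gt0.
(* With a = e' * (s * c), the error bound for [E w - w] on the ball, the radius e * s equals (p + 2)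
   a. *)
pose e' := e / (c * (p%:R + 2)).
have p20 : 0 < p%:R + 2 :> R by rewrite ltr_wpDl.
have e'0 : 0 < e' by rewrite divr_gt0 // mulr_gt0.
have [r2 r20 h2] := diff_eps (nbhs_singleton dPhi) e'0.
exists (Num.min r1 r2 / c); first by rewrite divr_gt0 // lt_min r10.
move=> s s0; rewrite ltr_pdivlMr // lt_min => /andP[sr1 sr2].
have small w : `|w| <= e * s -> `|s *: v + lincomb w| <= s * c.
  move=> hw; apply: le_trans (ler_normD _ _) _.
  rewrite normrZ gtr0_norm // mulrDr lerD2l.
  apply: le_trans (hK w) _; rewrite mulrCA ler_pM2l // mulrC; exact: hw.
pose E w : 'rV[R]_p := Phi (x + s *: v + lincomb w) - Phi x.
have dE w : `|w| <= e * s -> differentiable E w /\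
    forall u, 'd E w u = 'd Phi (x + s *: v + lincomb w) (lincomb u).
  move=> hw.
  have dP : differentiable Phi (x + s *: v + lincomb w).
    by rewrite -addrA; have [] := h1 _ (le_lt_trans (small w hw) sr1).
  pose l := fun w => x + s *: v + lincomb w.
  have [dl dlE] : is_diff w l lincomb.
    have dL : is_diff w lincomb lincomb.
      split; first exact: (linear_differentiable _ continuous_lincomb).
      exact: (diff_lin _ continuous_lincomb).
    have := @is_diffD R _ V (cst (x + s *: v)) lincomb 0 lincomb w _ dL.
    by rewrite add0r; apply.
  have dPl := differentiable_comp dl dP.
  have [dEw dEE] : is_diff w E (fun u => 'd (Phi \o l) w u - 0).
    exact: is_diffB (differentiableP dPl) (is_diff_cst (Phi x) w).
  split=> // u; rewrite (congr1 (@^~ u) dEE).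
  transitivity ('d (Phi \o l) w u); first exact: subr0.
  by rewrite (congr1 (@^~ u) (diff_comp dl dP)) /= (congr1 (@^~ u) dlE).
pose G w := sqnorm (E w).
have [w0 w0s w0min] : exists2 w0, `|w0| <= e * s & forall w, `|w| <= e * s -> G w0 <= G w.
  have [|||w0] := @EVT_min_rV R p G [set w | `|w| <= e * s].
  - by exists 0; rewrite /= normr0 mulr_ge0 // ltW.
  - apply: bounded_closed_compact.
      by exists (e * s); split; [exact: num_real|move=> y /ltW ey w /= /le_trans; apply].
    have -> : [set w : 'rV[R]_p | `|w| <= e * s] = Num.norm @^-1` [set t : R | t <= e * s] by [].
    by apply: closed_comp; [move=> w _; exact: norm_continuous|exact: closed_le].
  - apply: continuous_in_subspaceT => w; rewrite inE /= => hw.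
    apply: differentiable_continuous.
    have -> : G = \sum_j (fun w => E w 0 j) ^+ 2.
      by apply/funext => u; rewrite fct_sumE.
    apply: differentiable_sum => j; apply: differentiableX.
    by apply: diff_coord; have [] := dE w hw.
  - by rewrite inE => h hm; exists w0 => // w hw; apply: hm; rewrite inE.
have p0 : 0 <= p%:R :> R by exact: ler0n.
pose a := e' * (s * c).
have aE : e * s = (p%:R + 2) * a.
  by rewrite /a /e'; field; rewrite !gt_eqF.
have a0 : 0 < a by apply: mulr_gt0 => //; apply: mulr_gt0.
have Ew w : `|w| <= e * s -> `|E w - w| <= a.
  move=> hw; have := h2 _ (le_lt_trans (small w hw) sr2).
  rewrite linearD linearZ /= Phiv scaler0 add0r Phil addrA => /le_trans; apply.
  by rewrite ler_pM2l //; exact: small.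
(* On the boundary |E w| >= (p + 2) a - a = (p + 1) a, whereas |E 0| <= a and so [G 0] <= p a^2 < (p
   + 1)^2 a^2: a minimiser on the boundary would be worse than the centre. *)
have w0lt : `|w0| < e * s.
  rewrite lt_neqAle w0s andbT; apply/negP => /eqP w0e.
  have es0 : `|0 : 'rV[R]_p| <= e * s by rewrite normr0 mulr_ge0 // ltW.
  have k1 := w0min 0 es0.
  have k2 := sqnorm_le (E 0); have k3 := sqnorm_ge (E w0).
  have k4 := Ew 0 es0; rewrite subr0 in k4.
  have k5 : (p%:R + 1) * a <= `|E w0|.
    have := lerB_normD (w0 : 'rV[R]_p) (E w0 - w0); rewrite subrKC.
    by rewrite w0e aE; have := Ew w0 w0s; lra.
  have k6 : `|E 0| ^+ 2 <= a ^+ 2 by rewrite ler_sqr ?nnegrE // ltW.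
  have k7 : ((p%:R + 1) * a) ^+ 2 <= `|E w0| ^+ 2.
    by rewrite ler_sqr ?nnegrE // mulr_ge0 ?ltW // ltr_wpDl.
  have k8 : ((p%:R + 1) * a) ^+ 2 <= p%:R * a ^+ 2.
    apply: le_trans k7 _; apply: le_trans k3 _; apply: le_trans k1 _.
    by apply: le_trans k2 _; rewrite ler_wpM2l.
  have a20 : 0 < a ^+ 2 by rewrite exprn_gt0.
  by move: k8; rewrite exprMn ler_pM2r //; nra.
exists w0 => //; apply/eqP; rewrite -subr_eq0 -/(E w0); set eta := E w0.
pose d := 'd Phi (x + s *: v + lincomb w0) (lincomb eta).
(* Half the derivative of [G] at the interior minimum [w0], in the direction of the residue [eta]
   itself. *)
have crit : \sum_j eta 0 j * d 0 j = 0.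
  have et0 : 0 < `|eta| + 1 by rewrite ltr_wpDl.
  pose del := (e * s - `|w0|) / (`|eta| + 1).
  have del0 : 0 < del by rewrite divr_gt0 // subr_gt0.
  have inball t : t \in `]- del, del[ -> `|w0 + t *: eta| <= e * s.
    rewrite in_itv /= -ltr_norml => /ltW; rewrite ler_pdivlMr // => ht.
    apply: le_trans (ler_normD _ _) _; rewrite normrZ -lerBrDl.
    by apply: le_trans ht; rewrite ler_wpM2l // lerDl.
  pose F t := G (w0 + t *: eta).
  have dF t : t \in `]- del, del[ -> is_derive t (1 : R) F
      (\sum_j (2 * E (w0 + t *: eta) 0 j) * 'd E (w0 + t *: eta) eta 0 j).
    move=> /inball ht; have [dEt _] := dE _ ht.
    have -> : F = \sum_j (fun t => E (w0 + t *: eta) 0 j) ^+ 2.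
      by apply/funext => u; rewrite fct_sumE.
    apply: is_derive_sum => j.
    have [_ dc] := diff_rV (diff_coord dEt).
    rewrite dc; have := is_derive_line (diff_coord dEt j).
    by move=> h; apply: is_derive_eq (is_deriveX _ h) _.
  have z0 : (0 : R) \in `]- del, del[ by rewrite in_itv /= oppr_lt0 del0.
  have ld : - del <= del by rewrite ge0_cp // ltW.
  have [] := @derive1_at_min R F (- del) del 0 ld.
  - by move=> t /dF [].
  - exact: z0.
  - by move=> t ht; rewrite /F scale0r addr0; apply: w0min; exact: inball.
  move=> _ D0; have [_] := dF 0 z0; rewrite D0 scale0r addr0 => D1.
  apply: (mulfI (_ : 2 != 0 :> R)) => //; rewrite mulr0 [RHS]D1 mulr_sumr.
  by apply: eq_bigr => j _; have [_ ->] := dE w0 w0s; rewrite mulrA.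
have [_ xk] : differentiable Phi (x + (s *: v + lincomb w0)) /\ forall j,
    `|'d Phi (x + (s *: v + lincomb w0)) (b j) - delta_mx 0 j| < kap.
  by apply: h1; apply: le_lt_trans sr1; exact: small.
have dj j : `|eta 0 j - d 0 j| <= p%:R * (`|eta| * kap).
  have -> : eta 0 j - d 0 j = \sum_i eta 0 i * (delta_mx 0 i - 'd Phi (x + (s *: v + lincomb w0)) (b i)) 0 j.
    rewrite /d addrA /lincomb linear_sum summxE {1}(row_sum_delta eta) summxE -sumrB.
    by apply: eq_bigr => i _; rewrite linearZ !mxE mulrBr.
  apply: le_trans (ler_norm_sum _ _ _) _.
  apply: (@le_trans _ _ (\sum_(i < p) `|eta| * kap)); last first.
    by rewrite sumr_const card_ord -[leLHS]mulr_natl.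
  apply: ler_sum => i _; rewrite normrM ler_pM //; first exact: norm_coord.
  by apply: le_trans (norm_coord _ _) _; rewrite distrC ltW.
(* By [crit], |eta|^2 in the Euclidean sense is the product of [eta] with [eta - d], which is small
   because the differential nearly maps [lincomb eta] to [eta]. *)
have sq : sqnorm eta <= p%:R * (`|eta| * (p%:R * (`|eta| * kap))).
  have -> : sqnorm eta = \sum_j eta 0 j * (eta 0 j - d 0 j).
    under [RHS]eq_bigr do rewrite mulrBr -expr2.
    by rewrite sumrB crit subr0.
  apply: (@le_trans _ _ (\sum_(j < p) `|eta| * (p%:R * (`|eta| * kap)))); last first.
    by rewrite sumr_const card_ord -[leLHS]mulr_natl.
  apply: ler_sum => j _; apply: le_trans (ler_norm _) _.
  by rewrite normrM ler_pM // norm_coord.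
have := le_trans (sqnorm_ge eta) sq.
have -> : p%:R * (`|eta| * (p%:R * (`|eta| * kap))) = `|eta| ^+ 2 * (1 - kap).
  by rewrite /kap; field; rewrite gt_eqF // ltr_wpDl // sqr_ge0.
rewrite -subr_ge0 mulrBr mulr1 addrAC subrr add0r oppr_ge0 pmulr_lle0 // => h.
by rewrite -normr_eq0 -sqrf_eq0 eq_le h sqr_ge0.
Unshelve. all: by end_near. Qed.

(** A curve in the level set with velocity [v] would settle this. Instead, for each small s there is
    a point of the level set at distance O(e s) from x + s v; [c] vanishes there, and the
    first-order expansion of [c] bounds |'d c x v| by a multiple of [e]. *)
Lemma diff_level_set (Phi : V -> 'rV[R]_p) (c : V -> R) x v :
  (\forall y \near x, differentiable Phi y) ->
  (forall j, {for x, continuous (fun y => 'd Phi y (b j))}) ->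
  (forall j, 'd Phi x (b j) = delta_mx 0 j) ->
  'd Phi x v = 0 ->
  differentiable c x ->
  (\forall y \near x, Phi y = Phi x -> c y = 0) ->
  'd c x v = 0.
Proof.
move=> dPhi cPhi Phib Phiv dc /nbhs_radius[r0 r00 c0].
have [K K0 hK] := norm_lincomb.
have [k k0 hk] := linear_lipschitz (diff_continuous dc).
(* The term k * K comes from ['d c x] on the correction [lincomb w], the terms |v| + K from the
   error of the first-order expansion of [c]. *)
pose M := k * K + `|v| + K.
have M0 : 0 < M by rewrite addr_gt0 // ltr_pwDl // mulr_gt0.
suff h (e : R) : 0 < e -> e < 1 -> `|'d c x v| <= e * M.
  apply/eqP; rewrite -normr_le0; apply/ler_addgt0Pl => e e0; rewrite addr0.
  (* The bound below 1 allows e * s * K to be estimated by s * K in the size of the displacement. *)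
  pose e1 := Num.min (e / M) (2^-1).
  have e10 : 0 < e1 by rewrite lt_min divr_gt0 //= invr_gt0.
  apply: le_trans (h e1 e10 _) _.
    by rewrite gt_min; apply/orP; right; rewrite invf_lt1 // ltr1n.
  by rewrite -ler_pdivlMr // ge_min lexx.
move=> e0 e1.
have [r1 r10 h1] := level_set_point dPhi cPhi Phib Phiv e0.
have [r2 r20 h2] := diff_eps dc e0.
pose m := Num.min r1 (Num.min r0 r2 / (`|v| + K)).
have vK : 0 < `|v| + K by rewrite ltr_wpDl.
have m0 : 0 < m by rewrite lt_min r10 divr_gt0 // lt_min r00.
pose s := m / 2.
have s0 : 0 < s by rewrite divr_gt0.
have : s < m by rewrite /s ltr_pdivrMr // mulr_natr mulr2n ltrDl.
rewrite lt_min ltr_pdivlMr // lt_min => /and3P[s1 s2 s3].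
have [w hw Pw] := h1 s s0 s1.
have lw : `|lincomb w| <= K * (e * s) by apply: le_trans (hK w) _; rewrite ler_pM2l.
have hs : `|s *: v + lincomb w| <= s * (`|v| + K).
  apply: le_trans (ler_normD _ _) _; rewrite normrZ gtr0_norm // mulrDr lerD2l.
  by apply: le_trans lw _; rewrite [leRHS]mulrC ler_pM2l // ler_piMl // ltW.
have cx : c x = 0.
  by have := c0 0; rewrite normr0 addr0; apply.
have := h2 _ (le_lt_trans hs s3).
rewrite c0 ?cx ?subr0 ?sub0r ?normrN; last 2 first.
- exact: le_lt_trans hs s2.
- by rewrite addrA.
rewrite linearD linearZ /= => h3.
rewrite -(ler_pM2l s0) -{1}(gtr0_norm s0) -normrM.
have : `|s * 'd c x v| <= `|s * 'd c x v + 'd c x (lincomb w)| + `|'d c x (lincomb w)|.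
  by rewrite -{1}(addrK ('d c x (lincomb w)) (s * _)) ler_normB.
move=> /le_trans; apply; apply: le_trans (lerD h3 (hk _)) _.
apply: le_trans (lerD (ler_wpM2l (ltW e0) hs) (ler_wpM2l (ltW k0) lw)) _.
by rewrite le_eqVlt; apply/orP; left; apply/eqP; rewrite /M; ring.
Qed.

End LevelSet.

(** * Calculus on manifolds *)

Section ManifoldCalculus.
Context {R : realType} {m : nat} {M : manifold R m}.
Implicit Types (a q r : M) (U : set M) (X Y : vfield M R m).

Local Notation cd a := (cdom (chart_at a)).
Local Notation cm a := (cmap (chart_at a)).
Local Notation ci a := (cinv (chart_at a)).

Lemma cd_open a : open (cd a). Proof. by have [] := chart_atP a. Qed.

Lemma cd_id q : cd q q. Proof. exact: chart_at_mem. Qed.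

Lemma ciK a q : cd a q -> ci a (cm a q) = q.
Proof. by have [_ _ + _ _] := chart_atP a; exact. Qed.

Lemma cm_img a U q : cd a q -> U q -> (cm a @` (cd a `&` U)) (cm a q).
Proof. by move=> aq Uq; exists q. Qed.

Lemma in_img a U y : (cm a @` (cd a `&` U)) y ->
  [/\ cd a (ci a y), U (ci a y) & cm a (ci a y) = y].
Proof. by move=> [q [aq Uq] <-]; rewrite ciK. Qed.

Lemma ci_cont a y : (cm a @` cd a) y -> {for y, continuous (ci a)}.
Proof. by have [_ _ _ _] := chart_atP a; exact. Qed.

Lemma cm_cont a q : cd a q -> {for q, continuous (cm a)}.
Proof. by have [_ _ _ + _] := chart_atP a; exact. Qed.

Lemma img_open a U : open U -> open (cm a @` (cd a `&` U)).
Proof.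
move=> oU; have [_ oa _ _ _] := chart_atP a.
rewrite openE => y hy; have [ay Uy yE] := in_img hy.
have ya : (cm a @` cd a) y by exists (ci a y).
have n1 : \forall z \near y, (cm a @` cd a) z by exact: open_nbhs_nbhs.
have n2 : \forall z \near y, U (ci a z).
  by apply: (ci_cont ya); exact: open_nbhs_nbhs.
rewrite /interior; near=> z.
have [q aq qz] : (cm a @` cd a) z by near: z.
have Uz : U (ci a z) by near: z.
by exists q => //; split=> //; rewrite -(ciK aq) qz.
Unshelve. all: by end_near. Qed.

Lemma near_img a q (P : M -> Prop) : cd a q -> (\forall r \near q, P r) ->
  \forall y \near cm a q, P (ci a y).
Proof.
move=> aq; rewrite -{1}(ciK aq) => h.
by apply: (@ci_cont a (cm a q)) => //; exists q.
Qed.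

Lemma near_open U q : open U -> U q -> \forall r \near q, U r.
Proof. by move=> oU Uq; exact: open_nbhs_nbhs. Qed.

Lemma smooth_on_subset (W : normedModType R) (A B : set M) (f : M -> W) :
  A `<=` B -> smooth_on B f -> smooth_on A f.
Proof.
move=> AB h a k; apply: Ck_subset (h a k) => y [q [aq /AB Bq] <-].
exact: cm_img.
Qed.

Lemma smooth_on_eq (W : normedModType R) U (f g : M -> W) : open U ->
  (forall r, U r -> f r = g r) -> smooth_on U f -> smooth_on U g.
Proof.
move=> oU fg h a k; apply: Ck_eq (h a k); first exact: img_open.
by move=> y /in_img[_ Uy _] /=; exact: fg.
Qed.

Lemma smooth_on_local (W : normedModType R) U (f : M -> W) :
  (forall q, U q -> exists2 U', U' q & smooth_on U' f) -> smooth_on U f.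
Proof.
move=> h a k; apply: Ck_local => y /in_img[ay Uy yE].
have [U' U'q s] := h _ Uy.
by exists (cm a @` (cd a `&` U')); [exists (ci a y)|exact: s].
Qed.

Lemma smooth_on_cst (W : normedModType R) U (c : W) : smooth_on U (fun=> c).
Proof. by move=> a k; exact: Ck_cst. Qed.

Lemma smooth_onD (W : normedModType R) U (f g : M -> W) : open U ->
  smooth_on U f -> smooth_on U g -> smooth_on U (fun r => f r + g r).
Proof. by move=> oU sf sg a k; apply: Ck_D; [exact: img_open|exact: sf|exact: sg]. Qed.

Lemma smooth_onM U (f g : M -> R) : open U ->
  smooth_on U f -> smooth_on U g -> smooth_on U (fun r => f r * g r).
Proof. by move=> oU sf sg a k; apply: Ck_M; [exact: img_open|exact: sf|exact: sg]. Qed.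

Lemma smooth_onN U (f : M -> R) : open U ->
  smooth_on U f -> smooth_on U (fun r => - f r).
Proof.
move=> oU sf; apply: (@smooth_on_eq R U (fun r => (-1) * f r) _ oU).
  by move=> r _; rewrite mulN1r.
by apply: smooth_onM => //; exact: smooth_on_cst.
Qed.

Lemma smooth_onB U (f g : M -> R) : open U ->
  smooth_on U f -> smooth_on U g -> smooth_on U (fun r => f r - g r).
Proof. by move=> oU sf sg; apply: smooth_onD => //; exact: smooth_onN. Qed.

Lemma smooth_on_sum (I : Type) (s : seq I) (P : pred I) (W : normedModType R)
    U (f : I -> M -> W) : open U ->
  (forall i, P i -> smooth_on U (f i)) -> smooth_on U (fun r => \sum_(i <- s | P i) f i r).
Proof.
move=> oU h a k; apply: (@Ck_sum _ _ _ _ _ _ _ _ (fun i => f i \o ci a)).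
  exact: img_open.
by move=> i Pi; exact: h.
Qed.

Lemma smooth_on_prod (I : Type) (s : seq I) (P : pred I)
    U (f : I -> M -> R) : open U ->
  (forall i, P i -> smooth_on U (f i)) -> smooth_on U (fun r => \prod_(i <- s | P i) f i r).
Proof.
move=> oU h; elim: s => [|i s IH].
  apply: (@smooth_on_eq R U (fun=> 1) _ oU); last exact: smooth_on_cst.
  by move=> r _; rewrite big_nil.
have [Pi|Pi] := boolP (P i).
  apply: (@smooth_on_eq R U (fun r => f i r * \prod_(i <- s | P i) f i r) _ oU).
    by move=> r _; rewrite big_cons Pi.
  by apply: smooth_onM => //; exact: h.
by apply: smooth_on_eq IH => // r _; rewrite big_cons (negbTE Pi).
Qed.

Lemma smooth_on_comp1 U (B : set R) (f : M -> R) (g : R -> R) : open U ->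
  (forall r, U r -> B (f r)) -> smooth_on U f -> Csmooth B g ->
  smooth_on U (fun r => g (f r)).
Proof.
move=> oU fB sf sg a k; apply: (@Ck_comp1 _ _ _ _ B (f \o ci a) g).
- exact: img_open.
- by move=> y /in_img[_ Uy _]; exact: fB.
- exact: sf.
- exact: sg.
Qed.

Lemma smooth_onV U (f : M -> R) : open U -> (forall r, U r -> f r != 0) ->
  smooth_on U f -> smooth_on U (fun r => (f r)^-1).
Proof.
move=> oU f0 sf; apply: (smooth_on_comp1 (B := [set x | x != 0])) => // k.
exact: Ck_inv.
Qed.

Lemma smooth_on_coord n U (f : M -> 'rV[R]_n) j : open U ->
  smooth_on U f -> smooth_on U (fun r => f r 0 j).
Proof.
by move=> oU sf a k; apply: (@Ck_coord _ _ _ _ _ (f \o ci a)); [exact: img_open|exact: sf].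
Qed.

Lemma smooth_on_rV n U (f : M -> 'rV[R]_n) : open U ->
  (forall j, smooth_on U (fun r => f r 0 j)) -> smooth_on U f.
Proof.
by move=> oU sf a k; apply: Ck_rV => [|j]; [exact: img_open|exact: sf].
Qed.

Lemma smooth_on_comp n U (B : set 'rV[R]_n) (f : M -> 'rV[R]_n) (g : 'rV[R]_n -> R) :
  open U -> (forall r, U r -> B (f r)) -> smooth_on U f -> Csmooth B g ->
  smooth_on U (fun r => g (f r)).
Proof.
move=> oU fB sf sg a k; apply: (@Ck_comp _ _ _ _ _ B (f \o ci a) g).
- exact: img_open.
- by move=> y /in_img[_ Uy _]; exact: fB.
- exact: sf.
- exact: sg.
Qed.

Lemma smooth_on_cm a : smooth_on (cd a) (cm a).
Proof. by move=> b; exact: manifold_smooth. Qed.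

Lemma smooth_on_of_chart a U (g : 'rV[R]_m -> R) : open U -> U `<=` cd a ->
  Csmooth (cm a @` (cd a `&` U)) g -> smooth_on U (fun r => g (cm a r)).
Proof.
move=> oU Ua sg; apply: smooth_on_comp sg => //.
  by move=> r Ur; apply: cm_img => //; exact: Ua.
exact: smooth_on_subset Ua (smooth_on_cm a).
Qed.

Lemma smooth_diff (W : normedModType R) U (f : M -> W) a q :
  smooth_on U f -> cd a q -> U q -> differentiable (f \o ci a) (cm a q).
Proof. by move=> sf aq Uq; apply: Csmooth_diff (sf a) _; exact: cm_img. Qed.

Lemma smooth_cont (W : normedModType R) U (f : M -> W) q :
  open U -> smooth_on U f -> U q -> {for q, continuous f}.
Proof.
move=> oU sf Uq; have df := smooth_diff sf (cd_id q) Uq.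
have c : {for q, continuous ((f \o ci q) \o cm q)}.
  apply: continuous_comp; first exact/cm_cont/cd_id.
  exact: differentiable_continuous.
have e : f q = ((f \o ci q) \o cm q) q by rewrite /= ciK //; exact: cd_id.
rewrite /prop_for /continuous_at e; apply: cvg_trans c.
apply: near_eq_cvg; near=> r; rewrite /= ciK //.
by near: r; apply: near_open; [exact: cd_open|exact: cd_id].
Unshelve. all: by end_near. Qed.

Lemma ddir_near_eq (W : normedModType R) U (f g : M -> W) q v :
  smooth_on U f -> U q -> (\forall r \near q, f r = g r) ->
  ddir g q v = ddir f q v.
Proof.
move=> sf Uq fg.
have [_ e] := diff_near_eq (near_img (cd_id q) fg) (smooth_diff sf (cd_id q) Uq).
exact: e.
Qed.

Lemma ddir_chart (W : normedModType R) U (f : M -> W) a q v :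
  smooth_on U f -> cd a q -> U q ->
  ddir f q v = 'd (f \o ci a) (cm a q) (ddir (cm a) q v).
Proof.
move=> sf aq Uq; rewrite /ddir.
have qq := cd_id q.
have dt : differentiable (cm a \o ci q) (cm q q).
  exact: smooth_diff (smooth_on_cm a) qq aq.
have e : (cm a \o ci q) (cm q q) = cm a q by rewrite /= ciK.
have df : differentiable (f \o ci a) (cm a q) by exact: smooth_diff sf aq Uq.
have near_e : \forall y \near cm q q,
    (f \o ci a) ((cm a \o ci q) y) = (f \o ci q) y.
  have : \forall r \near q, f (ci a (cm a r)) = f r.
    have := near_open (cd_open a) aq; apply: filterS => r ar.
    by rewrite ciK.
  exact: near_img.
exact: (diff_chain v e dt df near_e).
Qed.

Lemma ddir_self q v : ddir (cm q) q v = v.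
Proof.
rewrite /ddir.
have o : open (cm q @` cd q) by have [] := chart_atP q.
have h : \forall y \near cm q q, (cm q @` cd q) y.
  by apply: open_nbhs_nbhs; split=> //; exists q => //; exact: cd_id.
have ne : \forall y \near cm q q, y = (cm q \o ci q) y.
  by move: h; apply: filterS => y [r qr <-] /=; rewrite ciK.
have [di dE] := is_diff_id (cm q q).
have [_ h1] := diff_near_eq ne di.
exact: etrans (h1 v) (congr1 (@^~ v) dE).
Qed.

End ManifoldCalculus.

(** * Vector fields in charts *)

Section VectorFields.
Context {R : realType} {m : nat} {M : manifold R m}.
Implicit Types (a q r : M) (U : set M) (X Y : vfield M R m).

Local Notation cd a := (cdom (chart_at a)).
Local Notation cm a := (cmap (chart_at a)).
Local Notation ci a := (cinv (chart_at a)).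

(* The coordinate field of [chart_at a] with constant components [w]; its value
   at r is expressed in [chart_at r], whence the transition map. *)
Definition cfield a (w : 'rV[R]_m) : vfield M R m :=
  fun r => 'd (cm r \o ci a) (cm a r) w.

Lemma cfieldK a r w : cd a r -> ddir (cm a) r (cfield a w r) = w.
Proof.
move=> ar; rewrite /cfield.
have rr := cd_id r.
have dt : differentiable (cm r \o ci a) (cm a r).
  exact: smooth_diff (smooth_on_cm r) ar rr.
have e : (cm r \o ci a) (cm a r) = cm r r by rewrite /= ciK.
have du : differentiable (cm a \o ci r) (cm r r).
  exact: smooth_diff (smooth_on_cm a) rr ar.
have ne : \forall y \near cm a r, (cm a \o ci r) ((cm r \o ci a) y) = id y.
  have o : open (cm a @` cd a) by have [] := chart_atP a.
  have o2 : \forall y \near cm a r, (cm a @` cd a) y.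
    by apply: open_nbhs_nbhs; split=> //; exists r.
  have o3 : \forall y \near cm a r, cd r (ci a y).
    by apply: near_img => //; apply: near_open => //; exact: cd_open.
  near=> y.
  have [s as_ sy] : (cm a @` cd a) y by near: y.
  have : cd r (ci a y) by near: y.
  by rewrite /= -sy (ciK as_) => rs; rewrite ciK.
have [_ dE] := is_diff_id (cm a r).
transitivity ('d (@id 'rV[R]_m) (cm a r) w); last exact: (congr1 (@^~ w) dE).
exact: esym (diff_chain w e dt du ne).
Unshelve. all: by end_near. Qed.

Lemma cfieldE a r v : cd a r -> cfield a (ddir (cm a) r v) r = v.
Proof.
by move=> ar; rewrite /cfield -(ddir_chart v (smooth_on_cm r) ar (cd_id r)) ddir_self.
Qed.

Lemma ddir_chart_inj a r u v : cd a r -> ddir (cm a) r u = ddir (cm a) r v -> u = v.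
Proof. by move=> ar e; rewrite -(cfieldE u ar) e cfieldE. Qed.

Lemma ddirD (W : normedModType R) (f : M -> W) q u v :
  ddir f q (u + v) = ddir f q u + ddir f q v.
Proof. exact: linearD. Qed.

Lemma ddirZ (W : normedModType R) (f : M -> W) q c v :
  ddir f q (c *: v) = c *: ddir f q v.
Proof. exact: linearZ. Qed.

Lemma ddirB (W : normedModType R) (f : M -> W) q u v :
  ddir f q (u - v) = ddir f q u - ddir f q v.
Proof. exact: linearB. Qed.

Lemma ddir0 (W : normedModType R) (f : M -> W) q : ddir f q 0 = 0.
Proof. exact: linear0. Qed.

Lemma ddir_sum (W : normedModType R) (f : M -> W) q (I : Type) (s : seq I) P (v : I -> 'rV[R]_m) :
  ddir f q (\sum_(i <- s | P i) v i) = \sum_(i <- s | P i) ddir f q (v i).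
Proof. exact: linear_sum. Qed.

Lemma ddir_cst (W : normedModType R) (c : W) q v : ddir (fun=> c : W) q v = 0.
Proof.
by rewrite /ddir (_ : _ \o _ = cst c) // diff_cst.
Qed.

Lemma ddir_const_near (W : normedModType R) U (f : M -> W) q v (c : W) :
  U q -> open U -> (forall r, U r -> f r = c) -> ddir f q v = 0.
Proof.
move=> Uq oU fc; rewrite -(ddir_cst c q v).
apply: (@ddir_near_eq _ _ _ _ U) => //; first exact: smooth_on_cst.
by apply: filterS (near_open oU Uq) => r /fc.
Qed.

Lemma ddir_add (W : normedModType R) U (f g : M -> W) q v :
  smooth_on U f -> smooth_on U g -> U q ->
  ddir (fun r => f r + g r) q v = ddir f q v + ddir g q v.
Proof.
move=> sf sg Uq; rewrite /ddir.
exact: (diffD_at v (smooth_diff sf (cd_id q) Uq) (smooth_diff sg (cd_id q) Uq)).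
Qed.

Lemma ddir_mul U (f g : M -> R) q v :
  smooth_on U f -> smooth_on U g -> U q ->
  ddir (fun r => f r * g r) q v = f q * ddir g q v + g q * ddir f q v.
Proof.
move=> sf sg Uq; rewrite /ddir.
apply: etrans (diffM_at v (smooth_diff sf (cd_id q) Uq) (smooth_diff sg (cd_id q) Uq)) _.
by rewrite /= ciK //; exact: cd_id.
Qed.

Lemma ddir_coord n U (f : M -> 'rV[R]_n) q v j :
  smooth_on U f -> U q -> ddir f q v 0 j = ddir (fun r => f r 0 j) q v.
Proof.
move=> sf Uq; have df := smooth_diff sf (cd_id q) Uq.
by have [_ ->] := diff_rV (diff_coord df).
Qed.

Lemma smooth_partial U (f : M -> R) a w : open U -> U `<=` cd a ->
  smooth_on U f -> smooth_on U (fun r => 'd (f \o ci a) (cm a r) w).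
Proof.
move=> oU Ua sf; apply: (smooth_on_of_chart (g := fun y => 'd (f \o ci a) y w)) => //.
exact: Csmooth_deriv (sf a).
Qed.

Lemma vf_smooth_subset (A B : set M) X : A `<=` B -> vf_smooth_on B X -> vf_smooth_on A X.
Proof.
by move=> AB sX a; apply: smooth_on_subset (sX a) => r [/AB].
Qed.

Lemma vf_smooth_eq U X Y : open U -> (forall r, U r -> X r = Y r) ->
  vf_smooth_on U X -> vf_smooth_on U Y.
Proof.
move=> oU XY sX a; apply: smooth_on_eq (sX a).
  by apply: openI => //; exact: cd_open.
by move=> r [Ur _]; rewrite /comps XY.
Qed.

Lemma vf_smooth_comps U X a : U `<=` cd a -> vf_smooth_on U X ->
  smooth_on U (comps (chart_at a) X).
Proof. by move=> Ua sX; apply: smooth_on_subset (sX a) => r Ur; split=> //; exact: Ua. Qed.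

Lemma smooth_ddir_chart n U (f : M -> 'rV[R]_n) X a : open U -> U `<=` cd a ->
  smooth_on U f -> smooth_on U (comps (chart_at a) X) ->
  smooth_on U (fun r => ddir f r (X r)).
Proof.
move=> oU Ua sf sX; apply: smooth_on_rV => // j.
have sfj := smooth_on_coord j oU sf.
apply: (@smooth_on_eq _ _ _ _ U (fun r => \sum_i comps (chart_at a) X r 0 i *
    'd ((fun r => f r 0 j) \o ci a) (cm a r) (delta_mx 0 i))) => //.
  move=> r Ur; rewrite (ddir_coord _ _ sf Ur) (ddir_chart _ sfj (Ua _ Ur) Ur).
  by rewrite [RHS]diff_row_sum.
apply: smooth_on_sum => // i _; apply: smooth_onM => //.
  exact: smooth_on_coord.
exact: smooth_partial.
Qed.

Lemma smooth_ddir_rV n U (f : M -> 'rV[R]_n) X : open U ->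
  smooth_on U f -> vf_smooth_on U X -> smooth_on U (fun r => ddir f r (X r)).
Proof.
move=> oU sf sX; apply: smooth_on_local => q Uq.
have o : open (U `&` cd q) by apply: openI => //; exact: cd_open.
exists (U `&` cd q); first by split=> //; exact: cd_id.
apply: (@smooth_ddir_chart _ _ _ _ q) => //.
  exact: smooth_on_subset sf.
Qed.

Lemma smooth_ddir U (f : M -> R) X : open U ->
  smooth_on U f -> vf_smooth_on U X -> smooth_on U (fun r => ddir f r (X r)).
Proof.
move=> oU sf sX.
have sF : smooth_on U (fun r => \row_(j < 1) f r : 'rV[R]_1).
  apply: smooth_on_rV => // j; apply: smooth_on_eq sf => // r _; by rewrite mxE.
have := smooth_on_coord 0 oU (smooth_ddir_rV oU sF sX).
apply: smooth_on_eq => // r Ur; rewrite (ddir_coord _ _ sF Ur).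
by congr (ddir _ _ _); apply/funext => s; rewrite mxE.
Qed.

(** A single chart containing [U] suffices: the components of [X] in another chart [b] are the
    derivatives along [X] of the coordinates of [b], which are smooth functions. *)
Lemma vf_smooth_chart U X a : open U -> U `<=` cd a ->
  smooth_on U (comps (chart_at a) X) -> vf_smooth_on U X.
Proof.
move=> oU Ua sX b.
have o : open (U `&` cd b) by apply: openI => //; exact: cd_open.
apply: (@smooth_ddir_chart _ _ _ _ a) => //.
- by move=> r [/Ua].
- by apply: smooth_on_subset (smooth_on_cm b) => r [].
- by apply: smooth_on_subset sX => r [].
Qed.

Lemma vf_smooth_local U X :
  (forall q, U q -> exists2 U', U' q & vf_smooth_on U' X) -> vf_smooth_on U X.
Proof.
move=> h a; apply: smooth_on_local => q [Uq aq].
by have [U' U'q s] := h q Uq; exists (U' `&` cd a); [split|exact: s].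
Qed.

Lemma vf_smoothD U X Y : open U -> vf_smooth_on U X -> vf_smooth_on U Y ->
  vf_smooth_on U (fun r => X r + Y r).
Proof.
move=> oU sX sY a.
have o : open (U `&` cd a) by apply: openI => //; exact: cd_open.
apply: smooth_on_eq (smooth_onD o (sX a) (sY a)) => // r _.
by rewrite /comps ddirD.
Qed.

Lemma vf_smoothZ U (f : M -> R) X : open U -> smooth_on U f -> vf_smooth_on U X ->
  vf_smooth_on U (fun r => f r *: X r).
Proof.
move=> oU sf sX a.
have o : open (U `&` cd a) by apply: openI => //; exact: cd_open.
apply: smooth_on_rV => // j.
apply: (@smooth_on_eq _ _ _ _ _ (fun r => f r * comps (chart_at a) X r 0 j)) => //.
  by move=> r _; rewrite /comps ddirZ mxE.
apply: smooth_onM => //; first by apply: smooth_on_subset sf => r [].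
exact: smooth_on_coord (sX a).
Qed.

Lemma vf_smooth0 U : vf_smooth_on U (fun=> 0 : 'rV[R]_m).
Proof.
move=> a; rewrite (_ : comps _ _ = fun=> 0); first exact: smooth_on_cst.
by apply/funext => r; rewrite /comps ddir0.
Qed.

Lemma vf_smoothN U X : open U -> vf_smooth_on U X -> vf_smooth_on U (fun r => - X r).
Proof.
move=> oU sX; apply: (vf_smooth_eq oU (X := fun r => (-1) *: X r)).
  by move=> r _; rewrite scaleN1r.
by apply: vf_smoothZ => //; exact: smooth_on_cst.
Qed.

Lemma vf_smoothB U X Y : open U -> vf_smooth_on U X -> vf_smooth_on U Y ->
  vf_smooth_on U (fun r => X r - Y r).
Proof. by move=> oU sX sY; apply: vf_smoothD => //; exact: vf_smoothN. Qed.

Lemma vf_smooth_sum (I : Type) (s : seq I) (P : pred I) U (X : I -> vfield M R m) :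
  open U -> (forall i, P i -> vf_smooth_on U (X i)) ->
  vf_smooth_on U (fun r => \sum_(i <- s | P i) X i r).
Proof.
move=> oU h; elim: s => [|i s IH].
  apply: (vf_smooth_eq oU (X := fun=> 0)); last exact: vf_smooth0.
  by move=> r _; rewrite big_nil.
have [Pi|Pi] := boolP (P i).
  apply: (vf_smooth_eq oU (X := fun r => X i r + \sum_(i <- s | P i) X i r)).
    by move=> r _; rewrite big_cons Pi.
  by apply: vf_smoothD => //; exact: h.
by apply: vf_smooth_eq IH => // r _; rewrite big_cons (negbTE Pi).
Qed.

Lemma comps_cfield a w r : cd a r -> comps (chart_at a) (cfield a w) r = w.
Proof. exact: cfieldK. Qed.

Lemma cfield_smooth a w : vf_smooth_on (cd a) (cfield a w).
Proof.
apply: (@vf_smooth_chart _ _ a) => //; first exact: cd_open.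
apply: smooth_on_eq (smooth_on_cst _ w); first exact: cd_open.
by move=> r ar; rewrite comps_cfield.
Qed.

Lemma cfield_self a w : cfield a w a = w.
Proof. by rewrite -{2}(cfieldK w (cd_id a)) ddir_self. Qed.

Lemma vf_expand a X r : cd a r ->
  X r = \sum_j comps (chart_at a) X r 0 j *: cfield a (delta_mx 0 j) r.
Proof.
move=> ar; rewrite -[LHS](cfieldE _ ar) {1}(row_sum_delta (ddir _ _ _)) {1}/cfield linear_sum.
by apply: eq_bigr => j _; rewrite linearZ.
Qed.

End VectorFields.

(** * Riemannian metrics and Levi-Civita connections *)

Section SmoothMatrices.
Context {R : realType} {m : nat} {M : manifold R m}.
Implicit Types (U : set M).

Definition msmooth k l U (A : M -> 'M[R]_(k, l)) : Prop :=
  forall i j, smooth_on U (fun r => A r i j).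

Lemma msmooth_mul k l n U (A : M -> 'M[R]_(k, l)) (B : M -> 'M[R]_(l, n)) :
  open U -> msmooth U A -> msmooth U B -> msmooth U (fun r => A r *m B r).
Proof.
move=> oU sA sB i j.
apply: (@smooth_on_eq _ _ _ _ U (fun r => \sum_h A r i h * B r h j)) => //.
  by move=> r _; rewrite mxE.
by apply: smooth_on_sum => // h _; exact: smooth_onM.
Qed.

Lemma msmooth_tr k l U (A : M -> 'M[R]_(k, l)) : open U ->
  msmooth U A -> msmooth U (fun r => (A r)^T).
Proof.
by move=> oU sA i j; apply: smooth_on_eq (sA j i) => // r _; rewrite mxE.
Qed.

Lemma smooth_det n U (A : M -> 'M[R]_n) : open U ->
  msmooth U A -> smooth_on U (fun r => \det (A r)).
Proof.
move=> oU sA; apply: smooth_on_sum => // s _; apply: smooth_onM => //.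
  exact: smooth_on_cst.
by apply: smooth_on_prod => // i _; exact: sA.
Qed.

Lemma msmooth_inv n U (A : M -> 'M[R]_n) : open U ->
  (forall r, U r -> A r \in unitmx) ->
  msmooth U A -> msmooth U (fun r => invmx (A r)).
Proof.
move=> oU uA sA i j.
apply: (@smooth_on_eq _ _ _ _ U (fun r => (\det (A r))^-1 * cofactor (A r) j i)) => //.
  by move=> r Ur; rewrite /invmx uA // !mxE.
apply: smooth_onM => //.
  apply: smooth_onV => //; last exact: smooth_det.
  by move=> r Ur; have := uA r Ur; rewrite unitmxE unitfE.
apply: smooth_onM => //; first exact: smooth_on_cst.
apply: smooth_det => // h l; apply: smooth_on_eq (sA (lift j h) (lift i l)) => // r _.
by rewrite !mxE.
Qed.

End SmoothMatrices.

Section InnerProducts.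
Context {R : realType} {m : nat} {M : manifold R m}.
Implicit Types (a q r : M) (U : set M) (X Y Z : vfield M R m) (u v w : 'rV[R]_m)
  (g : M -> 'M[R]_m).

Local Notation cd a := (cdom (chart_at a)).
Local Notation cm a := (cmap (chart_at a)).
Local Notation ci a := (cinv (chart_at a)).

Lemma ipDl g q u v w : ip g q (u + v) w = ip g q u w + ip g q v w.
Proof. by rewrite /ip !mulmxDl mxE. Qed.

Lemma ipDr g q u v w : ip g q u (v + w) = ip g q u v + ip g q u w.
Proof. by rewrite /ip linearD mulmxDr mxE. Qed.

Lemma ipZl g q c u v : ip g q (c *: u) v = c * ip g q u v.
Proof. by rewrite /ip -!scalemxAl mxE. Qed.

Lemma ipZr g q c u v : ip g q u (c *: v) = c * ip g q u v.
Proof. by rewrite /ip linearZ /= -scalemxAr mxE. Qed.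

Lemma ip0l g q v : ip g q 0 v = 0.
Proof. by rewrite -(scale0r v) ipZl mul0r. Qed.

Lemma ip0r g q v : ip g q v 0 = 0.
Proof. by rewrite -(scale0r v) ipZr mul0r. Qed.

Lemma ipNl g q u v : ip g q (- u) v = - ip g q u v.
Proof. by rewrite -scaleN1r ipZl mulN1r. Qed.

Lemma ipNr g q u v : ip g q u (- v) = - ip g q u v.
Proof. by rewrite -scaleN1r ipZr mulN1r. Qed.

Lemma ipBl g q u v w : ip g q (u - v) w = ip g q u w - ip g q v w.
Proof. by rewrite ipDl ipNl. Qed.

Lemma ipBr g q u v w : ip g q u (v - w) = ip g q u v - ip g q u w.
Proof. by rewrite ipDr ipNr. Qed.

Lemma ip_suml g q (I : Type) (s : seq I) (P : pred I) (F : I -> 'rV[R]_m) v :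
  ip g q (\sum_(i <- s | P i) F i) v = \sum_(i <- s | P i) ip g q (F i) v.
Proof.
by apply: (big_morph (fun u => ip g q u v)) => [u w|]; [exact: ipDl|exact: ip0l].
Qed.

Lemma ip_sumr g q (I : Type) (s : seq I) (P : pred I) (F : I -> 'rV[R]_m) v :
  ip g q v (\sum_(i <- s | P i) F i) = \sum_(i <- s | P i) ip g q v (F i).
Proof.
by apply: (big_morph (fun u => ip g q v u)) => [u w|]; [exact: ipDr|exact: ip0r].
Qed.

Context (g : M -> 'M[R]_m) (rg : riemannian g).

Lemma ipC q u v : ip g q u v = ip g q v u.
Proof.
have [sg _ _] := rg; rewrite /ip.
have -> : u *m g q *m v^T = (v *m g q *m u^T)^T.
  by rewrite !trmx_mul trmxK sg mulmxA.
by rewrite mxE.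
Qed.

Lemma ip_gt0 q u : u != 0 -> 0 < ip g q u u.
Proof. by have [_ + _] := rg; exact. Qed.

Lemma ip_eq0 q u : ip g q u u = 0 -> u = 0.
Proof. by move=> h; apply/eqP/negPn/negP => /(ip_gt0 q); rewrite h ltxx. Qed.

Lemma ip_nondeg q u : (forall v, ip g q u v = 0) -> u = 0.
Proof. by move=> h; exact: (@ip_eq0 q u (h u)). Qed.

Lemma ip_inj q u v : (forall w, ip g q u w = ip g q v w) -> u = v.
Proof.
by move=> h; apply: subr0_eq; apply: (@ip_nondeg q) => w; rewrite ipBl h subrr.
Qed.

Lemma ip_smooth U X Y : open U -> vf_smooth_on U X -> vf_smooth_on U Y ->
  smooth_on U (ipf g X Y).
Proof. by have [_ _ +] := rg; exact. Qed.

(** The matrix of [g] in the fixed chart of index [a]. Unlike those of [g r], which refers to a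
    chart varying with [r], its entries are smooth on the domain of that chart. *)
Definition gram a r : 'M[R]_m :=
  \matrix_(i, j) ip g r (cfield a (delta_mx 0 i) r) (cfield a (delta_mx 0 j) r).

Lemma cfield_expand a r u : cd a r ->
  u = \sum_j ddir (cm a) r u 0 j *: cfield a (delta_mx 0 j) r.
Proof. exact: (@vf_expand _ _ _ a (fun=> u)). Qed.

Lemma gramP a r u v : cd a r ->
  ip g r u v = (ddir (cm a) r u *m gram a r *m (ddir (cm a) r v)^T) 0 0.
Proof.
move=> ar; rewrite {1}(cfield_expand u ar) {1}(cfield_expand v ar).
rewrite ip_suml -mulmxA mxE; apply: eq_bigr => i _.
rewrite ipZl ip_sumr mxE; congr (_ * _); apply: eq_bigr => j _.
by rewrite ipZr !mxE mulrC.
Qed.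

Lemma gram_sym a r : (gram a r)^T = gram a r.
Proof. by apply/matrixP => i j; rewrite !mxE ipC. Qed.

Lemma gram_pos a r u : cd a r -> u != 0 -> 0 < (u *m gram a r *m u^T) 0 0.
Proof.
move=> ar u0; rewrite -(cfieldK u ar) -gramP //; apply: ip_gt0.
by apply: contra_neq u0 => h; rewrite -(cfieldK u ar) h ddir0.
Qed.

Lemma posdef_unitmx n (A : 'M[R]_n) :
  (forall u : 'rV[R]_n, u != 0 -> 0 < (u *m A *m u^T) 0 0) -> A \in unitmx.
Proof.
move=> pA; rewrite -row_free_unit -kermx_eq0; apply/eqP/row_matrixP => i.
rewrite row0; apply/eqP/negPn/negP => /pA.
by rewrite -row_mul mulmx_ker row0 mul0mx mxE ltxx.
Qed.

Lemma gram_unit a r : cd a r -> gram a r \in unitmx.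
Proof. by move=> ar; apply: posdef_unitmx => u; exact: gram_pos. Qed.

Lemma gram_smooth a U : open U -> U `<=` cd a -> msmooth U (gram a).
Proof.
move=> oU Ua i j.
have sc w := vf_smooth_subset Ua (cfield_smooth a w).
by apply: smooth_on_eq (ip_smooth oU (sc (delta_mx 0 i)) (sc (delta_mx 0 j))) => // r _; rewrite mxE.
Qed.

(** Raising an index: the components of [X] are its products with the coordinate fields times the
    inverse Gram matrix, smooth by Cramer's formula. *)
Lemma vf_smooth_raise U X : open U ->
  (forall a w, smooth_on (U `&` cd a) (fun r => ip g r (X r) (cfield a w r))) ->
  vf_smooth_on U X.
Proof.
move=> oU h; apply: vf_smooth_local => q Uq.
have o : open (U `&` cd q) by apply: openI => //; exact: cd_open.
have sub : U `&` cd q `<=` cd q by move=> r [].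
exists (U `&` cd q); first by split=> //; exact: cd_id.
apply: (vf_smooth_chart o sub); apply: smooth_on_rV => // j.
pose k r : 'rV[R]_m := \row_i ip g r (X r) (cfield q (delta_mx 0 i) r).
apply: (@smooth_on_eq _ _ _ _ _ (fun r => (k r *m invmx (gram q r)) 0 j)) => //.
  move=> r [Ur qr]; have -> : k r = comps (chart_at q) X r *m gram q r.
    apply/rowP => i; rewrite mxE (gramP _ _ qr) cfieldK // trmx_delta -colE.
    by rewrite [LHS]mxE.
  by rewrite mulmxK // gram_unit.
apply: (@msmooth_mul _ _ _ 1 m m) => //.
  by move=> i l; apply: smooth_on_eq (h q (delta_mx 0 l)) => // r _; rewrite mxE.
apply: msmooth_inv => //; first by move=> r [_ qr]; exact: gram_unit.
exact: gram_smooth.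
Qed.

End InnerProducts.

(** * Algebra and locality of a given Levi-Civita connection *)

Section LeviCivitaTheory.
Context {R : realType} {m : nat} {M : manifold R m}.
Implicit Types (a q r : M) (U : set M) (X Y Z : vfield M R m) (f : M -> R).
Context (g : M -> 'M[R]_m) (nabla : vfield M R m -> vfield M R m -> vfield M R m).
Hypothesis lc : is_levi_civita g nabla.

Lemma lc_smooth U X Y : open U -> vf_smooth_on U X -> vf_smooth_on U Y ->
  vf_smooth_on U (nabla X Y).
Proof.
by move=> oU sX sY; have [] := lc oU sX sY sY (smooth_on_cst U (0 : R)).
Qed.

Lemma lc_addl U X Y Z q : open U -> vf_smooth_on U X -> vf_smooth_on U Y ->
  vf_smooth_on U Z -> U q ->
  nabla (fun r => X r + Y r) Z q = nabla X Z q + nabla Y Z q.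
Proof.
move=> oU sX sY sZ Uq.
by have [_ /(_ q Uq)[[]]] := lc oU sX sY sZ (smooth_on_cst U (0 : R)).
Qed.

Lemma lc_scalel U X Y f q : open U -> vf_smooth_on U X -> vf_smooth_on U Y ->
  smooth_on U f -> U q -> nabla (fun r => f r *: X r) Y q = f q *: nabla X Y q.
Proof.
move=> oU sX sY sf Uq.
by have [_ /(_ q Uq)[[]]] := lc oU sX sY sY sf.
Qed.

Lemma lc_addr U X Y Z q : open U -> vf_smooth_on U X -> vf_smooth_on U Y ->
  vf_smooth_on U Z -> U q ->
  nabla X (fun r => Y r + Z r) q = nabla X Y q + nabla X Z q.
Proof.
move=> oU sX sY sZ Uq.
by have [_ /(_ q Uq)[]] := lc oU sX sY sZ (smooth_on_cst U (0 : R)).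
Qed.

Lemma lc_leibniz U X Y f q : open U -> vf_smooth_on U X -> vf_smooth_on U Y ->
  smooth_on U f -> U q ->
  nabla X (fun r => f r *: Y r) q = ddir f q (X q) *: Y q + f q *: nabla X Y q.
Proof.
move=> oU sX sY sf Uq.
by have [_ /(_ q Uq)[]] := lc oU sX sY sY sf.
Qed.

Lemma lc_torsion U X Y q : open U -> vf_smooth_on U X -> vf_smooth_on U Y ->
  U q -> nabla X Y q - nabla Y X q = lie_bracket X Y q.
Proof.
move=> oU sX sY Uq.
by have [_ /(_ q Uq)[]] := lc oU sX sY sY (smooth_on_cst U (0 : R)).
Qed.

Lemma lc_metric U X Y Z q : open U -> vf_smooth_on U X -> vf_smooth_on U Y ->
  vf_smooth_on U Z -> U q ->
  ddir (ipf g Y Z) q (X q) = ip g q (nabla X Y q) (Z q) + ip g q (Y q) (nabla X Z q).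
Proof.
move=> oU sX sY sZ Uq.
by have [_ /(_ q Uq)[]] := lc oU sX sY sZ (smooth_on_cst U (0 : R)).
Qed.

(* The axioms of [is_levi_civita] do not constrain fields outside U, but they
   do allow multiplication by the indicator function of the complement of U,
   which is smooth on U; this gives locality. *)
Let off U r : R := if `[< U r >] then 0 else 1.

Let off0 U r : U r -> off U r = 0.
Proof. by move=> Ur; rewrite /off asboolT. Qed.

Let off_smooth U : open U -> smooth_on U (off U).
Proof.
move=> oU; apply: smooth_on_eq (smooth_on_cst U (0 : R)) => // r Ur.
by rewrite off0.
Qed.

Let off_scale U X Y : (forall r, U r -> X r = Y r) ->
  (fun r => X r - Y r) = (fun r => off U r *: (X r - Y r)).
Proof.
move=> XY; apply/funext => r; rewrite /off.
by case: asboolP => [/XY->|_]; rewrite ?subrr ?scaler0 ?scale1r.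
Qed.

Lemma lc_locall U X X' Y q : open U -> vf_smooth_on U X' -> vf_smooth_on U Y ->
  (forall r, U r -> X r = X' r) -> U q -> nabla X Y q = nabla X' Y q.
Proof.
move=> oU sX' sY XX' Uq.
have sX : vf_smooth_on U X by apply: vf_smooth_eq sX' => // r /XX'.
have sW := vf_smoothB oU sX sX'.
have -> : X = fun r => X' r + (X r - X' r) by apply/funext => r; rewrite subrKC.
rewrite (lc_addl oU sX' sW sY Uq) (off_scale XX').
by rewrite (lc_scalel oU sW sY (off_smooth oU) Uq) off0 // scale0r addr0.
Qed.

Lemma lc_localr U X Y Y' q : open U -> vf_smooth_on U X -> vf_smooth_on U Y' ->
  (forall r, U r -> Y r = Y' r) -> U q -> nabla X Y q = nabla X Y' q.
Proof.
move=> oU sX sY' YY' Uq.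
have sY : vf_smooth_on U Y by apply: vf_smooth_eq sY' => // r /YY'.
have sW := vf_smoothB oU sY sY'.
have -> : Y = fun r => Y' r + (Y r - Y' r) by apply/funext => r; rewrite subrKC.
rewrite (lc_addr oU sX sY' sW Uq) (off_scale YY').
rewrite (lc_leibniz oU sX sW (off_smooth oU) Uq) off0 // scale0r addr0.
by rewrite YY' // subrr scaler0 addr0.
Qed.

End LeviCivitaTheory.

(* Given the connection of one metric g0, the connection of another metric g1
   is obtained by adding the tensor D with
   [2 g1(D(X,Y),Z) = (nabla0_X g1)(Y,Z) + (nabla0_Y g1)(X,Z) - (nabla0_Z g1)(X,Y)]. *)
Section LeviCivitaExistence.
Context {R : realType} {m : nat} {M : manifold R m}.
Implicit Types (a q r : M) (U : set M) (X Y Z : vfield M R m) (f : M -> R).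
Context (g0 g1 : M -> 'M[R]_m).
Context (nabla0 : vfield M R m -> vfield M R m -> vfield M R m).
Hypotheses (lc : is_levi_civita g0 nabla0) (rg : riemannian g1).

Local Notation cd a := (cdom (chart_at a)).

(** The covariant derivative (nabla0_X g1)(Y, Z). It is tensorial in all arguments, since the
    derivatives of coefficients cancel; this and locality are what the following lemmas
    establish. *)
Definition nabla_metric X Y Z q : R :=
  ddir (ipf g1 Y Z) q (X q) - ip g1 q (nabla0 X Y q) (Z q)
  - ip g1 q (Y q) (nabla0 X Z q).

Lemma nabla_metric_sym X Y Z q : nabla_metric X Y Z q = nabla_metric X Z Y q.
Proof.
rewrite /nabla_metric (_ : ipf g1 Y Z = ipf g1 Z Y).
  by rewrite addrAC (ipC rg q (Y q)) (ipC rg q _ (Z q)).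
by apply/funext => r; rewrite /ipf ipC.
Qed.

Lemma nabla_metric_addl U X X' Y Z q : open U -> vf_smooth_on U X ->
  vf_smooth_on U X' -> vf_smooth_on U Y -> vf_smooth_on U Z -> U q ->
  nabla_metric (fun r => X r + X' r) Y Z q = nabla_metric X Y Z q + nabla_metric X' Y Z q.
Proof.
move=> oU sX sX' sY sZ Uq; rewrite /nabla_metric ddirD.
rewrite (lc_addl lc oU sX sX' sY Uq) (lc_addl lc oU sX sX' sZ Uq).
by rewrite ipDl ipDr; ring.
Qed.

Lemma nabla_metric_scalel U f X Y Z q : open U -> smooth_on U f ->
  vf_smooth_on U X -> vf_smooth_on U Y -> vf_smooth_on U Z -> U q ->
  nabla_metric (fun r => f r *: X r) Y Z q = f q * nabla_metric X Y Z q.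
Proof.
move=> oU sf sX sY sZ Uq; rewrite /nabla_metric ddirZ.
rewrite (lc_scalel lc oU sX sY sf Uq) (lc_scalel lc oU sX sZ sf Uq).
by rewrite ipZl ipZr /GRing.scale /=; ring.
Qed.

Lemma nabla_metric_addr U X Y Z Z' q : open U -> vf_smooth_on U X ->
  vf_smooth_on U Y -> vf_smooth_on U Z -> vf_smooth_on U Z' -> U q ->
  nabla_metric X Y (fun r => Z r + Z' r) q = nabla_metric X Y Z q + nabla_metric X Y Z' q.
Proof.
move=> oU sX sY sZ sZ' Uq; rewrite /nabla_metric.
rewrite (_ : ipf g1 Y _ = fun r => ipf g1 Y Z r + ipf g1 Y Z' r); last first.
  by apply/funext => r; rewrite /ipf ipDr.
rewrite (ddir_add _ (ip_smooth rg oU sY sZ) (ip_smooth rg oU sY sZ') Uq).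
rewrite (lc_addr lc oU sX sZ sZ' Uq) !ipDr.
move: (ddir _ _ _) (ddir _ _ _) (ip _ _ _ (Z q)) (ip _ _ _ (Z' q)) => a b c d.
by move: (ip _ _ _ _) (ip _ _ _ _) => e f; ring.
Qed.

Lemma nabla_metric_scaler U f X Y Z q : open U -> smooth_on U f ->
  vf_smooth_on U X -> vf_smooth_on U Y -> vf_smooth_on U Z -> U q ->
  nabla_metric X Y (fun r => f r *: Z r) q = f q * nabla_metric X Y Z q.
Proof.
move=> oU sf sX sY sZ Uq; rewrite /nabla_metric.
rewrite (_ : ipf g1 Y _ = fun r => f r * ipf g1 Y Z r); last first.
  by apply/funext => r; rewrite /ipf ipZr.
rewrite (ddir_mul _ sf (ip_smooth rg oU sY sZ) Uq).
rewrite (lc_leibniz lc oU sX sZ sf Uq) ipDr !ipZr /ipf.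
move: (ddir _ _ _) (ddir _ _ _) (ip _ _ _ (Z q)) (ip _ _ _ (Z q)) => a b c d.
by move: (ip _ _ _ _) (f q) => e k; ring.
Qed.

Lemma nabla_metric_locall U X X' Y Z q : open U -> vf_smooth_on U X' ->
  vf_smooth_on U Y -> vf_smooth_on U Z -> (forall r, U r -> X r = X' r) -> U q ->
  nabla_metric X Y Z q = nabla_metric X' Y Z q.
Proof.
move=> oU sX' sY sZ XX' Uq; rewrite /nabla_metric XX' //.
by rewrite (lc_locall lc oU sX' sY XX' Uq) (lc_locall lc oU sX' sZ XX' Uq).
Qed.

Lemma nabla_metric_localr U X Y Z Z' q : open U -> vf_smooth_on U X ->
  vf_smooth_on U Y -> vf_smooth_on U Z' -> (forall r, U r -> Z r = Z' r) -> U q ->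
  nabla_metric X Y Z q = nabla_metric X Y Z' q.
Proof.
move=> oU sX sY sZ' ZZ' Uq; rewrite /nabla_metric.
rewrite (ddir_near_eq (X q) (ip_smooth rg oU sY sZ') Uq); last first.
  by apply: filterS (near_open oU Uq) => r Ur; rewrite /ipf ZZ'.
by rewrite (lc_localr lc oU sX sZ' ZZ' Uq) ZZ'.
Qed.

Lemma nabla_metric_smooth U X Y Z : open U -> vf_smooth_on U X ->
  vf_smooth_on U Y -> vf_smooth_on U Z -> smooth_on U (nabla_metric X Y Z).
Proof.
move=> oU sX sY sZ; apply: smooth_onB => //; first apply: smooth_onB => //.
- by apply: smooth_ddir => //; exact: ip_smooth.
- by apply: ip_smooth => //; exact: lc_smooth lc _ _ _ _ _ _.
- by apply: ip_smooth => //; exact: lc_smooth lc _ _ _ _ _ _.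
Qed.

Definition koszul_defect X Y Z q : R :=
  nabla_metric X Y Z q + nabla_metric Y X Z q - nabla_metric Z X Y q.

Lemma koszul_defect_sym X Y Z q : koszul_defect X Y Z q = koszul_defect Y X Z q.
Proof. by rewrite /koszul_defect (nabla_metric_sym Z) [in X in X - _]addrC. Qed.

Lemma koszul_defect_addl U X X' Y Z q : open U -> vf_smooth_on U X ->
  vf_smooth_on U X' -> vf_smooth_on U Y -> vf_smooth_on U Z -> U q ->
  koszul_defect (fun r => X r + X' r) Y Z q = koszul_defect X Y Z q + koszul_defect X' Y Z q.
Proof.
move=> oU sX sX' sY sZ Uq; rewrite /koszul_defect.
rewrite (nabla_metric_addl oU sX sX' sY sZ Uq).
rewrite (nabla_metric_sym Y) (nabla_metric_addr oU sY sZ sX sX' Uq).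
rewrite (nabla_metric_sym Z) (nabla_metric_addr oU sZ sY sX sX' Uq).
rewrite !(nabla_metric_sym Y Z) !(nabla_metric_sym Z Y); ring.
Qed.

Lemma koszul_defect_scalel U f X Y Z q : open U -> smooth_on U f ->
  vf_smooth_on U X -> vf_smooth_on U Y -> vf_smooth_on U Z -> U q ->
  koszul_defect (fun r => f r *: X r) Y Z q = f q * koszul_defect X Y Z q.
Proof.
move=> oU sf sX sY sZ Uq; rewrite /koszul_defect.
rewrite (nabla_metric_scalel oU sf sX sY sZ Uq).
rewrite (nabla_metric_sym Y) (nabla_metric_scaler oU sf sY sZ sX Uq).
rewrite (nabla_metric_sym Z) (nabla_metric_scaler oU sf sZ sY sX Uq).
rewrite !(nabla_metric_sym Y Z) !(nabla_metric_sym Z Y); ring.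
Qed.

Lemma koszul_defect_addr U X Y Z Z' q : open U -> vf_smooth_on U X ->
  vf_smooth_on U Y -> vf_smooth_on U Z -> vf_smooth_on U Z' -> U q ->
  koszul_defect X Y (fun r => Z r + Z' r) q = koszul_defect X Y Z q + koszul_defect X Y Z' q.
Proof.
move=> oU sX sY sZ sZ' Uq; rewrite /koszul_defect.
rewrite (nabla_metric_addr oU sX sY sZ sZ' Uq) (nabla_metric_addr oU sY sX sZ sZ' Uq).
rewrite (nabla_metric_addl oU sZ sZ' sX sY Uq); ring.
Qed.

Lemma koszul_defect_scaler U f X Y Z q : open U -> smooth_on U f ->
  vf_smooth_on U X -> vf_smooth_on U Y -> vf_smooth_on U Z -> U q ->
  koszul_defect X Y (fun r => f r *: Z r) q = f q * koszul_defect X Y Z q.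
Proof.
move=> oU sf sX sY sZ Uq; rewrite /koszul_defect.
rewrite (nabla_metric_scaler oU sf sX sY sZ Uq) (nabla_metric_scaler oU sf sY sX sZ Uq).
rewrite (nabla_metric_scalel oU sf sZ sX sY Uq); ring.
Qed.

Lemma koszul_defect_sumr U (I : Type) (s : seq I) (c : I -> M -> R)
    (Z : I -> vfield M R m) X Y q : open U -> vf_smooth_on U X ->
  vf_smooth_on U Y -> (forall i, smooth_on U (c i)) ->
  (forall i, vf_smooth_on U (Z i)) -> U q ->
  koszul_defect X Y (fun r => \sum_(i <- s) c i r *: Z i r) q =
  \sum_(i <- s) c i q * koszul_defect X Y (Z i) q.
Proof.
move=> oU sX sY sc sZ Uq; elim: s => [|i s IH].
  rewrite big_nil (_ : (fun r => _) = fun r => (0 : R) *: (0 : 'rV[R]_m)).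
    rewrite (koszul_defect_scaler oU (smooth_on_cst U 0) sX sY (vf_smooth0 U) Uq).
    by rewrite mul0r.
  by apply/funext => r; rewrite big_nil scaler0.
rewrite big_cons (_ : (fun r => _) = fun r => c i r *: Z i r + \sum_(i <- s) c i r *: Z i r).
  have s1 := vf_smoothZ oU (sc i) (sZ i).
  have s2 : vf_smooth_on U (fun r => \sum_(i <- s) c i r *: Z i r).
    by apply: vf_smooth_sum => // j _; exact: vf_smoothZ.
  rewrite (koszul_defect_addr oU sX sY s1 s2 Uq) IH.
  by rewrite (koszul_defect_scaler oU (sc i) sX sY (sZ i) Uq).
by apply/funext => r; rewrite big_cons.
Qed.

Lemma koszul_defect_localr U X Y Z Z' q : open U -> vf_smooth_on U X ->
  vf_smooth_on U Y -> vf_smooth_on U Z' -> (forall r, U r -> Z r = Z' r) -> U q ->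
  koszul_defect X Y Z q = koszul_defect X Y Z' q.
Proof.
move=> oU sX sY sZ' ZZ' Uq; rewrite /koszul_defect.
rewrite (nabla_metric_localr oU sX sY sZ' ZZ' Uq) (nabla_metric_localr oU sY sX sZ' ZZ' Uq).
by rewrite (nabla_metric_locall oU sZ' sX sY ZZ' Uq).
Qed.

Definition lc_tensor X Y : vfield M R m := fun q =>
  2^-1 *: ((\row_j koszul_defect X Y (cfield q (delta_mx 0 j)) q) *m invmx (g1 q)).

(** [lc_tensor] is defined at [q] by the coordinate fields of the chart of [q] only. Near [q] the
    field [Z] is a combination of them with smooth coefficients, and [koszul_defect] is linear over
    functions in its third argument. *)
Lemma lc_tensorP U X Y Z q : open U -> vf_smooth_on U X -> vf_smooth_on U Y ->
  vf_smooth_on U Z -> U q ->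
  ip g1 q (lc_tensor X Y q) (Z q) = 2^-1 * koszul_defect X Y Z q.
Proof.
move=> oU sX sY sZ Uq; rewrite ipZl; congr (_ * _).
pose U' := U `&` cd q.
have oU' : open U' by apply: openI => //; exact: cd_open.
have U'q : U' q by split=> //; exact: cd_id.
have UU' : U' `<=` U by move=> r [].
have Ucd : U' `<=` cd q by move=> r [].
have sX' := vf_smooth_subset UU' sX; have sY' := vf_smooth_subset UU' sY.
have sZ' := vf_smooth_subset UU' sZ.
have sc j : smooth_on U' (fun r => comps (chart_at q) Z r 0 j).
  by apply: smooth_on_coord => //; exact: vf_smooth_comps.
have sE j := vf_smooth_subset Ucd (cfield_smooth q (delta_mx 0 j)).
rewrite (@koszul_defect_localr U' X Y Z (fun r => \sum_j comps (chart_at q) Z r 0 j *: cfield q (delta_mx 0 j) r)) //.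
- rewrite (koszul_defect_sumr _ oU' sX' sY' sc sE U'q).
  rewrite /ip mulmxKV; last by apply: posdef_unitmx => u; exact: ip_gt0.
  rewrite mxE; apply: eq_bigr => j _; rewrite !mxE mulrC.
  by rewrite /comps ddir_self.
- by apply: vf_smooth_sum => // j _; exact: vf_smoothZ.
- by move=> r [_ qr]; exact: vf_expand.
Qed.

Lemma lc_tensorPw U X Y q w : open U -> vf_smooth_on U X -> vf_smooth_on U Y -> U q ->
  ip g1 q (lc_tensor X Y q) w = 2^-1 * koszul_defect X Y (cfield q w) q.
Proof.
move=> oU sX sY Uq.
have UU' : U `&` cd q `<=` U by move=> r [].
have Ucd : U `&` cd q `<=` cd q by move=> r [].
rewrite -{1}(cfield_self q w); apply: (@lc_tensorP (U `&` cd q)).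
- by apply: openI => //; exact: cd_open.
- exact: vf_smooth_subset sX.
- exact: vf_smooth_subset sY.
- exact: vf_smooth_subset (cfield_smooth q w).
- by split=> //; exact: cd_id.
Qed.

Lemma lc_tensor_smooth U X Y : open U -> vf_smooth_on U X -> vf_smooth_on U Y ->
  vf_smooth_on U (lc_tensor X Y).
Proof.
move=> oU sX sY; apply: (vf_smooth_raise rg) => // a w.
have o : open (U `&` cd a) by apply: openI => //; exact: cd_open.
have UU' : U `&` cd a `<=` U by move=> r [].
have Ucd : U `&` cd a `<=` cd a by move=> r [].
have sX' := vf_smooth_subset UU' sX; have sY' := vf_smooth_subset UU' sY.
have sw := vf_smooth_subset Ucd (cfield_smooth a w).
apply: (@smooth_on_eq _ _ _ _ _ (fun r => 2^-1 * koszul_defect X Y (cfield a w) r)) => //.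
  by move=> r Ur; rewrite (lc_tensorP o sX' sY' sw Ur).
apply: smooth_onM => //; first exact: smooth_on_cst.
apply: smooth_onB => //; first apply: smooth_onD => //; exact: nabla_metric_smooth.
Qed.

(** The added tensor is symmetric, so the torsion does not change. The two Koszul defects of X, Y, Z
    and of X, Z, Y add up to 2 (nabla0_X g1)(Y, Z), which is twice what compatibility of [nabla0]
    with [g1] lacks. *)
Theorem levi_civita_change : exists nabla, is_levi_civita g1 nabla.
Proof.
exists (fun X Y q => nabla0 X Y q + lc_tensor X Y q) => U oU X Y Z sX sY sZ f sf.
split; first by apply: vf_smoothD => //; [exact: (lc_smooth lc)|exact: lc_tensor_smooth].
have tadd q A B C : U q -> vf_smooth_on U A -> vf_smooth_on U B -> vf_smooth_on U C ->
    lc_tensor (fun r => A r + B r) C q = lc_tensor A C q + lc_tensor B C q.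
  move=> {X Y Z sX sY sZ} Uq sX sY sZ; apply: (ip_inj rg (q := q)) => w.
  have sXY := vf_smoothD oU sX sY.
  have o : open (U `&` cd q) by apply: openI => //; exact: cd_open.
  have sw := vf_smooth_subset (@subIsetr _ U (cd q)) (cfield_smooth q w).
  rewrite ipDl (lc_tensorPw w oU sXY sZ Uq) (lc_tensorPw w oU sX sZ Uq) (lc_tensorPw w oU sY sZ Uq).
  rewrite -mulrDr; congr (_ * _); apply: (koszul_defect_addl o) => //.
  - exact: vf_smooth_subset sX.
  - exact: vf_smooth_subset sY.
  - exact: vf_smooth_subset sZ.
  - by split=> //; exact: cd_id.
have tscale q (k : M -> R) A B : U q -> smooth_on U k -> vf_smooth_on U A -> vf_smooth_on U B ->
    lc_tensor (fun r => k r *: A r) B q = k q *: lc_tensor A B q.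
  move=> {X Y Z f sX sY sZ sf} Uq sf sX sY; apply: (ip_inj rg (q := q)) => w.
  have sXY := vf_smoothZ oU sf sX.
  have o : open (U `&` cd q) by apply: openI => //; exact: cd_open.
  have sw := vf_smooth_subset (@subIsetr _ U (cd q)) (cfield_smooth q w).
  rewrite ipZl (lc_tensorPw w oU sXY sY Uq) (lc_tensorPw w oU sX sY Uq) mulrCA.
  congr (_ * _); apply: (koszul_defect_scalel o) => //.
  - exact: smooth_on_subset sf.
  - exact: vf_smooth_subset sX.
  - exact: vf_smooth_subset sY.
  - by split=> //; exact: cd_id.
have tsym A B : lc_tensor A B = lc_tensor B A.
  apply/funext => q; congr (_ *: (_ *m _)); apply/rowP => j.
  by rewrite !mxE koszul_defect_sym.
move=> q Uq; split.
- split.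
    change (nabla0 (fun r => X r + Y r) Z q + lc_tensor (fun r => X r + Y r) Z q =
      nabla0 X Z q + lc_tensor X Z q + (nabla0 Y Z q + lc_tensor Y Z q)).
    rewrite (lc_addl lc oU sX sY sZ Uq) (tadd q X Y Z Uq) //.
    by rewrite addrACA.
  by rewrite (lc_scalel lc oU sX sY sf Uq) (tscale q f X Y Uq) // scalerDr.
- change (nabla0 X (fun r => Y r + Z r) q + lc_tensor X (fun r => Y r + Z r) q =
    nabla0 X Y q + lc_tensor X Y q + (nabla0 X Z q + lc_tensor X Z q)).
  rewrite (lc_addr lc oU sX sY sZ Uq).
  by rewrite (tsym X) (tadd q Y Z X Uq) // !(tsym _ X) addrACA.
- rewrite (lc_leibniz lc oU sX sY sf Uq) (tsym X) (tscale q f Y X Uq) // (tsym Y X).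
  by rewrite scalerDr addrA.
- by rewrite (tsym X Y) opprD addrACA subrr addr0; exact: (lc_torsion lc oU).
- rewrite ipDl ipDr (lc_tensorP oU sX sY sZ Uq) (ipC rg q (Y q) (lc_tensor _ _ _)).
  rewrite (lc_tensorP oU sX sZ sY Uq) /koszul_defect (nabla_metric_sym X Z Y).
  have -> : ddir (ipf g1 Y Z) q (X q) = nabla_metric X Y Z q
      + ip g1 q (Y q) (nabla0 X Z q) + ip g1 q (nabla0 X Y q) (Z q).
    by rewrite /nabla_metric !subrK.
  move: (nabla_metric X Y Z q) (nabla_metric Y X Z q) (nabla_metric Z X Y q) => n1 n2 n3.
  by move: (ip _ _ _ _) (ip _ _ _ _) => e1 e2; field.
Qed.

End LeviCivitaExistence.

(** * Lie brackets and submersions *)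

Section BracketDerivation.
Context {R : realType} {m : nat} {M : manifold R m}.
Implicit Types (a q r : M) (U : set M) (X Y Z : vfield M R m).

Local Notation cd a := (cdom (chart_at a)).
Local Notation cm a := (cmap (chart_at a)).
Local Notation ci a := (cinv (chart_at a)).

Lemma ddir_bigsum (I : Type) (s : seq I) (h : I -> M -> R) U q v :
  open U -> (forall i, smooth_on U (h i)) -> U q ->
  ddir (fun r => \sum_(i <- s) h i r) q v = \sum_(i <- s) ddir (h i) q v.
Proof.
move=> oU sh Uq; elim: s => [|i s IH].
  rewrite big_nil (_ : (fun r => _) = fun=> 0 : R); first exact: ddir_cst.
  by apply/funext => r; rewrite big_nil.
rewrite big_cons -IH -(ddir_add v (sh i) (smooth_on_sum _ oU (fun i _ => sh i)) Uq).
by congr (ddir _ _ _); apply/funext => r; rewrite big_cons.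
Qed.

Lemma ddir_expand (F : M -> R) U q v : smooth_on U F -> U q ->
  ddir F q v = \sum_j v 0 j * 'd (F \o ci q) (cm q q) (delta_mx 0 j).
Proof.
move=> sF Uq; rewrite (ddir_chart v sF (cd_id q) Uq) ddir_self.
exact: diff_row_sum.
Qed.

(** In the chart of [q] the second derivatives of [F] enter both terms symmetrically and cancel by
    Schwarz's theorem. Every verticality statement about brackets is derived from this identity,
    applied to coordinates of the submersion. *)
Lemma lie_bracket_fun (F : M -> R) U X Y q : open U -> smooth_on U F ->
  vf_smooth_on U X -> vf_smooth_on U Y -> U q ->
  ddir F q (lie_bracket X Y q) =
  ddir (fun r => ddir F r (Y r)) q (X q) - ddir (fun r => ddir F r (X r)) q (Y q).
Proof.
move=> oU sF sX sY Uq.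
pose V := U `&` cd q.
have oV : open V by apply: openI => //; exact: cd_open.
have Vq : V q by split=> //; exact: cd_id.
have VU : V `<=` U by move=> r [].
have Vc : V `<=` cd q by move=> r [].
have sFV := smooth_on_subset VU sF.
pose P j r := 'd (F \o ci q) (cm q r) (delta_mx 0 j).
have sP j : smooth_on V (P j) by exact: smooth_partial.
have dP j v : ddir (P j) q v = 'd (fun y => 'd (F \o ci q) y (delta_mx 0 j)) (cm q q) v.
  have := ddir_chart v (sP j) (cd_id q) Vq; rewrite ddir_self => ->.
  have sPc := Csmooth_deriv (delta_mx 0 j) (sF q).
  have dg := Csmooth_diff sPc (cm_img (cd_id q) Uq).
  have o : \forall y \near cm q q, (cm q @` (cd q `&` V)) y.
    by apply: open_nbhs_nbhs; split; [exact: img_open|exact: (cm_img (cd_id q))].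
  have ne : \forall y \near cm q q, 'd (F \o ci q) y (delta_mx 0 j) = (P j \o ci q) y.
    by apply: filterS o => y /in_img[_ _ yE]; rewrite /P /= yE.
  by have [_ e] := diff_near_eq ne dg; exact: (e v).
have sc Z j : vf_smooth_on U Z -> smooth_on V (fun r => comps (chart_at q) Z r 0 j).
  move=> sZ; apply: smooth_on_coord => //; apply: vf_smooth_comps => //.
  exact: vf_smooth_subset sZ.
have key Z W : vf_smooth_on U Z -> ddir (fun r => ddir F r (Z r)) q W =
    \sum_j (Z q 0 j * ddir (P j) q W + P j q * ddir (comps (chart_at q) Z) q W 0 j).
  move=> sZ.
  have sZV : smooth_on V (comps (chart_at q) Z).
    by apply: vf_smooth_comps => //; exact: vf_smooth_subset sZ.
  transitivity (ddir (fun r => \sum_j comps (chart_at q) Z r 0 j * P j r) q W).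
    apply: (@ddir_near_eq _ _ _ _ V) => //.
      by apply: smooth_on_sum => // j _; apply: smooth_onM => //; exact: sc.
    apply: filterS (near_open oV Vq) => r [Ur qr].
    by rewrite (ddir_chart _ sF qr Ur); exact: esym (diff_row_sum _ _ _).
  rewrite (@ddir_bigsum _ _ (fun j r => comps (chart_at q) Z r 0 j * P j r) V) //.
    apply: eq_bigr => j _; rewrite (ddir_mul W (sc Z j sZ) (sP j) Vq).
    by rewrite (ddir_coord W j sZV Vq) /comps ddir_self.
  by move=> j; apply: smooth_onM => //; exact: sc.
rewrite (key Y (X q) sY) (key X (Y q) sX) (ddir_expand _ sF Uq) -sumrB.
have schwarz i j : ddir (P j) q (delta_mx 0 i) = ddir (P i) q (delta_mx 0 j).
  rewrite !dP; apply: second_diff_sym.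
  - have o : \forall y \near cm q q, (cm q @` (cd q `&` U)) y.
      by apply: open_nbhs_nbhs; split; [exact: img_open|exact: (cm_img (cd_id q))].
    by apply: filterS o => y; apply: Csmooth_diff; exact: sF.
  - exact: Csmooth_diff (Csmooth_deriv _ (sF q)) (cm_img (cd_id q) Uq).
  - exact: Csmooth_diff (Csmooth_deriv _ (sF q)) (cm_img (cd_id q) Uq).
have dPsum j v : ddir (P j) q v = \sum_i v 0 i * ddir (P j) q (delta_mx 0 i).
  by rewrite {1}(row_sum_delta v) ddir_sum; apply: eq_bigr => i _; rewrite ddirZ.
transitivity (\sum_j (P j q * ddir (comps (chart_at q) Y) q (X q) 0 j
     - P j q * ddir (comps (chart_at q) X) q (Y q) 0 j)).
  apply: eq_bigr => j _; rewrite /lie_bracket !mxE mulrC mulrBr; exact: erefl.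
have -> : \sum_j (Y q 0 j * ddir (P j) q (X q) + P j q * ddir (comps (chart_at q) Y) q (X q) 0 j
   - (X q 0 j * ddir (P j) q (Y q) + P j q * ddir (comps (chart_at q) X) q (Y q) 0 j)) =
  \sum_j (P j q * ddir (comps (chart_at q) Y) q (X q) 0 j
     - P j q * ddir (comps (chart_at q) X) q (Y q) 0 j)
  + (\sum_j Y q 0 j * ddir (P j) q (X q) - \sum_j X q 0 j * ddir (P j) q (Y q)).
  rewrite -sumrB -big_split /=; apply: eq_bigr => j _.
  move: (Y q 0 j) (X q 0 j) (ddir (P j) q (X q)) (ddir (P j) q (Y q)) (P j q) => a1 a2 a3 a4 a5.
  by move: (ddir (comps _ _) _ _ _ _) (ddir (comps _ _) _ _ _ _) => a6 a7; ring.
rewrite [X in _ + X](_ : _ = 0) ?addr0 //; apply/eqP; rewrite subr_eq0; apply/eqP.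
under eq_bigr do rewrite dPsum mulr_sumr.
under [RHS]eq_bigr do rewrite dPsum mulr_sumr.
rewrite exchange_big /=; apply: eq_bigr => i _; apply: eq_bigr => j _.
by rewrite schwarz mulrCA.
Qed.

Lemma lie_bracket_anti X Y q : lie_bracket X Y q = - lie_bracket Y X q.
Proof. by rewrite /lie_bracket opprB. Qed.

Lemma lie_bracket_addl U X X' Y q : open U -> vf_smooth_on U X -> vf_smooth_on U X' -> U q ->
  lie_bracket (fun r => X r + X' r) Y q = lie_bracket X Y q + lie_bracket X' Y q.
Proof.
move=> oU sX sX' Uq; rewrite /lie_bracket ddirD.
rewrite (_ : comps _ (fun r => X r + X' r) =
    fun r => comps (chart_at q) X r + comps (chart_at q) X' r); last first.
  by apply/funext => r; rewrite /comps ddirD.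
have Vq : (U `&` cd q) q by split=> //; exact: cd_id.
by rewrite (ddir_add (Y q) (sX q) (sX' q) Vq) opprD addrACA.
Qed.

Lemma lie_bracket_scalel U (k : M -> R) X Y q : open U -> smooth_on U k ->
  vf_smooth_on U X -> U q ->
  lie_bracket (fun r => k r *: X r) Y q = k q *: lie_bracket X Y q - ddir k q (Y q) *: X q.
Proof.
move=> oU sk sX Uq; rewrite /lie_bracket ddirZ scalerBr -addrA -opprD; congr (_ - _).
have Vq : (U `&` cd q) q by split=> //; exact: cd_id.
have oV : open (U `&` cd q) by apply: openI => //; exact: cd_open.
have skV := smooth_on_subset (@subIsetl _ U (cd q)) sk.
have skX : smooth_on (U `&` cd q) (comps (chart_at q) (fun r => k r *: X r)).
  exact: (vf_smoothZ oU sk sX).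
apply/rowP => j; rewrite [RHS]mxE [X in _ = X + _]mxE [X in _ = _ + X]mxE.
apply: etrans (ddir_coord (Y q) j skX Vq) _.
have -> : (fun r => comps (chart_at q) (fun r => k r *: X r) r 0 j) =
    fun r => k r * comps (chart_at q) X r 0 j.
  by apply/funext => r; rewrite /comps ddirZ mxE.
apply: etrans (ddir_mul (Y q) skV (smooth_on_coord j oV (sX q)) Vq) _.
have e1 := ddir_coord (Y q) j (sX q) Vq.
by rewrite -e1 /comps ddir_self [X in _ + X]mulrC.
Qed.

Lemma lie_bracket_locall U X X' Y q : open U -> vf_smooth_on U X' ->
  (forall r, U r -> X r = X' r) -> U q -> lie_bracket X Y q = lie_bracket X' Y q.
Proof.
move=> oU sX' XX' Uq.
have Vq : (U `&` cd q) q by split=> //; exact: cd_id.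
have e : ddir (comps (chart_at q) X) q (Y q) = ddir (comps (chart_at q) X') q (Y q).
  apply: (ddir_near_eq (Y q) (sX' q) Vq).
  by apply: filterS (near_open oU Uq) => r Ur; rewrite /comps XX'.
by rewrite /lie_bracket e (XX' q Uq).
Qed.

End BracketDerivation.

(** * Linear algebra of horizontal lifts *)

Section LiftMatrix.
Context {R : realType} {m p : nat} (G : 'M[R]_m) (D : 'M[R]_(m, p)).
Hypotheses (Gsym : G^T = G) (Gpos : forall u : 'rV_m, u != 0 -> 0 < (u *m G *m u^T) 0 0)
  (Drank : \rank D = p).

(** The rows of D^T G^-1 span the G-orthogonal complement of the kernel of [D]; the first factor
    normalises them to a right inverse of [D] acting on row vectors. An explicit formula makes the
    smooth dependence on [G] and [D] visible. *)
Definition lift_mx : 'M[R]_(p, m) := invmx (D^T *m invmx G *m D) *m D^T *m invmx G.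

Let Gu : G \in unitmx := posdef_unitmx Gpos.

Lemma lift_mx_unit : D^T *m invmx G *m D \in unitmx.
Proof.
apply: posdef_unitmx => y y0.
have w0 : y *m D^T != 0.
  apply: contra_neq y0 => h; have rf : row_free D^T by rewrite /row_free mxrank_tr Drank.
  by apply: (row_free_inj rf); rewrite h mul0mx.
set z := y *m D^T *m invmx G.
have zG : z *m G = y *m D^T by rewrite /z mulmxKV.
have -> : y *m (D^T *m invmx G *m D) *m y^T = z *m G *m z^T.
  by rewrite zG /z !trmx_mul trmxK trmx_inv Gsym !mulmxA.
by apply: Gpos; apply: contra_neq w0 => z0; rewrite -zG z0 mul0mx.
Qed.

Lemma lift_mxK : lift_mx *m D = 1%:M.
Proof. by rewrite /lift_mx -!mulmxA mulVmx //= mulmxA lift_mx_unit. Qed.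

Lemma lift_mx_orth (v : 'rV[R]_m) : v *m D = 0 -> lift_mx *m G *m v^T = 0.
Proof.
move=> vD; rewrite /lift_mx mulmxKV //.
have e : D^T *m v^T = 0 by rewrite -trmx_mul vD trmx0.
by rewrite -[LHS]mulmxA e mulmx0.
Qed.

End LiftMatrix.

(** * Vertical vectors and brackets for a smooth map *)

Section SubmersionCalculus.
Context {R : realType} {m p : nat} {M : manifold R m} {N : manifold R p}.
Implicit Types (a q r : M) (b : N) (U : set M) (X Y Z : vfield M R m) (u v : 'rV[R]_m).
Context (f : M -> N) (sf : smooth_map f).

Local Notation cd a := (cdom (chart_at a)).
Local Notation cm a := (cmap (chart_at a)).
Local Notation ci a := (cinv (chart_at a)).
Local Notation Phi b := (cmap (chart_at b) \o f).

Lemma f_open (W : set N) : open W -> open (f @^-1` W).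
Proof. by move=> oW; have [cf _] := sf; move/continuousP : cf; exact. Qed.

Lemma fcd_open b : open (f @^-1` cd b).
Proof. by apply: f_open; exact: cd_open. Qed.

Lemma Phi_smooth b : smooth_on (f @^-1` cd b) (Phi b).
Proof. by have [_] := sf. Qed.

Lemma smooth_pullback (W : set N) (h : N -> R) : open W -> smooth_on W h ->
  smooth_on (f @^-1` W) (h \o f).
Proof.
move=> oW sh; apply: smooth_on_local => q Wq; pose b := f q.
have oV : open (f @^-1` (cd b `&` W)).
  by apply: f_open; apply: openI => //; exact: cd_open.
exists (f @^-1` (cd b `&` W)); first by split=> //; exact: cd_id.
apply: (@smooth_on_eq _ _ _ _ _ (fun r => (h \o ci b) (Phi b r))) => //.
  by move=> r [br _] /=; rewrite ciK.
apply: (smooth_on_comp (B := cm b @` (cd b `&` W))) => //.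
- by move=> r [br Wr]; exact: cm_img.
- by apply: smooth_on_subset (Phi_smooth b) => r [].
Qed.

Lemma ddir_pullback (V : normedModType R) (W : set N) (h : N -> V) q v :
  smooth_on W h -> open W -> W (f q) ->
  ddir (h \o f) q v = ddir h (f q) (v *m dmap f q).
Proof.
move=> sh oW Wq; rewrite /dmap mul_rV_lin1.
have e : (Phi (f q) \o ci q) (cm q q) = cm (f q) (f q).
  by rewrite /= ciK //; exact: cd_id.
have dt := smooth_diff (Phi_smooth (f q)) (cd_id q) (cd_id (f q)).
have dh := smooth_diff sh (cd_id (f q)) Wq.
have ne : \forall y \near cm q q, (h \o ci (f q)) ((Phi (f q) \o ci q) y) = ((h \o f) \o ci q) y.
  have : \forall r \near q, (h \o ci (f q)) (Phi (f q) r) = (h \o f) r.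
    have := near_open (fcd_open (f q)) (cd_id (f q)); apply: filterS => r br.
    by rewrite /= ciK.
  exact: near_img (cd_id q).
exact: (diff_chain v e dt dh ne).
Qed.

Lemma ddir_Phi b q v : cd b (f q) ->
  ddir (Phi b) q v = ddir (cm b) (f q) (v *m dmap f q).
Proof. by move=> bq; apply: ddir_pullback (smooth_on_cm b) (cd_open b) bq. Qed.

Lemma dmap_cfield b q v : cd b (f q) ->
  v *m dmap f q = cfield b (ddir (Phi b) q v) (f q).
Proof. by move=> bq; rewrite ddir_Phi // cfieldE. Qed.

Lemma verticalE b q v : cd b (f q) -> vertical f q v <-> ddir (Phi b) q v = 0.
Proof.
move=> bq; rewrite ddir_Phi //; split=> [->|h]; first exact: ddir0.
by apply: (ddir_chart_inj bq); rewrite h ddir0.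
Qed.

Lemma vertical_pullback (W : set N) (h : N -> R) q v :
  smooth_on W h -> open W -> W (f q) -> vertical f q v -> ddir (h \o f) q v = 0.
Proof. by move=> sh oW Wq vv; rewrite (ddir_pullback v sh oW Wq) vv ddir0. Qed.

Lemma vertical0 q : vertical f q 0. Proof. exact: mul0mx. Qed.

Lemma verticalD q u v : vertical f q u -> vertical f q v -> vertical f q (u + v).
Proof. by rewrite /vertical mulmxDl => -> ->; rewrite addr0. Qed.

Lemma verticalZ q c v : vertical f q v -> vertical f q (c *: v).
Proof. by rewrite /vertical -scalemxAl => ->; rewrite scaler0. Qed.

Lemma verticalB q u v : vertical f q u -> vertical f q v -> vertical f q (u - v).
Proof. by rewrite /vertical mulmxBl => -> ->; rewrite subr0. Qed.

Lemma vertical_sum q (I : Type) (s : seq I) (P : pred I) (F : I -> 'rV[R]_m) :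
  (forall i, P i -> vertical f q (F i)) -> vertical f q (\sum_(i <- s | P i) F i).
Proof.
by move=> h; elim/big_ind: _ => //; [exact: vertical0|move=> *; exact: verticalD].
Qed.

(** Verticality is tested on the coordinates of [f] in the chart of [f q], where the bracket acts as
    a commutator. *)
Lemma bracket_vertical_eq U X Y q : open U -> vf_smooth_on U X -> vf_smooth_on U Y -> U q ->
  (forall j, ddir (fun r => ddir (fun s => Phi (f q) s 0 j) r (Y r)) q (X q) =
             ddir (fun r => ddir (fun s => Phi (f q) s 0 j) r (X r)) q (Y q)) ->
  vertical f q (lie_bracket X Y q).
Proof.
move=> oU sX sY Uq h; have bq := cd_id (f q); apply/(verticalE _ bq).
pose V := U `&` f @^-1` cd (f q).
have oV : open V by apply: openI => //; exact: fcd_open.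
have Vq : V q by split.
have sP := smooth_on_subset (@subIsetr _ U _) (Phi_smooth (f q)).
have sXV := vf_smooth_subset (@subIsetl _ U (f @^-1` cd (f q))) sX.
have sYV := vf_smooth_subset (@subIsetl _ U (f @^-1` cd (f q))) sY.
apply/rowP => j; rewrite mxE; apply: etrans (ddir_coord _ j sP Vq) _.
apply: etrans (lie_bracket_fun oV (smooth_on_coord j oV sP) sXV sYV Vq) _.
by rewrite h subrr.
Qed.

Lemma vertical_Phi_near U X q j : open U -> vertical_on f U X -> U q ->
  forall r, (U `&` f @^-1` cd (f q)) r -> ddir (fun s => Phi (f q) s 0 j) r (X r) = 0.
Proof.
move=> oU [sX vX] Uq r [Ur br].
have e := ddir_coord (X r) j (Phi_smooth (f q)) br.
have h : ddir (Phi (f q)) r (X r) = 0 by apply/(verticalE (X r) br); exact: vX.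
by rewrite -e h mxE.
Qed.

Lemma vertical_Phi_ddir U X q j w : open U -> vertical_on f U X -> U q ->
  ddir (fun r => ddir (fun s => Phi (f q) s 0 j) r (X r)) q w = 0.
Proof.
move=> oU vX Uq; pose V := U `&` f @^-1` cd (f q).
have oV : open V by apply: openI => //; exact: fcd_open.
apply: (@ddir_const_near _ _ _ _ V _ _ _ 0) => //; first by split=> //; exact: cd_id.
exact: vertical_Phi_near.
Qed.

Lemma bracket_vertical U X Y q : open U -> vertical_on f U X -> vertical_on f U Y -> U q ->
  vertical f q (lie_bracket X Y q).
Proof.
move=> oU vX vY Uq; apply: (bracket_vertical_eq oU) => //; [by case: vX|by case: vY|].
by move=> j; rewrite !(vertical_Phi_ddir j _ oU).
Qed.

(* [Z] projects to the field on N whose components in the chart at [f q] are [w]. *)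
Lemma bracket_vertical_proj U X Z (W : set N) (w : N -> 'rV[R]_p) q : open U ->
  vf_smooth_on U Z -> vertical_on f U X -> U q ->
  open W -> W (f q) -> smooth_on W w ->
  (forall r, U r -> W (f r) -> cd (f q) (f r) -> ddir (Phi (f q)) r (Z r) = w (f r)) ->
  vertical f q (lie_bracket Z X q).
Proof.
move=> oU sZ vX Uq oW Wq sw hw; apply: (bracket_vertical_eq oU) => //; first by case: vX.
move=> j; rewrite (vertical_Phi_ddir j _ oU) //.
have sfw := smooth_on_coord j oW sw.
have [_ /(_ q Uq) vXq] := vX.
rewrite -(vertical_pullback sfw oW Wq vXq).
pose V := U `&` f @^-1` (W `&` cd (f q)).
have oV : open V.
  by apply: openI => //; apply: f_open; apply: openI => //; exact: cd_open.
have Vq : V q by split=> //; split=> //; exact: cd_id.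
have sV : smooth_on V ((fun x => w x 0 j) \o f).
  by apply: smooth_on_subset (smooth_pullback oW sfw) => r [_ []].
apply: esym; apply: (ddir_near_eq (X q) sV Vq).
apply: filterS (near_open oV Vq) => r [Ur [Wr br]] /=.
by rewrite -(hw r Ur Wr br) -(ddir_coord _ j (Phi_smooth (f q)) br).
Qed.

End SubmersionCalculus.

(** * Horizontal lifts and the splitting of the tangent space *)

Section Lifts.
Context {R : realType} {m p : nat} {M : manifold R m} {N : manifold R p}.
Implicit Types (a q r : M) (b : N) (U : set M) (X Y Z : vfield M R m) (u v : 'rV[R]_m).
Context (f : M -> N) (sf : smooth_map f) (rk : forall q, \rank (dmap f q) = p).
Context (g : M -> 'M[R]_m) (rg : riemannian g).

Local Notation cd a := (cdom (chart_at a)).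
Local Notation cm a := (cmap (chart_at a)).
Local Notation ci a := (cinv (chart_at a)).
Local Notation Phi b := (cmap (chart_at b) \o f).

Definition hlift q : 'M[R]_(p, m) := lift_mx (g q) (dmap f q).

Lemma g_sym q : (g q)^T = g q. Proof. by have [] := rg. Qed.

Lemma hliftK q : hlift q *m dmap f q = 1%:M.
Proof. by apply: lift_mxK; [exact: g_sym|exact: ip_gt0|exact: rk]. Qed.

Lemma hliftKr q (y : 'rV[R]_p) : y *m hlift q *m dmap f q = y.
Proof. by rewrite -mulmxA hliftK mulmx1. Qed.

Lemma hlift_horizontal q (y : 'rV[R]_p) : horizontal f g q (y *m hlift q).
Proof.
move=> v vv; rewrite /ip -2!mulmxA (mulmxA (hlift q)) lift_mx_orth ?mulmx0 ?mxE //.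
exact: ip_gt0.
Qed.

Lemma horizontalB q u v : horizontal f g q u -> horizontal f g q v -> horizontal f g q (u - v).
Proof. by move=> hu hv w vw; rewrite ipBl hu // hv // subr0. Qed.

Lemma horizontalZ q c u : horizontal f g q u -> horizontal f g q (c *: u).
Proof. by move=> hu w vw; rewrite ipZl hu // mulr0. Qed.

Lemma horizontal_sum q (I : Type) (s : seq I) (F : I -> 'rV[R]_m) :
  (forall i, horizontal f g q (F i)) -> horizontal f g q (\sum_(i <- s) F i).
Proof. by move=> h w vw; rewrite ip_suml big1 // => i _; exact: h. Qed.

Lemma horizontal_inj q u v : horizontal f g q u -> horizontal f g q v ->
  u *m dmap f q = v *m dmap f q -> u = v.
Proof.
move=> hu hv e; apply: subr0_eq; apply: (ip_eq0 rg (q := q)).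
by apply: horizontalB => //; rewrite /vertical mulmxBl e subrr.
Qed.

Lemma horizontal_ext q u v : horizontal f g q u -> horizontal f g q v ->
  (forall w, horizontal f g q w -> ip g q u w = ip g q v w) -> u = v.
Proof.
move=> hu hv h; apply: subr0_eq; apply: (ip_eq0 rg (q := q)).
by rewrite ipBl h ?subrr //; exact: horizontalB.
Qed.

Definition vpart q u := u - u *m dmap f q *m hlift q.

Lemma vpart_vertical q u : vertical f q (vpart q u).
Proof. by rewrite /vertical mulmxBl hliftKr subrr. Qed.

Lemma vpart_id q u : vertical f q u -> vpart q u = u.
Proof. by move=> vu; rewrite /vpart vu mul0mx subr0. Qed.

Lemma ip_split q u v : ip g q u v =
  ip g q (u *m dmap f q *m hlift q) (v *m dmap f q *m hlift q) + ip g q (vpart q u) (vpart q v).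
Proof.
set hu := u *m _ *m _; set hv := v *m _ *m _.
have e1 : ip g q hu (vpart q v) = 0 by exact: hlift_horizontal (vpart_vertical q v).
have e2 : ip g q (vpart q u) hv = 0.
  by rewrite (ipC rg); exact: hlift_horizontal (vpart_vertical q u).
have eu : u = hu + vpart q u by rewrite subrKC.
have ev : v = hv + vpart q v by rewrite subrKC.
rewrite {1}eu {1}ev; move: (vpart q u) (vpart q v) e1 e2 => a b e1 e2.
by rewrite ipDl !ipDr e1 e2 addr0 add0r.
Qed.

(** [proj_mx] decomposes a vector only if it lies in the sum of the two row spaces. The lift of the
    projection of [u] and the remainder [vpart q u] exhibit [u] in that sum. *)
Lemma hproj_split q u :
  [/\ horizontal f g q (hproj f g q u) & vertical f q (u - hproj f g q u)].
Proof.
have HV : (u <= Hmx f g q + Vmx f q)%MS.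
  have eu : u = u *m dmap f q *m hlift q + vpart q u by rewrite subrKC.
  rewrite [X in (X <= _)%MS]eu; apply: addmx_sub_adds.
    rewrite sub_kermx; apply/eqP/rowP => i.
    have vi : vertical f q (row i (Vmx f q)) by rewrite /vertical -row_mul mulmx_ker row0.
    have := hlift_horizontal (u *m dmap f q) vi.
    by rewrite /ip tr_row colE mulmxA -colE mxE -[in X in X -> _]mulmxA [X in _ -> _ = X]mxE.
  by rewrite sub_kermx; apply/eqP; exact: vpart_vertical.
split.
  have : (hproj f g q u <= Hmx f g q)%MS by exact: proj_mx_sub.
  rewrite sub_kermx => /eqP h v vv.
  have : (v <= Vmx f q)%MS by rewrite sub_kermx; apply/eqP.
  move=> /submxP[c ->]; rewrite /ip trmx_mul.
  have -> : hproj f g q u *m g q *m ((Vmx f q)^T *m c^T) =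
      hproj f g q u *m (g q *m (Vmx f q)^T) *m c^T by rewrite !mulmxA.
  by rewrite h mul0mx mxE.
apply/eqP; rewrite -sub_kermx; exact: proj_mx_compl_sub.
Qed.

Lemma hproj_ip q u w : horizontal f g q w -> ip g q (hproj f g q u) w = ip g q u w.
Proof.
move=> hw; have [_ vu] := hproj_split q u.
rewrite -[in RHS](subrK (hproj f g q u) u) ipDl.
by rewrite [X in _ = X + _](ipC rg) hw // add0r.
Qed.

(* The horizontal field whose projection to N has components [w] in the chart [b]. *)
Definition hfield b (w : M -> 'rV[R]_p) : vfield M R m :=
  fun r => cfield b (w r) (f r) *m hlift r.

Lemma hfield_horizontal b w r : horizontal f g r (hfield b w r).
Proof. exact: hlift_horizontal. Qed.

Lemma hfield_Phi b w r : cd b (f r) -> ddir (Phi b) r (hfield b w r) = w r.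
Proof. by move=> br; rewrite (ddir_Phi sf) // hliftKr cfieldK. Qed.

Let Dm b a r : 'M[R]_(m, p) :=
  \matrix_(i, j) ddir (Phi b) r (cfield a (delta_mx 0 i) r) 0 j.

Let DmP b a r v : cd a r -> ddir (Phi b) r v = ddir (cm a) r v *m Dm b a r.
Proof.
move=> ar; rewrite {1}(cfield_expand v ar) ddir_sum; apply/rowP => j.
by rewrite summxE mxE; apply: eq_bigr => i _; rewrite ddirZ !mxE.
Qed.

Let Dm_rank b a r : cd a r -> cd b (f r) -> \rank (Dm b a r) = p.
Proof.
move=> ar br; apply/eqP; rewrite -/(row_full _) -sub1mx; apply/row_subP => i.
apply/submxP; exists (ddir (cm a) r (cfield b (row i 1%:M) (f r) *m hlift r)).
by rewrite -(DmP _ _ ar) (@hfield_Phi b (fun=> row i 1%:M)).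
Qed.

(** [hlift r] is written in the chart of [r], so its formula says nothing about smoothness. In the
    fixed chart of [q] the components are given by [lift_mx] of the Gram matrix and of the Jacobian
    [Dm]; the two descriptions agree because a horizontal vector is determined by its projection. *)
Lemma hfield_smooth b U w : open U -> U `<=` f @^-1` cd b -> smooth_on U w ->
  vf_smooth_on U (hfield b w).
Proof.
move=> oU Ub sw; apply: vf_smooth_local => q Uq.
have o : open (U `&` cd q) by apply: openI => //; exact: cd_open.
have sub : U `&` cd q `<=` cd q by move=> r [].
have subU : U `&` cd q `<=` U by move=> r [].
exists (U `&` cd q); first by split=> //; exact: cd_id.
apply: (vf_smooth_chart o sub).
pose c r : 'rV[R]_m := w r *m lift_mx (gram g q r) (Dm b q r).
apply: (@smooth_on_eq _ _ _ _ _ c) => //.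
  move=> r [Ur qr]; have br := Ub _ Ur.
  have gp u : u != 0 -> 0 < (u *m gram g q r *m u^T) 0 0 by exact: gram_pos.
  have gs := gram_sym rg q r.
  rewrite /comps -[LHS](cfieldK (c r) qr); congr (ddir _ _ _).
  apply: (horizontal_inj (q := r)).
  - move=> v vv; rewrite (gramP _ _ _ qr) cfieldK // -2!mulmxA (mulmxA (lift_mx _ _)).
    rewrite lift_mx_orth ?mulmx0 ?mxE //.
    by rewrite -(DmP b v qr); apply/(verticalE sf v br).
  - exact: hfield_horizontal.
  - rewrite !(dmap_cfield sf _ br); congr (cfield _ _ _).
    by rewrite hfield_Phi // (DmP b _ qr) cfieldK // -mulmxA lift_mxK ?mulmx1 // Dm_rank.
apply: smooth_on_rV => // j.
have sD : msmooth (U `&` cd q) (Dm b q).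
  move=> i k; apply: (@smooth_on_eq _ _ _ _ _
    (fun r => ddir (Phi b) r (cfield q (delta_mx 0 i) r) 0 k)) => //.
    by move=> r _; rewrite mxE.
  apply: smooth_on_coord => //; apply: smooth_ddir_rV => //.
    by apply: smooth_on_subset (Phi_smooth sf b) => r [/Ub].
  exact: vf_smooth_subset (cfield_smooth q _).
have sG := gram_smooth rg o sub.
have sGi : msmooth (U `&` cd q) (fun r => invmx (gram g q r)).
  by apply: msmooth_inv => // r [_ qr]; exact: gram_unit.
have sDt := msmooth_tr o sD.
apply: (@msmooth_mul _ _ _ 1 p m) => //.
  move=> i k; apply: smooth_on_subset subU _.
  apply: (@smooth_on_eq _ _ _ _ _ (fun r => w r 0 k)) => //; last exact: smooth_on_coord.
  by move=> r _; rewrite (ord1 i).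
have sDG := msmooth_mul o sDt sGi.
apply: msmooth_mul => //; apply: msmooth_mul => //.
apply: msmooth_inv => //; last exact: msmooth_mul.
move=> r [Ur qr]; apply: lift_mx_unit; last by rewrite Dm_rank //; exact: Ub.
- exact: gram_sym.
- by move=> u; exact: gram_pos.
Qed.

Lemma hpart_smooth U X : open U -> vf_smooth_on U X ->
  vf_smooth_on U (fun r => X r *m dmap f r *m hlift r).
Proof.
move=> oU sX; apply: vf_smooth_local => q Uq; pose b := f q.
have ob := fcd_open sf b.
have o : open (U `&` f @^-1` cd b) by exact: openI.
exists (U `&` f @^-1` cd b); first by split=> //; exact: cd_id.
apply: (@vf_smooth_eq _ _ _ _ (hfield b (fun r => ddir (Phi b) r (X r)))) => //.
  by move=> r [Ur br]; rewrite /hfield -(dmap_cfield sf _ br).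
apply: hfield_smooth => //.
apply: smooth_ddir_rV => //; first exact: smooth_on_subset (Phi_smooth sf b).
exact: vf_smooth_subset sX.
Qed.

Lemma vpart_smooth U X : open U -> vf_smooth_on U X ->
  vertical_on f U (fun r => vpart r (X r)).
Proof.
move=> oU sX; split; last by move=> r _; exact: vpart_vertical.
by apply: vf_smoothB => //; exact: hpart_smooth.
Qed.

End Lifts.

(** * Umbilical fibers *)

Section VerticalFrames.
Context {R : realType} {m p : nat} {M : manifold R m} {N : manifold R p}.
Implicit Types (a q r : M) (b : N) (U : set M) (X Y Z : vfield M R m) (u v : 'rV[R]_m).
Context (f : M -> N) (sf : smooth_map f) (rk : forall q, \rank (dmap f q) = p).
Context (g : M -> 'M[R]_m) (rg : riemannian g).

Local Notation cd a := (cdom (chart_at a)).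

Lemma vertical_on_subset (A B : set M) X : A `<=` B -> vertical_on f B X -> vertical_on f A X.
Proof.
by move=> AB [sX vX]; split=> [|q /AB]; [exact: vf_smooth_subset sX|exact: vX].
Qed.

Lemma positive_open U (h : M -> R) : open U -> smooth_on U h ->
  open (U `&` [set r | 0 < h r]).
Proof.
move=> oU sh; rewrite openE => r [Ur /= hr].
have n1 : \forall s \near r, 0 < h s.
  have c := smooth_cont oU sh Ur.
  by have /c : nbhs (h r) [set x | 0 < x] by exact: lt_nbhsr.
by rewrite /interior; apply: filterS2 n1 (near_open oU Ur).
Qed.

Definition orthonormal_on U k (E : 'I_k -> vfield M R m) :=
  (forall i, vertical_on f U (E i)) /\
  forall r i j, U r -> ip g r (E i r) (E j r) = (i == j)%:R.

(** One Gram-Schmidt step. A new vertical direction at [q] is extended by the vertical part of a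
    coordinate field, its components along [E] are subtracted, and the result is normalised on the
    open set where its square length is positive. *)
Lemma vframe_step q k U (E : 'I_k -> vfield M R m) : (k < m - p)%N -> open U -> U q ->
  orthonormal_on U E -> exists (U' : set M) (E' : 'I_k.+1 -> vfield M R m),
  [/\ open U', U' q & orthonormal_on U' E'].
Proof.
move=> km oU Uq [vE oE].
pose Em := \matrix_i E i q.
(* The kernel consists of the vertical vectors orthogonal to all [E i q]; it is nonzero since [A]
   has p + k < m columns. *)
pose A := row_mx (dmap f q) (g q *m Em^T).
have [v v0 vA] : exists2 v : 'rV[R]_m, v != 0 & v *m A = 0.
  have : kermx A != 0.
    rewrite -mxrank_eq0 mxrank_ker -lt0n subn_gt0.
    by apply: leq_ltn_trans (rank_leq_col _) _; rewrite -ltn_subRL.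
  by move=> /rowV0Pn[v /sub_kermxP vA v0]; exists v.
move: vA; rewrite mul_mx_row => /eqP; rewrite row_mx_eq0 => /andP[/eqP vv /eqP vE0].
have vEi i : ip g q v (E i q) = 0.
  have h : v *m g q *m Em^T = 0 by rewrite -mulmxA.
  rewrite /ip -[E i q](rowK (fun i => E i q)) tr_row colE mulmxA h mul0mx.
  by rewrite mxE.
pose V := U `&` cd q.
have oV : open V by apply: openI => //; exact: cd_open.
have Vq : V q by split=> //; exact: cd_id.
have vEV i := vertical_on_subset (@subIsetl _ U (cd q)) (vE i).
pose T r := vpart f g r (cfield q v r).
have vT : vertical_on f V T.
  by apply: vpart_smooth => //; exact: vf_smooth_subset (@subIsetr _ U _) (cfield_smooth q v).
pose W r := T r - \sum_i ip g r (T r) (E i r) *: E i r.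
have vW : vertical_on f V W.
  split.
    apply: vf_smoothB => //; first by case: vT.
    apply: vf_smooth_sum => // i _; apply: vf_smoothZ => //; last by case: (vEV i).
    by apply: ip_smooth => //; [case: vT|case: (vEV i)].
  move=> r Vr; have [_ /(_ r Vr) vTr] := vT.
  apply: (verticalB vTr); apply: vertical_sum => i _; apply: verticalZ.
  by have [_ /(_ r Vr)] := vEV i.
have Wq : W q = v.
  rewrite /W /T cfield_self vpart_id // big1 ?subr0 // => i _.
  by rewrite vEi scale0r.
have WE r i : V r -> ip g r (W r) (E i r) = 0.
  move=> [Ur _]; rewrite /W ipBl ip_suml (bigD1 i) //= ipZl oE // eqxx mulr1.
  rewrite big1 ?addr0 ?subrr // => j ji.
  by rewrite ipZl oE // (negbTE ji) mulr0.
pose nW := ipf g W W.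
have sW : smooth_on V nW by apply: ip_smooth => //; case: vW.
pose V' := V `&` [set r | 0 < nW r].
have oV' : open V' by exact: positive_open.
have V'q : V' q by split=> //; rewrite /= /nW /ipf Wq; exact: ip_gt0.
have V'V : V' `<=` V by move=> r [].
pose E0 r := isqrt (nW r) *: W r.
have vE0' : vertical_on f V' E0.
  split.
    apply: vf_smoothZ => //.
      apply: (smooth_on_comp1 (B := [set x | 0 < x])) => //.
      - by move=> r [].
      - exact: smooth_on_subset sW.
      - by move=> n; exact: Ck_isqrt.
    by apply: vf_smooth_subset V'V _; case: vW.
  move=> r /V'V Vr; have [_ /(_ r Vr) vWr] := vW; exact: (verticalZ _ vWr).
exists V', (fun i => if unlift ord_max i is Some j then E j else E0).
split; [exact: oV'|exact: V'q|split=> [i|r i j V'r]].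
  case: unliftP => [j _|_]; last exact: vE0'.
  by apply: vertical_on_subset (vE j) => r [[]].
have Vr := V'V _ V'r; have [Ur _] := Vr.
case: unliftP => [i' ->|->]; case: unliftP => [j' ->|->].
- by rewrite oE // (inj_eq lift_inj).
- by rewrite ipZr (ipC rg) WE // mulr0 lift_eqF.
- by rewrite ipZl WE // mulr0 eq_liftF.
- rewrite ipZl ipZr mulrA eqxx; apply: isqrtP.
  by case: V'r.
Qed.

Lemma orthonormal_span U (E : 'I_(m - p) -> vfield M R m) r v : orthonormal_on U E ->
  U r -> vertical f r v -> exists k : 'I_(m - p) -> R, v = \sum_i k i *: E i r.
Proof.
move=> [vE oE] Ur vv; pose Em := \matrix_i E i r.
have EmV : (Em <= Vmx f r)%MS.
  apply/row_subP => i; rewrite rowK sub_kermx; apply/eqP.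
  by have [_] := vE i; exact.
have EgE : Em *m g r *m Em^T = 1%:M.
  apply/matrixP => i j; rewrite [RHS]mxE -(oE r i j Ur).
  transitivity ((row i Em *m g r *m (row j Em)^T) 0 0); last by rewrite !rowK.
  by rewrite -row_mul tr_row colE mulmxA -colE [RHS]mxE -row_mul [RHS]mxE.
have Efree : \rank Em = (m - p)%N.
  apply/eqP; rewrite eqn_leq rank_leq_row /=.
  rewrite -{1}(mxrank1 R (m - p)) -EgE -mulmxA; exact: mxrankM_maxl.
have VE : (Vmx f r <= Em)%MS.
  have [_ e] := mxrank_leqif_sup EmV.
  by rewrite -e Efree mxrank_ker rk.
have : (v <= Em)%MS by apply: submx_trans VE; rewrite sub_kermx; apply/eqP.
move=> /submxP[c ->]; exists (fun i => c 0 i).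
by rewrite mulmx_sum_row; apply: eq_bigr => i _; rewrite rowK.
Qed.

(** [umbilical_fibers] expresses the mean curvature by an orthonormal frame, so the hypothesis says
    something at [q] only once a frame around [q] exists. *)
Lemma local_vframe q : exists (U : set M) (E : 'I_(m - p) -> vfield M R m),
  [/\ open U, U q & orthonormal_vframe f g U E].
Proof.
have : forall k, (k <= m - p)%N -> exists (U : set M) (E : 'I_k -> vfield M R m),
    [/\ open U, U q & orthonormal_on U E].
  elim=> [|k IH] kp.
    by exists setT, (fun=> fun=> 0); split; [exact: openT| |split=> [[]|? []]].
  by have [U [E [oU Uq oE]]] := IH (ltnW kp); exact: vframe_step oE.
move=> /(_ (m - p)%N (leqnn _))[U [E [oU Uq oE]]]; exists U, E; split=> //.
have [vE E1] := oE; split=> // r v Ur vv; exact: orthonormal_span oE Ur vv.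
Qed.

End VerticalFrames.

Section Umbilicity.
Context {R : realType} {m p : nat} {M : manifold R m} {N : manifold R p}.
Implicit Types (a q r : M) (b : N) (U : set M) (X Y Z : vfield M R m) (u v : 'rV[R]_m).
Context (f : M -> N) (sf : smooth_map f) (rk : forall q, \rank (dmap f q) = p).
Context (g : M -> 'M[R]_m) (rg : riemannian g).

(** Conformality on vertical vectors at one point, for a field [Z] that may be horizontal or
    vertical. The number [lam] belongs to [q] alone, with no regularity in [q]. *)
Definition conformal_at Z q (lam : R) : Prop :=
  forall U X Y, open U -> U q -> vertical_on f U X -> vertical_on f U Y ->
  lie_metric g Z X Y q = lam * ip g q (X q) (Y q).

(** Without torsion, (L_Z g)(X, Y) = g(nabla_X Z, Y) + g(X, nabla_Y Z). As Z is orthogonal to X and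
    Y, this is -g(Z, nabla_X Y) - g(Z, nabla_Y X), and both terms agree because [X, Y] is
    vertical. *)
Lemma lie_metric_horizontal nabla U X Y Z q : is_levi_civita g nabla ->
  open U -> U q -> vertical_on f U X -> vertical_on f U Y -> vf_smooth_on U Z ->
  (forall r, U r -> horizontal f g r (Z r)) ->
  lie_metric g Z X Y q = - 2 * ip g q (nabla X Y q) (Z q).
Proof.
move=> lc oU Uq vX vY sZ hZ; have [sX wX] := vX; have [sY wY] := vY.
have e1 := lc_metric lc oU sZ sX sY Uq.
have e2 := lc_torsion lc oU sZ sX Uq.
have e3 := lc_torsion lc oU sZ sY Uq.
have e4 := lc_metric lc oU sX sZ sY Uq.
have e5 := lc_metric lc oU sY sX sZ Uq.
have e6 := lc_torsion lc oU sX sY Uq.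
have z1 : ddir (ipf g Z Y) q (X q) = 0.
  by apply: (ddir_const_near _ Uq oU (c := 0)) => r Ur; exact: (hZ r Ur _ (wY r Ur)).
have z2 : ddir (ipf g X Z) q (Y q) = 0.
  apply: (ddir_const_near _ Uq oU (c := 0)) => r Ur.
  by rewrite /ipf (ipC rg); exact: (hZ r Ur _ (wX r Ur)).
have z3 : ip g q (lie_bracket X Y q) (Z q) = 0.
  rewrite (ipC rg); apply: hZ => //.
  exact: (bracket_vertical sf oU vX vY Uq).
rewrite /lie_metric e1 -e2 -e3 ipBl ipBr.
move: z1 z2 z3; rewrite e4 e5 -e6 ipBl.
rewrite (ipC rg q (Z q) (nabla X Y q)).
move: (ip _ _ (nabla Z X q) _) (ip _ _ (nabla X Z q) _) (ip _ _ (X q) (nabla Z Y q)) => a b c.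
move: (ip _ _ (nabla X Y q) _) (ip _ _ (nabla Y X q) _) (ip _ _ (X q) (nabla Y Z q)) => d e k.
by move=> h1 h2 h3; lra.
Qed.

Lemma umbilical_conformal U Z q : umbilical_fibers f g -> open U -> U q ->
  vf_smooth_on U Z -> (forall r, U r -> horizontal f g r (Z r)) ->
  exists lam, conformal_at Z q lam.
Proof.
move=> [nabla [lc um]] oU Uq sZ hZ.
have [V [E [oV Vq fE]]] := local_vframe sf rk rg q.
(* Minus twice the product of [Z q] with the mean curvature divided by n, where n = m - p. *)
exists (- 2 * ((m - p)%:R^-1 * ip g q (mean_curvature f g nabla E q) (Z q))) => U' X Y oU' U'q vX vY.
pose W := U `&` V `&` U'.
have oW : open W by do !apply: openI.
have Wq : W q by [].
have WU : W `<=` U by move=> r [[]].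
have WV : W `<=` V by move=> r [[]].
have WU' : W `<=` U' by move=> r [].
have vX' := vertical_on_subset WU' vX; have vY' := vertical_on_subset WU' vY.
rewrite (lie_metric_horizontal lc oW Wq vX' vY' (vf_smooth_subset WU sZ)); last first.
  by move=> r /WU; exact: hZ.
have fEW : orthonormal_vframe f g W E.
  have [h1 h2 h3] := fE; split.
  - by move=> i; exact: vertical_on_subset (h1 i).
  - by move=> r i j /WV; exact: h2.
  - by move=> r v /WV; exact: h3.
have := um W _ E oW fEW X Y vX' vY' q Wq.
move=> /(congr1 (fun u => ip g q u (Z q))).
rewrite ipZl /second_form (hproj_ip rk rg) => [->|]; last exact: hZ.
by rewrite -!mulrA; congr (_ * (_ * _)); rewrite mulrC.
Qed.

(** Paired with a horizontal vector [w], the second fundamental form is -(lam / 2) g by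
    [lie_metric_horizontal]; its trace is -(lam / 2) n, so the multiple is the one demanded by
    umbilicity. *)
Lemma conformal_umbilical nabla : is_levi_civita g nabla ->
  (forall q u, horizontal f g q u -> exists (U : set M) Z lam,
     [/\ open U /\ U q, vf_smooth_on U Z,
         forall r, U r -> horizontal f g r (Z r),
         Z q = u & conformal_at Z q lam]) ->
  umbilical_fibers f g.
Proof.
move=> lc h; exists nabla; split=> // U n E oU [vE oE sE] X Y vX vY q Uq.
have hh u : horizontal f g q (hproj f g q u) by have [] := hproj_split rk rg q u.
apply: (horizontal_ext rg (f := f) (q := q)); first exact: hh.
  by apply: horizontalZ; apply: horizontal_sum => i; exact: hh.
move=> w hw; have [V [Z [lam [[oV Vq] sZ hZ Zq cZ]]]] := h q w hw.
have key A B : vertical_on f U A -> vertical_on f U B ->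
    ip g q (second_form f g nabla A B q) w = - (lam / 2) * ip g q (A q) (B q).
  move=> vA vB.
  have -> : ip g q (second_form f g nabla A B q) w = ip g q (nabla A B q) w.
    exact: (hproj_ip rk rg).
  have oW : open (U `&` V) by exact: openI.
  have Wq : (U `&` V) q by [].
  have := cZ U A B oU Uq vA vB.
  rewrite (lie_metric_horizontal lc oW Wq (vertical_on_subset (@subIsetl _ U V) vA)
    (vertical_on_subset (@subIsetl _ U V) vB) (vf_smooth_subset (@subIsetr _ U V) sZ)); last first.
    by move=> r [_]; exact: hZ.
  by rewrite Zq => e; lra.
rewrite key // ipZl /mean_curvature ip_suml.
rewrite (eq_bigr (fun=> - (lam / 2))); last first.
  by move=> i _; rewrite key // oE // eqxx mulr1.
(* For n = 0 the empty frame spans the vertical space, so [X q] = 0 and both sides vanish; otherwise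
   [n%:R^-1] cancels the n equal terms of the trace. *)
rewrite sumr_const card_ord; case: n E vE oE sE => [|n] E vE oE sE.
  have [c Xq] := sE q (X q) Uq (proj2 vX q Uq).
  by rewrite Xq big_ord0 ip0l !(mulr0, mul0r).
rewrite -[- (lam / 2) *+ _]mulr_natr.
have k0 : n.+1%:R != 0 :> R by rewrite pnatr_eq0.
by move: (n.+1%:R : R) k0 => k k0; field.
Qed.

End Umbilicity.

(** * Bump functions *)

Section Bumps.
Context {R : realType} {p : nat} {N : manifold R p}.
Implicit Types (x b : N).

Local Notation cd a := (cdom (chart_at a)).
Local Notation cm a := (cmap (chart_at a)).
Local Notation ci a := (cinv (chart_at a)).

Lemma flat_gt0 k (s : R) : 0 < s -> 0 < flat k s.
Proof. by move=> s0; rewrite /flat s0 mulr_gt0 ?expR_gt0 // invr_gt0 exprn_gt0. Qed.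

(** The support lies in the image [K] of a compact ball of the chart. [K] is closed since N is
    Hausdorff, so the chart domain and the complement of [K] form an open cover, on each member of
    which extension by zero is smooth. [K] is part of the conclusion so that local functions and
    fields can be cut off in the same way. *)
Lemma bump x : exists (rho : N -> R) (K : set N),
  [/\ smooth_on setT rho, 0 < rho x, closed K, K `<=` cd x &
      forall y, ~ K y -> rho y = 0].
Proof.
pose y0 := cm x x.
have [r0 r00 h0] : exists2 r0 : R, 0 < r0 & forall h, `|h| < r0 -> (cm x @` cd x) (y0 + h).
  apply: (@nbhs_radius _ _ y0 (cm x @` cd x)).
  apply: open_nbhs_nbhs; split; first by have [] := chart_atP x.
  by exists x => //; exact: cd_id.
pose r := r0 / 2.
have r_gt0 : 0 < r by rewrite divr_gt0.
have rr0 : r < r0 by rewrite /r ltr_pdivrMr // mulr_natr mulr2n ltrDl.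
pose B := [set y : 'rV[R]_p | `|y - y0| <= r].
have Bimg y : B y -> (cm x @` cd x) y.
  by move=> hy; rewrite -(subrKC y0 y); apply: h0; exact: le_lt_trans rr0.
have cB : compact B.
  apply: bounded_closed_compact.
    exists (r + `|y0|); split; first exact: num_real.
    move=> t tr y /= hy; rewrite -(subrK y0 y); apply: le_trans (ler_normD _ _) _.
    by apply: le_trans (ltW tr); rewrite lerD2r.
  have -> : B = (fun y => `|y - y0|) @^-1` [set t : R | t <= r] by [].
  apply: closed_comp; last exact: closed_le.
  move=> y _; have c : y' - y0 @[y' --> y] --> y - y0.
    exact: (cvgB cvg_id (cvg_cst y0)).
  exact: (cvg_norm c).
pose K := ci x @` B.
have KP y : cd x y -> B (cm x y) -> K y by move=> xy By; exists (cm x y) => //; exact: ciK.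
have cK : closed K.
  apply: compact_closed; first exact: manifold_hausdorff.
  apply: continuous_compact => //; apply: continuous_in_subspaceT => y; rewrite inE => By.
  exact: ci_cont (Bimg y By).
(* [B] is a cube, the norm being the sup norm; hence a product of one-variable bumps. *)
pose psi (y : 'rV[R]_p) := \prod_j flat 0 (r ^+ 2 - (y 0 j - y0 0 j) ^+ 2).
have sc j : smooth_on (cd x) (fun y => cm x y 0 j).
  by apply: smooth_on_coord; [exact: cd_open|exact: smooth_on_cm].
have psiB y : ~ B y -> psi y = 0.
  move=> nB; have [h|/existsNP[j hj]] := pselect (forall j, `|(y - y0) 0 j| <= r).
    by case: nB; apply: norm_rV_le => //; exact: ltW.
  have {}hj : r < `|y 0 j - y0 0 j| by move/negP : hj; rewrite -ltNge !mxE.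
  rewrite /psi (bigD1 j) //= /flat ifF ?mul0r //.
  apply/negbTE; rewrite -leNgt subr_le0 -[leRHS]real_normK ?num_real //.
  by rewrite ler_sqr ?nnegrE //; exact: ltW.
exists (fun y => if `[< cd x y >] then psi (cm x y) else 0), K; split=> //.
- apply: smooth_on_local => y _; have [xy|nxy] := pselect (cd x y).
    exists (cd x) => //; apply: (@smooth_on_eq _ _ _ _ _ (fun y => psi (cm x y))).
    + exact: cd_open.
    + by move=> z xz; rewrite asboolT.
    apply: smooth_on_prod => [|j _]; first exact: cd_open.
    apply: (smooth_on_comp1 (B := setT)) => //; first exact: cd_open.
      apply: smooth_onB; [exact: cd_open|exact: smooth_on_cst|].
      by apply: smooth_onM; first exact: cd_open; apply: smooth_onB => //;
        first [exact: cd_open|exact: smooth_on_cst].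
    by move=> n; exact: Ck_flat.
  exists (~` K).
    move=> Ky; apply: nxy; case: Ky => z Bz <-.
    by have [w xw <-] := Bimg z Bz; rewrite ciK.
  apply: (@smooth_on_eq _ _ _ _ _ (fun=> 0 : R)); last exact: smooth_on_cst.
    by rewrite openC.
  move=> z nKz; case: asboolP => // xz; rewrite psiB // => Bz; apply: nKz; exact: KP.
- rewrite asboolT; last exact: cd_id.
  by apply: prodr_gt0 => j _; apply: flat_gt0; rewrite subrr expr0n subr0 exprn_gt0.
- move=> z [y By <-]; have [w xw <-] := Bimg y By; by rewrite ciK.
- move=> y nKy; case: asboolP => // xy; rewrite psiB // => By; apply: nKy; exact: KP.
Qed.

Lemma exists_noncritical_function x : (0 < p)%N -> exists (phi : N -> R) v,
  smooth_on setT phi /\ ddir phi x v != 0.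
Proof.
move=> p0; have [rho [K [sr rx cK Kx rK]]] := bump x.
pose j := Ordinal p0.
have sc : smooth_on (cd x) (fun y => cm x y 0 j).
  by apply: smooth_on_coord; [exact: cd_open|exact: smooth_on_cm].
have srx := smooth_on_subset (@subsetT _ (cd x)) sr.
pose h y := cm x y 0 j - cm x x 0 j.
have sh : smooth_on (cd x) h.
  by apply: smooth_onB => //; [exact: cd_open|exact: smooth_on_cst].
(* [h] is a coordinate shifted to vanish at [x], which removes the derivative of [rho] at [x] and
   leaves [rho x] times that of the coordinate. *)
exists (fun y => rho y * h y), (delta_mx 0 j); split.
  apply: smooth_on_local => y _; have [xy|nxy] := pselect (cd x y).
    by exists (cd x) => //; apply: smooth_onM => //; exact: cd_open.
  exists (~` K); first by move=> /Kx.
  apply: (@smooth_on_eq _ _ _ _ _ (fun=> 0 : R)); last exact: smooth_on_cst.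
    by rewrite openC.
  by move=> z nKz; rewrite rK // mul0r.
rewrite (ddir_mul _ srx sh (cd_id x)) /h subrr mul0r addr0 mulf_neq0 ?gt_eqF //.
have e := ddir_add (delta_mx 0 j) sc (smooth_on_cst (cd x) (- cm x x 0 j)) (cd_id x).
rewrite e ddir_cst addr0.
have e2 := ddir_coord (delta_mx 0 j) j (smooth_on_cm x) (cd_id x).
by rewrite -e2 ddir_self mxE !eqxx ltr01.
Qed.

End Bumps.

(** * From conformal Killing fields to variations *)

Section LieMetric.
Context {R : realType} {m p : nat} {M : manifold R m} {N : manifold R p}.
Implicit Types (q r : M) (b : N) (U : set M) (X Y Z : vfield M R m) (u v : 'rV[R]_m).
Context (f : M -> N).

Lemma lie_metric_addl g U Z Z' X Y q : open U -> vf_smooth_on U Z ->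
  vf_smooth_on U Z' -> U q ->
  lie_metric g (fun r => Z r + Z' r) X Y q = lie_metric g Z X Y q + lie_metric g Z' X Y q.
Proof.
move=> oU sZ sZ' Uq; rewrite /lie_metric ddirD.
rewrite (lie_bracket_addl X oU sZ sZ' Uq) (lie_bracket_addl Y oU sZ sZ' Uq) ipDl ipDr.
have alg (a1 a2 a3 a4 a5 a6 : R) :
  a1 + a2 - (a3 + a4) - (a5 + a6) = a1 - a3 - a5 + (a2 - a4 - a6) by ring.
exact: alg.
Qed.

(** The remaining terms of L_(kZ) g are dk(X) g(Z, Y) and dk(Y) g(X, Z), hence the two conditions on
    [k]. *)
Lemma lie_metric_scalel g U (k : M -> R) Z X Y q : open U -> smooth_on U k ->
  vf_smooth_on U Z -> U q -> ddir k q (X q) = 0 -> ddir k q (Y q) = 0 ->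
  lie_metric g (fun r => k r *: Z r) X Y q = k q * lie_metric g Z X Y q.
Proof.
move=> oU sk sZ Uq kX kY; rewrite /lie_metric ddirZ.
rewrite (lie_bracket_scalel X oU sk sZ Uq) (lie_bracket_scalel Y oU sk sZ Uq).
rewrite kX kY !scale0r !subr0 ipZl ipZr.
have alg (l a b c : R) : l * a - l * b - l * c = l * (a - b - c) by ring.
exact: alg.
Qed.

Lemma lie_metric_vertical g g' U Z X Y q :
  riemannian g' -> open U -> U q -> vertical_on f U X -> vertical_on f U Y ->
  (forall r u v, vertical f r u -> vertical f r v -> ip g r u v = ip g' r u v) ->
  vertical f q (lie_bracket Z X q) -> vertical f q (lie_bracket Z Y q) ->
  lie_metric g Z X Y q = lie_metric g' Z X Y q.
Proof.
move=> rg' oU Uq [sX vX] [sY vY] gg' vZX vZY.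
have e1 := gg' q _ _ vZX (vY q Uq).
have e2 := gg' q _ _ (vX q Uq) vZY.
have e3 : ddir (ipf g X Y) q (Z q) = ddir (ipf g' X Y) q (Z q).
  apply: (ddir_near_eq (Z q) (ip_smooth rg' oU sX sY) Uq).
  apply: filterS (near_open oU Uq) => r Ur.
  exact: esym (gg' r _ _ (vX r Ur) (vY r Ur)).
exact: (congr2 (fun x y => x - y) (congr2 (fun x y => x - y) e3 e1) e2).
Qed.

End LieMetric.

(** * The sheared metrics *)

Section Shear.
Context {R : realType} {m p : nat} {M : manifold R m} {N : manifold R p}.
Implicit Types (q r : M) (b : N) (U : set M) (X Y Z : vfield M R m) (u v : 'rV[R]_m) (t : R).
Context (f : M -> N) (gN : N -> 'M[R]_p) (g0 : M -> 'M[R]_m).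
Hypotheses (rg : riemannian g0) (rs : riemannian_submersion f g0 gN)
  (um : umbilical_fibers f g0).
Context (xi : vfield M R m) (phi : N -> R).
Hypotheses (vxi : vertical_on f setT xi) (sphi : smooth_on setT phi).

Let sf : smooth_map f. Proof. by have [] := rs. Qed.
Let rk q : \rank (dmap f q) = p. Proof. by have [_ + _] := rs; exact. Qed.
Let F : M -> R := phi \o f.
Let sF : smooth_on setT F.
Proof. exact: (smooth_pullback sf openT sphi). Qed.
Let vx q : vertical f q (xi q). Proof. by have [_] := vxi; exact. Qed.

Definition shear t q u : 'rV[R]_m := u - (t * ddir F q u) *: xi q.

Definition shear_mx t q : 'M[R]_m := \matrix_i shear t q (delta_mx 0 i).

(* The horizontal lift of [w] for this metric is its g0-lift plus
   [t * dphi(w) *: xi]. *)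
Definition shear_metric t q : 'M[R]_m := shear_mx t q *m g0 q *m (shear_mx t q)^T.

Lemma dF_vertical q v : vertical f q v -> ddir F q v = 0.
Proof. by move=> vv; exact: (vertical_pullback sf sphi openT Logic.I vv). Qed.

Lemma shear_mxE t q u : u *m shear_mx t q = shear t q u.
Proof.
rewrite mulmx_sum_row /shear.
transitivity (\sum_i (u 0 i *: delta_mx 0 i - (t * (u 0 i * ddir F q (delta_mx 0 i))) *: xi q)).
  by apply: eq_bigr => i _; rewrite rowK /shear scalerBr scalerA mulrCA.
rewrite sumrB -row_sum_delta; congr (_ - _).
rewrite [in RHS](row_sum_delta u) ddir_sum mulr_sumr scaler_suml.
by apply: eq_bigr => i _; rewrite ddirZ.
Qed.

Lemma shear_metricE t q u v :
  ip (shear_metric t) q u v = ip g0 q (shear t q u) (shear t q v).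
Proof. by rewrite /ip -!shear_mxE trmx_mul !mulmxA. Qed.

Lemma shear_vertical t q v : vertical f q v -> shear t q v = v.
Proof. by move=> vv; rewrite /shear dF_vertical // mulr0 scale0r subr0. Qed.

Lemma shear_dmap t q u : shear t q u *m dmap f q = u *m dmap f q.
Proof. by rewrite mulmxBl -scalemxAl (vx q) scaler0 subr0. Qed.

(** A quadratic polynomial in t whose coefficients are smooth on M: this gives smoothness of each
    metric and joint smoothness in (t, q). *)
Lemma shear_expand t q u v : ip (shear_metric t) q u v = ip g0 q u v
  - t * (ddir F q u * ip g0 q (xi q) v + ddir F q v * ip g0 q u (xi q))
  + t ^+ 2 * (ddir F q u * ddir F q v * ip g0 q (xi q) (xi q)).
Proof.
rewrite shear_metricE /shear ipBl !ipBr !ipZl !ipZr.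
by move: (ip _ _ _ _) (ip _ _ _ _) (ip _ _ _ _) (ip _ _ _ _) (ddir _ _ _) (ddir _ _ _) => a b c d e k; ring.
Qed.

Lemma shear_smooth t U X Y : open U -> vf_smooth_on U X -> vf_smooth_on U Y ->
  [/\ smooth_on U (ipf g0 X Y),
    smooth_on U (fun q => ddir F q (X q) * ip g0 q (xi q) (Y q) + ddir F q (Y q) * ip g0 q (X q) (xi q)) &
    smooth_on U (fun q => ddir F q (X q) * ddir F q (Y q) * ip g0 q (xi q) (xi q))].
Proof.
move=> oU sX sY; have [sxi _] := vxi.
have sx := vf_smooth_subset (@subsetT _ U) sxi.
have sFU := smooth_on_subset (@subsetT _ U) sF.
have dX := smooth_ddir oU sFU sX; have dY := smooth_ddir oU sFU sY.
have i1 := ip_smooth rg oU sx sY; have i2 := ip_smooth rg oU sX sx.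
have i3 := ip_smooth rg oU sx sx.
split; first exact: ip_smooth.
- by apply: smooth_onD => //; apply: smooth_onM.
- by apply: smooth_onM => //; apply: smooth_onM.
Qed.

Lemma shear_riemannian t : riemannian (shear_metric t).
Proof.
split=> [q|q u u0|U X Y oU sX sY].
- by rewrite !trmx_mul trmxK (g_sym rg) mulmxA.
- rewrite shear_metricE; apply: ip_gt0 => //; apply: contra_neq u0 => e.
  have uE : u = (t * ddir F q u) *: xi q by apply/subr0_eq.
  have d0 : ddir F q u = 0.
    by rewrite {1}uE ddirZ (dF_vertical (vx q)) scaler0.
  by rewrite uE d0 mulr0 scale0r.
- have [h1 h2 h3] := shear_smooth t oU sX sY.
  apply: (@smooth_on_eq _ _ _ _ _ (fun q => ipf g0 X Y q
    - t * (ddir F q (X q) * ip g0 q (xi q) (Y q) + ddir F q (Y q) * ip g0 q (X q) (xi q))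
    + t ^+ 2 * (ddir F q (X q) * ddir F q (Y q) * ip g0 q (xi q) (xi q)))) => //.
    by move=> q _; rewrite /ipf shear_expand.
  apply: smooth_onD => //; last by apply: smooth_onM => //; exact: smooth_on_cst.
  by apply: smooth_onB => //; apply: smooth_onM => //; exact: smooth_on_cst.
Qed.

Lemma shear_ip_vertical t q u v : vertical f q u -> vertical f q v ->
  ip (shear_metric t) q u v = ip g0 q u v.
Proof. by move=> vu vv; rewrite shear_metricE !shear_vertical. Qed.

Lemma shear_metric0 : shear_metric 0 = g0.
Proof.
apply/funext => q; rewrite /shear_metric.
have -> : shear_mx 0 q = 1%:M.
  apply/row_matrixP => i; rewrite rowK /shear mul0r scale0r subr0.
  by rewrite rowE mulmx1.
by rewrite mul1mx trmx1 mulmx1.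
Qed.

Lemma shear_horizontal t q u : horizontal f (shear_metric t) q u ->
  horizontal f g0 q (shear t q u).
Proof.
move=> hu v vv; rewrite -{1}(shear_vertical t vv) -shear_metricE; exact: hu.
Qed.

(** [shear t] maps g_t-horizontal vectors isometrically to g0-horizontal ones and preserves their
    projection to N. *)
Lemma shear_submersion t : riemannian_submersion f (shear_metric t) gN.
Proof.
split=> // q u v hu hv; rewrite shear_metricE.
have [_ _ h] := rs; rewrite h ?shear_dmap //; exact: shear_horizontal.
Qed.

Lemma shear_smooth_family eps : smooth_family eps shear_metric.
Proof.
move=> U X Y oU sX sY a; have [h1 h2 h3] := shear_smooth 0 oU sX sY.
move: h1 h2 h3; set P1 := ipf _ _ _; set P2 := (fun q => _ + _); set P3 := (fun q => _ * _ * _).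
move=> h1 h2 h3.
set I := [set s | - eps < s < eps]; set B := cmap _ @` _.
have oB : open B by exact: img_open.
have oI : open I.
  rewrite (_ : I = `]- eps, eps[%classic); first exact: itv_open.
  by apply/seteqP; split => s /=; rewrite in_itv.
have oS : open (I `*` B).
  rewrite openE => -[s y] [Is By]; exists (I, B) => //=; split; exact: open_nbhs_nbhs.
move=> k.
have c2 (P : M -> R) : smooth_on U P ->
    Ck k (I `*` B) (fun z : R * 'rV[R]_m => P (cinv (chart_at a) z.2)).
  move=> sP.
  have cs : continuous (snd : R * 'rV[R]_m -> 'rV[R]_m) by move=> z; exact: cvg_snd.
  have := Ck_comp_linear cs oB (sP a k).
  by apply: Ck_subset => z [].
have c1 : Ck k (I `*` B) (fun z : R * 'rV[R]_m => z.1).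
  by apply: (@Ck_linear _ _ _ _ _ fst) => z; exact: cvg_fst.
apply: (@Ck_eq _ _ _ _ _ (fun z : R * 'rV[R]_m => P1 (cinv (chart_at a) z.2)
   + (-1) * (z.1 * P2 (cinv (chart_at a) z.2)) + z.1 * z.1 * P3 (cinv (chart_at a) z.2))) => //.
  by move=> z _; rewrite /ipf shear_expand mulN1r expr2.
apply: Ck_D => //; last by apply: Ck_M => //; [exact: Ck_M|exact: c2].
apply: Ck_D => //; first exact: c2.
by apply: Ck_M => //; [exact: Ck_cst|apply: Ck_M => //; exact: c2].
Qed.

Hypothesis cxi : forall x : N, fiber_conformal_killing f g0 xi x.

Lemma shear_umbilical t : umbilical_fibers f (shear_metric t).
Proof.
have rgt := shear_riemannian t.
have [nabla0 [lc0 _]] := um.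
have [nabla lc] := levi_civita_change lc0 rgt.
apply: (conformal_umbilical sf rk rgt lc) => q u hu.
pose b := f q; pose U := f @^-1` cdom (chart_at b).
have oU : open U by exact: fcd_open.
have Uq : U q by exact: cd_id.
have hu0 := shear_horizontal hu.
(* [shear t q u] is g0-horizontal. The g0-lift [Z0] of the coordinate field of N with constant
   components [w] extends it, and [Z] below is the g_t-lift of the same field, extending [u]. *)
pose w := ddir (cmap (chart_at b) \o f) q (shear t q u).
pose Z0 := hfield f g0 b (fun=> w).
have sZ0 : vf_smooth_on U Z0 by apply: (hfield_smooth sf rk rg) => //; exact: smooth_on_cst.
have hZ0 r : horizontal f g0 r (Z0 r) by exact: (hfield_horizontal rg).
have Z0q : Z0 q = shear t q u.
  apply: (horizontal_inj rg (f := f)); [exact: hZ0|exact: hu0|].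
  rewrite (dmap_cfield sf (Z0 q) Uq) (dmap_cfield sf (shear t q u) Uq).
  by rewrite (hfield_Phi sf rk rg (fun=> w) Uq).
pose k r := t * ddir F r (Z0 r).
have sk : smooth_on U k.
  apply: smooth_onM => //; first exact: smooth_on_cst.
  by apply: smooth_ddir => //; exact: smooth_on_subset sF.
have sx : vf_smooth_on U xi by case: vxi => sx _; exact: vf_smooth_subset sx.
have vxU : vertical_on f U xi by split.
pose Z r := Z0 r + k r *: xi r.
have skx := vf_smoothZ oU sk sx.
have dFZ r : ddir F r (Z r) = ddir F r (Z0 r).
  by rewrite /Z ddirD ddirZ (dF_vertical (vx r)) scaler0 addr0.
have [lam0 c0] := umbilical_conformal sf rk rg um oU Uq sZ0 (fun r _ => hZ0 r).
have [lam _ cl] := cxi (f q).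
exists U, Z, (lam0 + k q * lam q); split.
- exact: (conj oU Uq).
- exact: vf_smoothD.
- move=> r Ur v vv; rewrite shear_metricE (shear_vertical t vv).
  rewrite (_ : shear t r (Z r) = Z0 r); first exact: hZ0.
  by rewrite /shear dFZ /Z addrK.
- rewrite /Z Z0q /k Z0q.
  have -> : ddir F q (shear t q u) = ddir F q u.
    by rewrite /shear ddirB ddirZ (dF_vertical (vx q)) scaler0 subr0.
  by rewrite /shear subrK.
move=> V X Y oV Vq vX vY.
pose W := U `&` V.
have oW : open W by exact: openI.
have Wq : W q by [].
have WU : W `<=` U by move=> r [].
have WV : W `<=` V by move=> r [].
have vXW := vertical_on_subset WV vX; have vYW := vertical_on_subset WV vY.
have brZ0 A : vertical_on f W A -> vertical f q (lie_bracket Z0 A q).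
  move=> vA; apply: (@bracket_vertical_proj _ _ _ _ _ _ sf W A Z0 setT (fun=> w)) => //.
  - exact: vf_smooth_subset sZ0.
  - exact: openT.
  - exact: smooth_on_cst.
  - by move=> r _ _ br; exact: (hfield_Phi sf rk rg (fun=> w) br).
(* [k] is constant along the fibers: in dF([Z0, A]) = Z0(dF(A)) - A(dF(Z0)) the left side and the
   first term on the right vanish. *)
have kA A : vertical_on f W A -> ddir k q (A q) = 0.
  move=> vA; have [sA wA] := vA.
  have sFW := smooth_on_subset (@subsetT _ W) sF.
  have e := lie_bracket_fun oW sFW (vf_smooth_subset WU sZ0) sA Wq.
  have z1 : ddir (fun r => ddir F r (A r)) q (Z0 q) = 0.
    apply: (ddir_const_near _ Wq oW (c := 0)) => r Wr; exact: dF_vertical (wA r Wr).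
  move: e; rewrite (dF_vertical (brZ0 A vA)) z1 sub0r => /esym/eqP; rewrite oppr_eq0 => /eqP e.
  have sd : smooth_on W (fun r => ddir F r (Z0 r)).
    by apply: smooth_ddir => //; exact: vf_smooth_subset sZ0.
  rewrite (ddir_mul (A q) (smooth_on_cst W t) sd Wq) e mulr0 add0r.
  by rewrite ddir_cst mulr0.
have brZ A : vertical_on f W A -> vertical f q (lie_bracket Z A q).
  move=> vA; rewrite (lie_bracket_addl A oU sZ0 skx Uq).
  rewrite (lie_bracket_scalel A oU sk sx Uq) (kA A vA) scale0r subr0.
  apply: verticalD; first exact: brZ0.
  apply: verticalZ; apply: (bracket_vertical sf oW _ vA Wq).
  exact: vertical_on_subset vxU.
have e := lie_metric_vertical rg oW Wq vXW vYW
  (fun r u v => @shear_ip_vertical t r u v) (brZ X vXW) (brZ Y vYW).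
apply: (etrans e).
rewrite (lie_metric_addl g0 X Y oU sZ0 skx Uq).
rewrite (lie_metric_scalel g0 oU sk sx Uq (kA X vXW) (kA Y vYW)).
have [_ wX] := vX; have [_ wY] := vY.
rewrite (c0 V X Y oV Vq vX vY) shear_ip_vertical; [|exact: wX|exact: wY].
rewrite (cl V X Y oV) //; last 2 first.
- by split; [case: vX|move=> r Vr _; exact: wX].
- by split; [case: vY|move=> r Vr _; exact: wY].
by move: (ip _ _ _ _) => a; ring.
Qed.

End Shear.

Section Converse.
Context {R : realType} {m p : nat} {M : manifold R m} {N : manifold R p}.
Context (f : M -> N) (gN : N -> 'M[R]_p) (g0 : M -> 'M[R]_m).

Theorem killing_variation (xi : M -> 'rV[R]_m) : (0 < p)%N ->
  riemannian g0 -> riemannian_submersion f g0 gN -> umbilical_fibers f g0 ->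
  vertical_on f setT xi -> nontrivial_vf xi ->
  (forall x : N, fiber_conformal_killing f g0 xi x) ->
  exists (eps : R) (g : R -> M -> 'M[R]_m),
    nontrivial_variation f g0 eps g /\
    forall t, - eps < t < eps ->
      riemannian_submersion f (g t) gN /\ umbilical_fibers f (g t).
Proof.
move=> p0 rg rs um vxi [q xq] cxi.
have [sf rk _] := rs; have [_ wxi] := vxi.
have [phi [v [sphi dphi]]] := exists_noncritical_function (f q) p0.
(* The shear is invertible for every t, so the choice of eps is arbitrary. *)
exists 1, (shear_metric f g0 xi phi); split; last first.
  move=> t _; split; first exact: (shear_submersion rs vxi sphi).
  exact: (shear_umbilical rg rs um vxi sphi cxi).
split.
  split=> //.
  - move=> t _; split; first exact: (shear_riemannian rg rs vxi sphi).
    by move=> r u w; exact: (shear_ip_vertical rs xi sphi).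
  - exact: (shear_smooth_family rg rs vxi sphi).
  - exact: shear_metric0.
exists (2^-1); first by apply/andP; split; lra.
(* Evaluated on the g0-lift of [v] and on [xi q], the metrics for t = 1/2 and t = 0 differ by
   dphi(v) g0(xi, xi) / 2, which is nonzero. *)
move=> /(congr1 (fun g => ip g q (v *m hlift f g0 q) (xi q))).
rewrite (shear_metricE) (shear_vertical rs xi sphi _ (wxi q Logic.I)) /shear ipBl ipZl.
rewrite (ddir_pullback sf (v *m hlift f g0 q) sphi openT Logic.I) (hliftKr rk rg).
have := ip_gt0 rg q xq; move: (ip _ _ _ _) (ip _ _ _ _) (ddir _ _ _) dphi => b a c c0 a0 e.
have : 2^-1 * c * a = 0 by rewrite -(subKr b (2^-1 * c * a)) e subrr.
by move=> /eqP; rewrite !mulf_eq0 (negbTE c0) (gt_eqF a0) orbF orbF invr_eq0 pnatr_eq0.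
Qed.

End Converse.

(** * From variations to conformal Killing fields *)

Section FiberFields.
Context {R : realType} {m p : nat} {M : manifold R m} {N : manifold R p}.
Implicit Types (q r : M) (b : N) (U : set M) (X Y Z : vfield M R m) (u v : 'rV[R]_m).
Context (f : M -> N) (sf : smooth_map f) (rk : forall q, \rank (dmap f q) = p).
Context (g : M -> 'M[R]_m) (rg : riemannian g).

Local Notation cd a := (cdom (chart_at a)).
Local Notation cm a := (cmap (chart_at a)).
Local Notation ci a := (cinv (chart_at a)).
Local Notation Phi b := (cmap (chart_at b) \o f).

(** [diff_level_set] in the chart of [q], where the fiber is a level set of the coordinates of [f].
    The horizontal lifts [B j] of the coordinate vectors at [f q] are the transverse directions on
    which the differential is the identity. *)
Lemma ddir_fiber U (c : M -> R) q v : open U -> U q -> smooth_on U c ->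
  (forall r, U r -> f r = f q -> c r = 0) -> vertical f q v -> ddir c q v = 0.
Proof.
move=> oU Uq sc c0 vv; pose b := f q.
have bq : cd b (f q) by exact: cd_id.
pose V := U `&` f @^-1` cd b.
have oV : open V by apply: openI => //; exact: fcd_open.
have Vq : V q by [].
pose B j := hfield f g b (fun=> delta_mx 0 j) q.
have oW : open (cm q @` (cd q `&` V)) by exact: img_open.
have Wq : (cm q @` (cd q `&` V)) (cm q q) by exact: (cm_img (cd_id q)).
have nW : \forall y \near cm q q, (cm q @` (cd q `&` V)) y by exact: open_nbhs_nbhs.
have sP : smooth_on V (Phi b) by apply: smooth_on_subset (Phi_smooth sf b) => r [].
apply: (@diff_level_set _ _ _ B (Phi b \o ci q)).
- by apply: filterS nW => y; apply: Csmooth_diff; exact: sP.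
- by move=> j; have h := Csmooth_deriv (B j) (sP q) 0%N; exact: h.
- by move=> j; exact: (hfield_Phi sf rk rg (fun=> delta_mx 0 j) bq).
- by have [h _] := verticalE sf v bq; exact: h.
- exact: smooth_diff sc (cd_id q) Uq.
apply: filterS nW => y /in_img[qy [Uy by_] yE] /=.
rewrite (ciK (cd_id q)) => e; apply: c0 => //.
by rewrite -(ciK by_) e ciK.
Qed.

Lemma lie_metric_sym Z X Y q : lie_metric g Z X Y q = lie_metric g Z Y X q.
Proof.
have e : ipf g X Y = ipf g Y X by apply/funext => r; rewrite /ipf ipC.
rewrite /lie_metric e (ipC rg q _ (Y q)) (ipC rg q (X q)).
by rewrite -addrA [X in _ + X]addrC addrA.
Qed.

Lemma lie_metric_locald U Z X X' Y q : open U -> U q -> vf_smooth_on U X' ->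
  vf_smooth_on U Y -> (forall r, U r -> X r = X' r) ->
  lie_metric g Z X Y q = lie_metric g Z X' Y q.
Proof.
move=> oU Uq sX' sY XX'.
have e1 : ddir (ipf g X Y) q (Z q) = ddir (ipf g X' Y) q (Z q).
  apply: (ddir_near_eq (Z q) (ip_smooth rg oU sX' sY) Uq).
  by apply: filterS (near_open oU Uq) => r Ur; rewrite /ipf XX'.
have e2 : lie_bracket Z X q = lie_bracket Z X' q.
  by rewrite lie_bracket_anti (lie_bracket_locall Z oU sX' XX' Uq) -lie_bracket_anti.
by rewrite /lie_metric e1 e2 (XX' q Uq).
Qed.

Lemma lie_metric_addd U Z X X' Y q : open U -> U q -> vf_smooth_on U X ->
  vf_smooth_on U X' -> vf_smooth_on U Y ->
  lie_metric g Z (fun r => X r + X' r) Y q = lie_metric g Z X Y q + lie_metric g Z X' Y q.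
Proof.
move=> oU Uq sX sX' sY.
have e1 : ddir (ipf g (fun r => X r + X' r) Y) q (Z q) =
    ddir (ipf g X Y) q (Z q) + ddir (ipf g X' Y) q (Z q).
  rewrite -(ddir_add (Z q) (ip_smooth rg oU sX sY) (ip_smooth rg oU sX' sY) Uq).
  by congr (ddir _ _ _); apply/funext => r; rewrite /ipf ipDl.
have e2 : lie_bracket Z (fun r => X r + X' r) q = lie_bracket Z X q + lie_bracket Z X' q.
  apply: (etrans (lie_bracket_anti _ _ _)); rewrite (lie_bracket_addl Z oU sX sX' Uq) opprD.
  exact: esym (congr2 +%R (lie_bracket_anti Z X q) (lie_bracket_anti Z X' q)).
rewrite /lie_metric e1 e2 !ipDl.
have alg (a1 a2 a3 a4 a5 a6 : R) :
  a1 + a2 - (a3 + a4) - (a5 + a6) = a1 - a3 - a5 + (a2 - a4 - a6) by ring.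
exact: alg.
Qed.

Lemma lie_metric_scaled0 U Z X Y (c : M -> R) q : open U -> U q -> smooth_on U c ->
  vf_smooth_on U X -> vf_smooth_on U Y -> c q = 0 -> ddir c q (Z q) = 0 ->
  lie_metric g Z (fun r => c r *: X r) Y q = 0.
Proof.
move=> oU Uq sc sX sY c0 dc0.
have e1 : ddir (ipf g (fun r => c r *: X r) Y) q (Z q) = 0.
  rewrite (_ : ipf g _ Y = fun r => c r * ipf g X Y r); last first.
    by apply/funext => r; rewrite /ipf ipZl.
  by rewrite (ddir_mul (Z q) sc (ip_smooth rg oU sX sY) Uq) c0 dc0 mul0r mulr0 addr0.
have e2 : lie_bracket Z (fun r => c r *: X r) q = 0.
  rewrite lie_bracket_anti (lie_bracket_scalel Z oU sc sX Uq) c0 dc0.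
  by rewrite !scale0r subr0 oppr0.
by rewrite /lie_metric e1 e2 c0 scale0r !ip0l !subr0.
Qed.

Lemma lie_metric_sum0 U Z Y q (I : Type) (s : seq I) (c : I -> M -> R)
    (X : I -> vfield M R m) : open U -> U q ->
  (forall i, smooth_on U (c i)) -> (forall i, vf_smooth_on U (X i)) ->
  vf_smooth_on U Y -> (forall i, c i q = 0) -> (forall i, ddir (c i) q (Z q) = 0) ->
  lie_metric g Z (fun r => \sum_(i <- s) c i r *: X i r) Y q = 0.
Proof.
move=> oU Uq sc sX sY c0 dc0; elim: s => [|i s IH].
  rewrite (_ : (fun r => _) = fun r => (0 : R) *: (0 : 'rV[R]_m)); last first.
    by apply/funext => r; rewrite big_nil scaler0.
  apply: (lie_metric_scaled0 oU Uq (smooth_on_cst U (0 : R)) (vf_smooth0 U) sY) => //.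
  exact: ddir_cst.
rewrite (_ : (fun r => _) = fun r => c i r *: X i r + \sum_(i <- s) c i r *: X i r); last first.
  by apply/funext => r; rewrite big_cons.
have s1 := vf_smoothZ oU (sc i) (sX i).
have s2 : vf_smooth_on U (fun r => \sum_(i <- s) c i r *: X i r).
  by apply: vf_smooth_sum => // j _; exact: vf_smoothZ.
rewrite (lie_metric_addd Z oU Uq s1 s2 sY) IH addr0.
exact: (lie_metric_scaled0 oU Uq (sc i) (sX i) sY (c0 i) (dc0 i)).
Qed.

(* X - vpart X is a combination of horizontal fields whose coefficients vanish
   on the fiber. *)
Lemma lie_metric_fiber U Z X Y q : open U -> U q -> vf_smooth_on U Y ->
  vertical f q (Z q) -> tangent_to_fiber f (f q) U X ->
  lie_metric g Z X Y q = lie_metric g Z (fun r => vpart f g r (X r)) Y q.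
Proof.
move=> oU Uq sY vZ [sX tX]; pose b := f q.
have bq : cd b (f q) by exact: cd_id.
pose V := U `&` f @^-1` cd b.
have oV : open V by apply: openI => //; exact: fcd_open.
have Vq : V q by [].
have VU : V `<=` U by move=> r [].
have Vb : V `<=` f @^-1` cd b by move=> r [].
have sXV := vf_smooth_subset VU sX; have sYV := vf_smooth_subset VU sY.
have sP : smooth_on V (Phi b) by apply: smooth_on_subset (Phi_smooth sf b) => r [].
pose c j r := ddir (Phi b) r (X r) 0 j.
pose L j := hfield f g b (fun=> delta_mx 0 j).
have sc j : smooth_on V (c j) by apply: smooth_on_coord => //; exact: smooth_ddir_rV.
have sL j : vf_smooth_on V (L j).
  by apply: (hfield_smooth sf rk rg) => //; exact: smooth_on_cst.
have c0 r j : V r -> f r = f q -> c j r = 0.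
  move=> [Ur br] frq; have [h _] := verticalE sf (X r) br.
  have e := h (tX r Ur frq).
  by apply: etrans (congr1 (fun z : 'rV_p => z 0 j) e) _; rewrite mxE.
have [sv _] := vpart_smooth sf rk rg oV sXV.
have sS : vf_smooth_on V (fun r => \sum_j c j r *: L j r).
  by apply: vf_smooth_sum => // j _; exact: vf_smoothZ.
have XE r : V r -> X r = vpart f g r (X r) + \sum_j c j r *: L j r.
  move=> [Ur br]; rewrite -[LHS](subrK (X r *m dmap f r *m hlift f g r)); congr (_ + _).
  rewrite (dmap_cfield sf (X r) br) {1}(row_sum_delta (ddir _ _ _)) {1}/cfield linear_sum mulmx_suml.
  by apply: eq_bigr => j _; rewrite linearZ -scalemxAl.
rewrite (lie_metric_locald Z oV Vq (vf_smoothD oV sv sS) sYV XE).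
rewrite (lie_metric_addd Z oV Vq sv sS sYV).
rewrite (lie_metric_sum0 _ oV Vq sc sL sYV) ?addr0 //.
- by move=> j; exact: c0.
- by move=> j; apply: (ddir_fiber oV Vq (sc j)) => // r Vr; exact: c0.
Qed.

(** The formula for [lie_bracket] uses a chart varying with the point; smoothness of the bracket is
    read off nabla_Z A - nabla_A Z instead. *)
Lemma lie_metric_smooth nabla U Z X Y : is_levi_civita g nabla -> open U ->
  vf_smooth_on U Z -> vf_smooth_on U X -> vf_smooth_on U Y ->
  smooth_on U (lie_metric g Z X Y).
Proof.
move=> lc oU sZ sX sY.
have sB A : vf_smooth_on U A -> vf_smooth_on U (lie_bracket Z A).
  move=> sA.
  have s1 := vf_smoothB oU (lc_smooth lc oU sZ sA) (lc_smooth lc oU sA sZ).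
  by apply: (vf_smooth_eq oU _ s1) => r Ur; exact: (lc_torsion lc oU sZ sA Ur).
apply: (smooth_onB oU); first apply: (smooth_onB oU).
- exact: (smooth_ddir oU (ip_smooth rg oU sX sY) sZ).
- exact: (ip_smooth rg oU (sB X sX) sY).
- exact: (ip_smooth rg oU sX (sB Y sY)).
Qed.

(* Pointwise conformality suffices: the factor is L_xi g (E, E) for a local
   unit vertical field E, hence smooth. *)
Lemma conformal_killing_of_pointwise nabla xi : is_levi_civita g nabla ->
  (0 < m - p)%N -> vertical_on f setT xi ->
  (forall q, exists lam, conformal_at f g xi q lam) ->
  forall x, fiber_conformal_killing f g xi x.
Proof.
move=> lc mp [sxi vxi] h x; pose lam q := sval (cid (h q)).
have lamP q : conformal_at f g xi q (lam q) by exact: svalP (cid (h q)).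
exists lam.
  move=> q fq; have [U [E [oU Uq [vE oE _]]]] := local_vframe sf rk rg q.
  pose i := Ordinal mp; have [sE _] := vE i.
  exists U, (lie_metric g xi (E i) (E i)); split=> //.
    exact: (lie_metric_smooth lc oU (vf_smooth_subset (@subsetT _ U) sxi) sE sE).
  move=> r Ur _; rewrite (lamP r U (E i) (E i) oU Ur (vE i) (vE i)).
  by rewrite oE // eqxx mulr1.
move=> U X Y oU tX tY q Uq fqx; rewrite -fqx in tX tY.
have [sX wX] := tX; have [sY wY] := tY.
have vX := vpart_smooth sf rk rg oU sX; have vY := vpart_smooth sf rk rg oU sY.
have vxq : vertical f q (xi q) by exact: vxi.
(* [lie_metric_fiber] makes only the first of the two fields vertical; symmetry of the Lie
   derivative lets it act on the second. *)
rewrite (lie_metric_fiber oU Uq sY vxq tX) lie_metric_sym.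
have [sX' _] := vX.
rewrite (lie_metric_fiber oU Uq sX' vxq tY) lie_metric_sym.
rewrite (lamP q U _ _ oU Uq vX vY).
by rewrite !vpart_id //; [exact: wY|exact: wX].
Qed.

End FiberFields.

(** * Lifts of one field of N for different metrics *)

Section BasicLifts.
Context {R : realType} {m p : nat} {M : manifold R m} {N : manifold R p}.
Implicit Types (q r : M) (b : N) (U : set M) (X Y Z : vfield M R m) (u v : 'rV[R]_m).
Context (f : M -> N) (sf : smooth_map f) (rk : forall q, \rank (dmap f q) = p).
Context (V : vfield N R p) (sV : vf_smooth_on setT V).

Local Notation cd a := (cdom (chart_at a)).
Local Notation Phi b := (cmap (chart_at b) \o f).

Definition basic_lift (g : M -> 'M[R]_m) : vfield M R m := fun r => V (f r) *m hlift f g r.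

Lemma basic_lift_Phi g b r : riemannian g -> cd b (f r) ->
  ddir (Phi b) r (basic_lift g r) = comps (chart_at b) V (f r).
Proof. by move=> rg br; rewrite (ddir_Phi sf) // hliftKr. Qed.

Lemma basic_lift_smooth g : riemannian g -> vf_smooth_on setT (basic_lift g).
Proof.
move=> rg; apply: vf_smooth_local => q _; pose b := f q.
have ob := fcd_open sf b.
exists (f @^-1` cd b); first exact: cd_id.
apply: (@vf_smooth_eq _ _ _ _ (hfield f g b (comps (chart_at b) V \o f))) => //.
  by move=> r br; rewrite /hfield /basic_lift /= cfieldE.
apply: (hfield_smooth sf rk rg) => //; apply: smooth_on_rV => // j.
apply: (smooth_pullback sf (h := fun x => comps (chart_at b) V x 0 j)); first exact: cd_open.
apply: smooth_on_coord; first exact: cd_open.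
by apply: smooth_on_subset (sV b).
Qed.

Lemma basic_lift_horizontal g r : riemannian g -> horizontal f g r (basic_lift g r).
Proof. by move=> rg; exact: hlift_horizontal. Qed.

Lemma basic_lift_bracket g U X q : riemannian g -> open U -> U q -> vertical_on f U X ->
  vertical f q (lie_bracket (basic_lift g) X q).
Proof.
move=> rg oU Uq vX.
apply: (@bracket_vertical_proj _ _ _ _ _ _ sf U X _ (cd (f q)) (comps (chart_at (f q)) V)) => //.
- exact: vf_smooth_subset (@subsetT _ U) (basic_lift_smooth rg).
- exact: cd_open.
- exact: cd_id.
- by apply: smooth_on_subset (sV (f q)).
- by move=> r Ur br _; exact: basic_lift_Phi.
Qed.

(** Along the g1-lift, L g0 and L g1 agree on vertical fields, so umbilicity for g1 controls that
    term and umbilicity for g0 the other; the factors subtract. *)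
Lemma basic_lift_conformal g0 g1 q : riemannian g0 -> riemannian g1 ->
  umbilical_fibers f g0 -> umbilical_fibers f g1 ->
  (forall r u v, vertical f r u -> vertical f r v -> ip g0 r u v = ip g1 r u v) ->
  exists lam, conformal_at f g0 (fun r => basic_lift g1 r - basic_lift g0 r) q lam.
Proof.
move=> rg0 rg1 um0 um1 g01.
have s0 := basic_lift_smooth rg0; have s1 := basic_lift_smooth rg1.
have [l0 c0] := umbilical_conformal sf rk rg0 um0 openT (Logic.I : setT q) s0
  (fun r _ => basic_lift_horizontal (r := r) rg0).
have [l1 c1] := umbilical_conformal sf rk rg1 um1 openT (Logic.I : setT q) s1
  (fun r _ => basic_lift_horizontal (r := r) rg1).
exists (l1 - l0) => U X Y oU Uq vX vY.
have [_ wX] := vX; have [_ wY] := vY.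
have sN : vf_smooth_on setT (fun r => (-1 : R) *: basic_lift g0 r).
  exact: (vf_smoothZ openT (smooth_on_cst setT (-1 : R)) s0).
have -> : (fun r => basic_lift g1 r - basic_lift g0 r) =
    (fun r => basic_lift g1 r + (-1 : R) *: basic_lift g0 r).
  by apply/funext => r; rewrite scaleN1r.
rewrite (lie_metric_addl g0 X Y openT s1 sN (Logic.I : setT q)).
have e := lie_metric_scalel g0 openT (smooth_on_cst setT (-1 : R)) s0 (Logic.I : setT q)
  (ddir_cst (-1 : R) q (X q)) (ddir_cst (-1 : R) q (Y q)).
rewrite e (c0 U X Y oU Uq vX vY).
have e1 := lie_metric_vertical rg1 oU Uq vX vY g01
  (basic_lift_bracket rg1 oU Uq vX) (basic_lift_bracket rg1 oU Uq vY).
rewrite e1 (c1 U X Y oU Uq vX vY) -(g01 q _ _ (wX q Uq) (wY q Uq)).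
by move: (ip _ _ _ _) => a; ring.
Qed.

End BasicLifts.

Section Direct.
Context {R : realType} {m p : nat} {M : manifold R m} {N : manifold R p}.
Context (f : M -> N) (gN : N -> 'M[R]_p).

(** A submersion metric is determined by its restriction to the fibers and its horizontal lifts,
    since on lifts it is the pullback of [gN]. Equal lifts would force equal metrics. *)
Lemma hlift_neq g0 g1 : riemannian g0 -> riemannian g1 ->
  riemannian_submersion f g0 gN -> riemannian_submersion f g1 gN ->
  (forall q u v, vertical f q u -> vertical f q v -> ip g1 q u v = ip g0 q u v) ->
  g1 <> g0 -> exists q (y : 'rV[R]_p), y *m hlift f g1 q != y *m hlift f g0 q.
Proof.
move=> rg0 rg1 rs0 rs1 g10 neq; apply: contrapT => H; apply: neq.
have [_ rk h0] := rs0; have [_ _ h1] := rs1.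
have hE q : hlift f g1 q = hlift f g0 q.
  apply/row_matrixP => i; rewrite !rowE; apply/eqP/negPn/negP => ne.
  by apply: H; exists q, (delta_mx 0 i).
have hip g q (y z : 'rV[R]_p) : riemannian g -> riemannian_submersion f g gN ->
    ip g q (y *m hlift f g q) (z *m hlift f g q) = ip gN (f q) y z.
  move=> rg [_ _ h]; rewrite h; [|exact: (hlift_horizontal rg)|exact: (hlift_horizontal rg)].
  by rewrite !(hliftKr rk rg).
apply/funext => q; apply/matrixP => i j.
have gE (g : M -> 'M[R]_m) : g q i j = ip g q (delta_mx 0 i) (delta_mx 0 j).
  by rewrite /ip -rowE trmx_delta -colE !mxE.
rewrite !gE (ip_split rk rg1) (ip_split rk rg0) (hip g1) // (hip g0) //.
have vE u : vpart f g1 q u = vpart f g0 q u by rewrite /vpart hE.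
rewrite !vE g10 //; exact: (vpart_vertical rk rg0).
Qed.

Theorem variation_killing (g0 g1 : M -> 'M[R]_m) : riemannian g0 -> Riem f g0 g1 ->
  riemannian_submersion f g0 gN -> riemannian_submersion f g1 gN ->
  umbilical_fibers f g0 -> umbilical_fibers f g1 -> g1 <> g0 ->
  exists xi : M -> 'rV[R]_m,
    [/\ vertical_on f setT xi, nontrivial_vf xi &
        forall x : N, fiber_conformal_killing f g0 xi x].
Proof.
move=> rg0 [rg1 g10] rs0 rs1 um0 um1 neq.
have [q [y hy]] := hlift_neq rg0 rg1 rs0 rs1 g10 neq.
have [sf rk _] := rs0.
have [rho [K [srho rho0 cK Kcd rhoK]]] := bump (f q).
pose b := f q.
(* A global field on N whose value at [f q] is a positive multiple of [y], the vector with different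
   lifts at [q]. *)
pose V : vfield N R p := fun x => rho x *: cfield b y x.
have sV : vf_smooth_on setT V.
  apply: vf_smooth_local => x _; have [bx|nbx] := pselect (cdom (chart_at b) x).
    exists (cdom (chart_at b)) => //; apply: vf_smoothZ; first exact: cd_open.
      exact: smooth_on_subset (@subsetT _ _) srho.
    exact: cfield_smooth.
  exists (~` K); first by move=> /Kcd.
  apply: (@vf_smooth_eq _ _ _ _ (fun=> 0)); last exact: vf_smooth0.
    by rewrite openC.
  by move=> z nKz; rewrite /V rhoK // scale0r.
pose xi : vfield M R m := fun r => basic_lift f V g1 r - basic_lift f V g0 r.
have vxi : vertical_on f setT xi.
  split; first exact: (vf_smoothB openT (basic_lift_smooth sf rk sV rg1) (basic_lift_smooth sf rk sV rg0)).
  by move=> r _; rewrite /vertical mulmxBl /basic_lift (hliftKr rk rg1) (hliftKr rk rg0) subrr.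
have xiq : xi q != 0.
  rewrite /xi /basic_lift /V cfield_self -!scalemxAl -scalerBr scaler_eq0 negb_or.
  by rewrite (gt_eqF rho0) subr_eq0.
(* [xi q] is a nonzero vertical vector; a unit vertical field is required to make the conformal
   factor smooth. *)
have mp : (0 < m - p)%N.
  rewrite lt0n; apply: contra xiq => /eqP mp0.
  have : (xi q <= kermx (dmap f q))%MS.
    by rewrite sub_kermx; apply/eqP; have [_ h] := vxi; exact: h.
  have -> : kermx (dmap f q) = 0 by apply/eqP; rewrite -mxrank_eq0 mxrank_ker rk mp0.
  by rewrite submx0.
have [nabla [lc _]] := um0.
exists xi; split=> //; first by exists q.
apply: (conformal_killing_of_pointwise sf rk rg0 lc mp vxi) => r.
by apply: (basic_lift_conformal sf rk sV) => // s u v vu vv; rewrite g10.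
Qed.

End Direct.

Unset Implicit Arguments.

Theorem theorem3p15 (R : realType) (m p : nat) (M : manifold R m)
    (N : manifold R p) (gN : N -> 'M[R]_p) (g0 : M -> 'M[R]_m) (f : M -> N) :
  (0 < p)%N ->
  riemannian gN -> riemannian g0 ->
  riemannian_submersion f g0 gN -> umbilical_fibers f g0 ->
  ((exists (eps : R) (g : R -> M -> 'M[R]_m),
      nontrivial_variation f g0 eps g /\
      forall t, - eps < t < eps ->
        riemannian_submersion f (g t) gN /\ umbilical_fibers f (g t)) ->
   exists xi : M -> 'rV[R]_m,
     [/\ vertical_on f setT xi, nontrivial_vf xi &
         forall x : N, fiber_conformal_killing f g0 xi x])
  /\
  ((exists xi : M -> 'rV[R]_m,
     [/\ vertical_on f setT xi, nontrivial_vf xi, bounded_vf g0 xi &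
         forall x : N, fiber_conformal_killing f g0 xi x]) ->
   exists (eps : R) (g : R -> M -> 'M[R]_m),
     nontrivial_variation f g0 eps g /\
     forall t, - eps < t < eps ->
       riemannian_submersion f (g t) gN /\ umbilical_fibers f (g t)).
Proof.
move=> p0 rgN rg0 rs um; split=> [[eps [g [[[e0 gR _ g0E] [t ht gt]] gP]]]|[xi [vxi nxi _ cxi]]].
  have [rst umt] := gP t ht; have Rt := gR t ht.
  exact: (variation_killing rg0 Rt rs rst um umt gt).
exact: (killing_variation p0 rg0 rs um vxi nxi cxi).
Qed.
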